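(* Let $\mathcal{X}$ be a nonsingular plane curve over the finite field $\mathbb{F}_q$ with homogeneous equation $XY^{n}+YZ^{n}+ZX^{n}+XYZ\cdot G(X,Y,Z)=0$, and let $P_1=(1:0:0)$, $P_2=(0:1:0)$. Let $i,j\ge 1$ be integers with $i+j\le n-1$, and set $$(\alpha_1,\alpha_2)=((i-1)n+1,\ (j-1)n+i),\qquad (\beta_1,\beta_2)=(in-i-j,\ jn-j).$$ Let $Q_1,\ldots,Q_m$ be $m$ distinct points of $\mathcal{X}(\mathbb{F}_q)\setminus\{P_1,P_2\}$, and let $D=Q_1+\cdots+Q_m$ and $F_1=(\alpha_1+\beta_1-1)P_1+(\alpha_2+\beta_2-1)P_2$. If $\frac{n+2}{2}\le i+j\le n-1$ and $m\ge 2n^2-4n-2$, then the Goppa code $C_{\Omega}(D,F_1)$ has length $m$, dimension $$\dim C_{\Omega}(D,F_1)=m+\tfrac{1}{2}n^2+\left(\tfrac{3}{2}-2(i+j)\right)n+2j,$$ and minimum distance $$\mathrm{d}(C_{\Omega}(D,F_1))\ge (2(i+j)+1)n-n^2-2i-4j+2.$$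
   Context: Here $n\ge 3$ and $G(X,Y,Z)\in\mathbb{F}_q[X,Y,Z]$ is either zero or homogeneous of degree $n-2$; nonsingular means nonsingular over the algebraic closure of $\mathbb{F}_q$. For a divisor $F$ on $\mathcal{X}$ defined over $\mathbb{F}_q$ and $D=Q_1+\cdots+Q_m$ with $Q_1,\ldots,Q_m$ distinct $\mathbb{F}_q$-rational points not in the support of $F$, the Goppa (algebraic geometry) code $C_{\Omega}(D,F)$ is the image of the $\mathbb{F}_q$-linear map $\Omega(F-D)\to\mathbb{F}_q^m$, $\eta\mapsto(\operatorname{res}_{Q_1}(\eta),\ldots,\operatorname{res}_{Q_m}(\eta))$, where $\Omega(F-D)$ is the $\mathbb{F}_q$-space of differentials $\eta$ on $\mathcal{X}$ (over $\mathbb{F}_q$) such that $\eta=0$ or $\operatorname{div}(\eta)\ge F-D$. Minimum distance is with respect to the Hamming metric. *)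

(* Defs.v *)
From HB Require Import structures.
From mathcomp Require Import all_boot all_order all_algebra all_field.
From mathcomp Require Import generic_quotient ring_quotient.
From mathcomp Require Import boolp.
From mathcomp Require Import freeg mpoly.

Set Implicit Arguments.
Unset Strict Implicit.
Unset Printing Implicit Defensive.

Import GRing.Theory Num.Theory.
Local Open Scope ring_scope.
Local Open Scope quotient_scope.

(* The module of Kaehler differentials of a field K over the image of
   c : F -> K: the free K-module on the symbols << x >>, x in K, modulo the
   smallest submodule [kaehler_rel] that makes x |-> << x >> a derivation
   vanishing on constants. *)
Section Kaehler.
Variables (F K : fieldType) (c : {rmorphism F -> K}).

Inductive kaehler_rel : {freeg K / K} -> Prop :=
| kaehler_rel0 : kaehler_rel 0
| kaehler_rel_lin a w w' :
    kaehler_rel w -> kaehler_rel w' -> kaehler_rel (a *: w + w')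
| kaehler_relD x y : kaehler_rel (<< x + y >> - << x >> - << y >>)
| kaehler_relM x y : kaehler_rel (<< x * y >> - x *: << y >> - y *: << x >>)
| kaehler_relC a : kaehler_rel << c a >>.

Definition kaehler_pred : {pred {freeg K / K}} := fun w => `[< kaehler_rel w >].

Lemma kaehler_predP w : reflect (kaehler_rel w) (w \in kaehler_pred).
Proof. exact: asboolP. Qed.

Lemma kaehler_predZ a w : w \in kaehler_pred -> a *: w \in kaehler_pred.
Proof.
move=> /kaehler_predP kw; apply/kaehler_predP; rewrite -[_ *: _]addr0.
exact: kaehler_rel_lin kw kaehler_rel0.
Qed.

Lemma kaehler_zmod_closed : zmod_closed kaehler_pred.
Proof.
split=> [|w w' /kaehler_predP kw /kaehler_predP kw'].
  by apply/kaehler_predP; apply: kaehler_rel0.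
apply/kaehler_predP; rewrite addrC -scaleN1r.
exact: kaehler_rel_lin kw' kw.
Qed.

HB.instance Definition _ :=
  GRing.isZmodClosed.Build {freeg K / K} kaehler_pred kaehler_zmod_closed.

Definition kaehler := Quotient.quot kaehler_pred.
HB.instance Definition _ := GRing.Zmodule.on kaehler.

Definition kaehler_mk (w : {freeg K / K}) : kaehler :=
  \pi_(Quotient.quot kaehler_pred) w.

Lemma kaehler_mkP w w' :
  reflect (kaehler_mk w = kaehler_mk w') (w - w' \in kaehler_pred).
Proof.
rewrite -[w - w' \in _]/(Quotient.equiv kaehler_pred w w').
by rewrite Quotient.equivE Quotient.idealrBE; apply: eqP.
Qed.

Lemma kaehler_mkD : {morph kaehler_mk : w w' / w + w'}.
Proof. by move=> w w'; rewrite /kaehler_mk !piE. Qed.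

Definition kaehler_repr (e : kaehler) : {freeg K / K} :=
  repr (e : Quotient.quot kaehler_pred).

Lemma kaehler_reprK : cancel kaehler_repr kaehler_mk.
Proof. exact: reprK. Qed.

Definition kaehler_scale (a : K) (e : kaehler) : kaehler :=
  kaehler_mk (a *: kaehler_repr e).

Lemma kaehler_scale_mk a w : kaehler_scale a (kaehler_mk w) = kaehler_mk (a *: w).
Proof.
apply/kaehler_mkP; rewrite -scalerBr; apply/kaehler_predZ/kaehler_mkP.
exact: kaehler_reprK.
Qed.

Lemma kaehler_scaleA a b e :
  kaehler_scale a (kaehler_scale b e) = kaehler_scale (a * b) e.
Proof. by rewrite -[e]kaehler_reprK !kaehler_scale_mk scalerA. Qed.

Lemma kaehler_scale1 : left_id 1 kaehler_scale.
Proof. by move=> e; rewrite -[e]kaehler_reprK kaehler_scale_mk scale1r. Qed.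

Lemma kaehler_scaleDr : right_distributive kaehler_scale +%R.
Proof.
move=> a e e'; rewrite -[e]kaehler_reprK -[e']kaehler_reprK -kaehler_mkD.
by rewrite !kaehler_scale_mk scalerDr kaehler_mkD.
Qed.

Lemma kaehler_scaleDl e : {morph kaehler_scale^~ e : a b / a + b}.
Proof.
move=> a b /=; rewrite -[e]kaehler_reprK !kaehler_scale_mk scalerDl.
exact: kaehler_mkD.
Qed.

HB.instance Definition _ := GRing.Zmodule_isLmodule.Build K kaehler
  kaehler_scaleA kaehler_scale1 kaehler_scaleDr kaehler_scaleDl.

Definition kaehler_d (x : K) : kaehler := kaehler_mk << x >>.

End Kaehler.

Section PlaneCurve.
Variable F : finFieldType.

Definition Fbar : closedFieldType := tag (countable_algebraic_closure F).
Definition to_Fbar : {rmorphism F -> Fbar} :=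
  sval (tagged (countable_algebraic_closure F)).

Definition eval_at (L : fieldType) (h : {rmorphism F -> L}) (P : 'rV[L]_3)
  (A : {mpoly F[3]}) : L := mmap h (P 0) A.

(* Points of the projective plane are given by nonzero row vectors of
   homogeneous coordinates; P and Q are the same point when (P == Q)%MS. *)
Definition on_curve (f : {mpoly F[3]}) (P : 'rV[Fbar]_3) : Prop :=
  P != 0 /\ eval_at to_Fbar P f = 0.

Definition geom_point (P : 'rV[F]_3) : 'rV[Fbar]_3 := map_mx to_Fbar P.

Definition nonsingular (f : {mpoly F[3]}) : Prop :=
  forall P, on_curve f P -> exists l, eval_at to_Fbar P (mderiv l f) != 0.

(* The function field over F of the plane curve f = 0: a field generated over
   F by the ratios of the coordinates of a point [ff_gen] at which exactly the
   forms divisible by f vanish.  It is determined by f up to isomorphism. *)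
Record function_field (f : {mpoly F[3]}) := FunctionField {
  ff_sort :> fieldType;
  ff_const : {rmorphism F -> ff_sort};
  ff_gen : 'rV[ff_sort]_3;
  ff_rel : forall d (A : {mpoly F[3]}), A \is d.-homog ->
    eval_at ff_const ff_gen A = 0 <-> exists B, A = f * B;
  ff_frac : forall g : ff_sort, exists d (A B : {mpoly F[3]}),
    [/\ A \is d.-homog, B \is d.-homog, eval_at ff_const ff_gen B != 0
      & g = eval_at ff_const ff_gen A / eval_at ff_const ff_gen B]
}.

(* A divisor defined over F is given by its multiplicities at the geometric
   points of the curve. *)
Definition divisor := 'rV[Fbar]_3 -> int.

Definition point_divisor (P : 'rV[F]_3) : divisor :=
  fun R => (geom_point P == R)%MS%:Z.

Section Local.
Variables (f : {mpoly F[3]}) (K : function_field f).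
Local Notation at_gen := (eval_at (ff_const K) (ff_gen K)).
Local Notation Omega := (kaehler (ff_const K)).
Local Notation "'d t" := (kaehler_d (ff_const K) t) (at level 10).

Section AtPoint.
Variable P : 'rV[Fbar]_3.
Local Notation at_P := (eval_at to_Fbar P).

Definition local_ring (g : K) : Prop := exists d (A B : {mpoly F[3]}),
  [/\ A \is d.-homog, B \is d.-homog, at_P B != 0 & g = at_gen A / at_gen B].

Definition maximal_ideal (g : K) : Prop := exists d (A B : {mpoly F[3]}),
  [/\ A \is d.-homog, B \is d.-homog, at_P B != 0, at_P A = 0
    & g = at_gen A / at_gen B].

Definition uniformizer (t : K) : Prop :=
  [/\ t != 0, maximal_ideal t
    & forall g, maximal_ideal g -> local_ring (g / t)].

Definition has_order (g : K) (k : int) : Prop := exists t,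
  [/\ uniformizer t, local_ring (g / t ^ k) & ~ maximal_ideal (g / t ^ k)].

(* F is perfect, so dt generates the differentials for every uniformizer t. *)
Definition has_diff_order (eta : Omega) (k : int) : Prop :=
  exists t g, [/\ uniformizer t, eta = g *: 'd t & has_order g k].

End AtPoint.

(* p encodes the principal part of the expansion of g in t: the coefficient of
   t^-k, k > 0, is p`_k, and p`_0 is irrelevant. *)
Definition has_residue (P : 'rV[F]_3) (eta : Omega) (a : F) : Prop :=
  exists t g (p : {poly F}),
    [/\ uniformizer (geom_point P) t, eta = g *: 'd t,
        local_ring (geom_point P) (g - (map_poly (ff_const K) p).[t^-1])
      & a = p`_1].

Definition differentials_ge (E : divisor) (eta : Omega) : Prop :=
  eta = 0 \/ forall P, on_curve f P ->
    exists2 k, has_diff_order P eta k & E P <= k.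

Definition goppa_code (m : nat) (Q : 'I_m -> 'rV[F]_3) (E : divisor) :
    {set 'rV[F]_m} :=
  [set c : 'rV[F]_m | `[< exists eta : Omega,
     differentials_ge (fun R => E R - \sum_k point_divisor (Q k) R) eta
     /\ forall k, has_residue (Q k) eta (c 0 k) >]].

End Local.

Definition hamming_dist (m : nat) (u v : 'rV[F]_m) : nat :=
  #|[set k | u 0 k != v 0 k]|.

(* The value m for a code with fewer than two words is never below the
   distance of two words. *)
Definition min_distance (m : nat) (C : {set 'rV[F]_m}) : nat :=
  \big[minn/m]_(p : 'rV[F]_m * 'rV[F]_m |
    [&& p.1 \in C, p.2 \in C & p.1 != p.2]) hamming_dist p.1 p.2.

Definition X : {mpoly F[3]} := 'X_(@Ordinal 3 0 isT).
Definition Y : {mpoly F[3]} := 'X_(@Ordinal 3 1 isT).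
Definition Z : {mpoly F[3]} := 'X_(@Ordinal 3 2 isT).

Definition curve_poly (n : nat) (G : {mpoly F[3]}) : {mpoly F[3]} :=
  X * Y ^+ n + Y * Z ^+ n + Z * X ^+ n + X * Y * Z * G.

Definition P1 : 'rV[F]_3 := delta_mx 0 (@Ordinal 3 0 isT).
Definition P2 : 'rV[F]_3 := delta_mx 0 (@Ordinal 3 1 isT).

End PlaneCurve.

Arguments P1 {F}.
Arguments P2 {F}.

(* Main.v *)
(* Differentials on a smooth plane curve of degree n + 1 are sections of O(n - 2)
   through a derivation of the function field, so the canonical divisor is
   W = (n - 2) H, with H cut out by Z = 0, and C_Omega(D, F1) consists of the
   residues of L(W - F1 + D).  A depth argument and a Nullstellensatz
   (Noether's theorem) identify L(k H) with the forms of degree k, which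
   gives l(k H) for large k.  Riemann-Roch follows by adding rational points one
   at a time: no differential has a simple pole as its only pole, so l(A) and
   l(W - A) never both jump, while the total over a long chain of divisors
   forces exactly one of them to jump at each step.  The dimension is then
   l(W - F1 + D), as W - F1 and F1 - D have negative degree.

   For the distance, a word of weight w gives v <> 0 in L(B), where B is W - F1
   plus the w points of the support.  Put beta = beta1 P1 + beta2 P2 and
   N = 2 n - 2 (i + j) + 1.  If deg B < N, then l(B + beta) < l(beta) + N by
   Riemann-Roch, so some nontrivial combination of N explicit monomials in
   L(B + beta) is v y with y in L(beta).  Its leading term makes the pole order
   gamma of y at P1 (or P2) lie in [alpha1, beta1] (or [alpha2, beta2]); but a
   monomial times y is then a differential with that point as its only pole, a
   simple one. *)

(* Orders are taken at all geometric points while functions have coefficients in [F], so every local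
   object must come from forms over [F]: uniformizers at a point with coordinates in [Fbar] are
   built with the help of Frobenius, and identities found over [Fbar] are brought down along a
   basis. A section of O(d) is kept as an element of [K], namely a form of degree d divided by X^d,
   and the degree is carried by the predicates.

   With g = n(n-1)/2, the quantity l(A) - deg A - 1 + g - l(W - A) never increases when a point is
   added to A. It vanishes for a large divisor T and, because it changes sign under A -> W - A (as
   deg W = 2g - 2), also for W - T; hence it vanishes for everything between W - T and T.

   The number N is the sum of the lengths p = n - i - j of [alpha1, beta1] and p + 1 of
   [alpha2, beta2], with one monomial for each integer in these windows. The inequality deg B >= N
   reads w >= N - deg W + deg F1, which is the stated bound. *)
Require Import Defs.
From HB Require Import structures.
From mathcomp Require Import all_boot all_order all_algebra all_field.
From mathcomp Require Import boolp.
From mathcomp Require Import freeg mpoly.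
From mathcomp Require classical_sets.
From mathcomp Require Import zify ring.

Set Implicit Arguments.
Unset Strict Implicit.
Unset Printing Implicit Defensive.

Import Order.TTheory GRing.Theory Num.Theory.
Local Open Scope ring_scope.

(** * Dimensions over a subfield *)

Section Dimension.
Variables (F K : fieldType) (c : {rmorphism F -> K}).

(** As a matrix product, so that rewriting one family in terms of another is associativity
    ([comb_mul]). *)
Definition comb r (b : 'cV[K]_r) (x : 'rV[F]_r) : K := (map_mx c x *m b) 0 0.

Lemma combE r (b : 'cV[K]_r) x : comb b x = \sum_i c (x 0 i) * b i 0.
Proof. by rewrite /comb mxE; apply: eq_bigr => i _; rewrite mxE. Qed.

Lemma comb_mul r s (b : 'cV[K]_s) (A : 'M[F]_(r, s)) x :
  comb b (x *m A) = comb (map_mx c A *m b) x.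
Proof. by rewrite /comb map_mxM mulmxA. Qed.

Lemma comb_lin r (b : 'cV[K]_r) a x y :
  comb b (a *: x + y) = c a * comb b x + comb b y.
Proof. by rewrite /comb map_mxD map_mxZ mulmxDl -scalemxAl !mxE. Qed.

Lemma comb0 r (b : 'cV[K]_r) : comb b 0 = 0.
Proof. by rewrite /comb map_mx0 mul0mx mxE. Qed.

Lemma combN r (b : 'cV[K]_r) x : comb b (- x) = - comb b x.
Proof. by rewrite /comb map_mxN mulNmx mxE. Qed.

Lemma comb_delta r (b : 'cV[K]_r) i : comb b (delta_mx 0 i) = b i 0.
Proof.
rewrite combE (bigD1 i) //= !mxE !eqxx rmorph1 mul1r big1 ?addr0 // => j.
by move=> /negbTE nji; rewrite mxE nji andbF rmorph0 mul0r.
Qed.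

Definition subsp (U : K -> Prop) :=
  U 0 /\ forall a u v, U u -> U v -> U (c a * u + v).

(** [K] is in general of infinite dimension over [F], so its finite-dimensional subspaces are
    predicates given with a basis. *)
Definition hasdim (U : K -> Prop) r := exists2 b : 'cV[K]_r,
  (forall x, comb b x = 0 -> x = 0) & forall v, U v <-> exists x, v = comb b x.

Lemma hasdim_ext U V r : (forall v, U v <-> V v) -> hasdim U r -> hasdim V r.
Proof. by move=> UV [b fb Ub]; exists b => // v; rewrite -UV. Qed.

Lemma hasdim_subsp U r : hasdim U r -> subsp U.
Proof.
case=> b fb Ub; split=> [|a u v /Ub[x ->] /Ub[y ->]]; apply/Ub.
  by exists 0; rewrite comb0.
by exists (a *: x + y); rewrite comb_lin.
Qed.

Lemma coords V s (b : 'cV[K]_s) q (w : 'cV[K]_q) :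
    (forall v, V v <-> exists x, v = comb b x) -> (forall i, V (w i 0)) ->
  exists A : 'M[F]_(q, s), w = map_mx c A *m b.
Proof.
move=> Vb Vw.
have /boolp.choice[h hP] : forall i, exists x, w i 0 = comb b x.
  by move=> i; apply/Vb.
exists (\matrix_i h i); apply/matrixP=> i j; rewrite ord1 hP combE mxE.
by apply: eq_bigr => k _; rewrite !mxE.
Qed.

(** In coordinates over a basis of [V], a basis of [U] and the family [w] give [r + q] rows of
    length [s < r + q], hence a relation; its [w]-part is nonzero because the basis of [U] is free.
    This is the source of the algebraic relations in the Nullstellensatz and of the combination of
    monomials in the distance bound. *)
Lemma hasdim_dep U V r s q (w : 'cV[K]_q) :
    hasdim U r -> hasdim V s -> (forall v, U v -> V v) ->
    (forall i, V (w i 0)) -> (s < r + q)%N ->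
  exists2 a : 'rV[F]_q, a != 0 & U (comb w a).
Proof.
move=> dU [b fb Vb] UV Vw ltsrq; have := dU => -[bU fU Ub].
have VbU i : V (bU i 0) by apply/UV/Ub; exists (delta_mx 0 i); rewrite comb_delta.
have [A eA] := coords Vb VbU; have [B eB] := coords Vb Vw.
have : (0 < \rank (kermx (col_mx A B)))%N.
  by rewrite mxrank_ker subn_gt0 (leq_ltn_trans (rank_leq_col _)).
rewrite lt0n mxrank_eq0 => /rowV0Pn[y /sub_kermxP].
rewrite -[y]hsubmxK mul_row_col => ey ny.
have ec : comb bU (lsubmx y) + comb w (rsubmx y) = 0.
  have <- : comb b (lsubmx y *m A + rsubmx y *m B) = 0 by rewrite ey comb0.
  by rewrite -[_ *m A]scale1r comb_lin rmorph1 mul1r !comb_mul -eA -eB.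
exists (rsubmx y).
  apply: contraNneq ny => r0; rewrite r0 comb0 addr0 in ec.
  by rewrite r0 (fU _ ec) row_mx0.
apply/Ub; exists (- lsubmx y); rewrite combN.
by apply/eqP; rewrite -addr_eq0 addrC ec.
Qed.

Lemma hasdim_leq U V r s :
  hasdim U r -> hasdim V s -> (forall v, U v -> V v) -> (r <= s)%N.
Proof.
move=> [bU fU Ub] [b fb Vb] UV.
have VbU i : V (bU i 0) by apply/UV/Ub; exists (delta_mx 0 i); rewrite comb_delta.
have [A eA] := coords Vb VbU; apply: contraTT isT; rewrite -ltnNge => ltsr.
have : (0 < \rank (kermx A))%N.
  by rewrite mxrank_ker subn_gt0 (leq_ltn_trans (rank_leq_col _)).
rewrite lt0n mxrank_eq0 => /rowV0Pn[y /sub_kermxP ey ny].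
by case/eqP: ny; apply: fU; rewrite eA -comb_mul ey comb0.
Qed.

Lemma hasdim_uniq U r s : hasdim U r -> hasdim U s -> r = s.
Proof.
by move=> dr ds; apply/eqP; rewrite eqn_leq !(hasdim_leq dr ds, hasdim_leq ds dr).
Qed.

Lemma hasdim0 : hasdim (fun v => v = 0) 0.
Proof.
exists 0 => [x _|v]; first by apply/rowP => -[].
split=> [->|[x ->]]; last by rewrite combE big_ord0.
by exists 0; rewrite combE big_ord0.
Qed.

Lemma hasdim_scale U r h : h != 0 -> hasdim U r -> hasdim (fun v => U (v / h)) r.
Proof.
move=> nh [b fb Ub]; have eh x : comb (h *: b) x = h * comb b x.
  by rewrite /comb -scalemxAr mxE.
exists (h *: b) => [x|v]; rewrite ?eh.
  by move=> /eqP; rewrite mulf_eq0 (negbTE nh) => /eqP/fb.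
rewrite Ub; split=> -[x ex]; exists x; first by rewrite eh -ex mulrC divfK.
by rewrite ex eh mulrC mulKf.
Qed.

Lemma hasdim_add U r v : hasdim U r -> ~ U v ->
  hasdim (fun w => exists a, U (w - c a * v)) r.+1.
Proof.
move=> dU nUv; have := dU => -[b fb Ub]; have [U0 UL] := hasdim_subsp dU.
have ecol (x : 'rV_(r + 1)) : comb (col_mx b v%:M) x =
    comb b (lsubmx x) + c (rsubmx x 0 0) * v.
  rewrite -{1}[x]hsubmxK /comb map_row_mx mul_row_col mxE; congr (_ + _).
  by rewrite mul_mx_scalar !mxE mulrC.
rewrite -addn1; exists (col_mx b v%:M) => [x|w].
  rewrite ecol => ex; have r0 : rsubmx x 0 0 = 0.
    apply/eqP/negPn/negP => nz; apply: nUv.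
    have -> : v = c (- (rsubmx x 0 0)^-1) * comb b (lsubmx x) + 0.
      rewrite addr0 rmorphN fmorphV; apply/eqP.
      rewrite mulNr -mulrN eq_sym mulrC -(inj_eq (mulIf (_ : c (rsubmx x 0 0) != 0))).
        by rewrite divfK ?fmorph_eq0 // eq_sym -addr_eq0 mulrC addrC ex.
      by rewrite fmorph_eq0.
    by apply: UL => //; apply/Ub; eexists.
  move: ex; rewrite r0 rmorph0 mul0r addr0 => /fb l0.
  rewrite -[x]hsubmxK l0; have -> : rsubmx x = 0 by apply/rowP=> i; rewrite ord1 r0 mxE.
  by rewrite row_mx0.
split=> [[a /Ub[x ex]]|[x ->]].
  exists (row_mx x a%:M); rewrite ecol row_mxKl row_mxKr -ex mxE eqxx mulr1n.
  by rewrite subrK.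
exists (rsubmx x 0 0); rewrite ecol addrK; apply/Ub; by eexists.
Qed.

Lemma hasdim_span (s : seq K) :
  exists r, exists2 U, hasdim U r & forall x, x \in s -> U x.
Proof.
elim: s => [|x s [r [U dU Us]]]; first by exists 0%N, (fun v => v = 0) => //; apply: hasdim0.
have [U0 UL] := hasdim_subsp dU.
have [Ux|nUx] := pselect (U x).
  by exists r, U => // y; rewrite inE => /orP[/eqP->|/Us].
exists r.+1, (fun w => exists a, U (w - c a * x)); first exact: hasdim_add.
move=> y; rewrite inE => /orP[/eqP->|ys].
  by exists 1; rewrite rmorph1 mul1r subrr.
by exists 0; rewrite rmorph0 mul0r subr0; apply: Us.
Qed.

(** The values of [lam] on a basis of [V] form a column of rank at most one. With a leading
    coefficient at a point as [lam], this controls the step from L(A) to L(A + P). *)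
Lemma hasdim_ker U V s (lam : K -> F) : hasdim V s ->
    (forall a u v, V u -> V v -> lam (c a * u + v) = a * lam u + lam v) ->
    (forall v, U v <-> V v /\ lam v = 0) ->
  exists r, [/\ hasdim U r, (r <= s)%N, (s <= r.+1)%N
              & (forall v, V v -> U v) <-> r = s].
Proof.
move=> dV lamL UV; have := dV => -[b fb Vb]; have [V0 VL] := hasdim_subsp dV.
have lam0 : lam 0 = 0.
  by have := lamL (-1) 0 0 V0 V0; rewrite mulr0 addr0 mulN1r addNr.
have Vbi i : V (b i 0) by apply/Vb; exists (delta_mx 0 i); rewrite comb_delta.
pose L : 'cV[F]_s := \col_i lam (b i 0).
have eL x : lam (comb b x) = (x *m L) 0 0.
  rewrite combE mxE.
  suff [_ ->] : V (\sum_i c (x 0 i) * b i 0) /\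
      lam (\sum_i c (x 0 i) * b i 0) = \sum_i x 0 i * lam (b i 0).
    by apply: eq_bigr => i _; rewrite mxE.
  elim/big_ind2: _ => [//|u1 u2 v1 v2 [Vu1 lu1] [Vv1 lv1]|i _].
    have := VL 1 _ _ Vu1 Vv1; have := lamL 1 _ _ Vu1 Vv1.
    by rewrite rmorph1 !mul1r lu1 lv1.
  have := VL (x 0 i) _ _ (Vbi i) V0; have := lamL (x 0 i) _ _ (Vbi i) V0.
  by rewrite !addr0 lam0 addr0.
pose B := row_base (kermx L); exists (\rank (kermx L)).
have dU : hasdim U (\rank (kermx L)).
  exists (map_mx c B *m b) => [x|v].
    rewrite -comb_mul => /fb /eqP; rewrite mulmx_free_eq0 ?row_base_free //.
    by move/eqP.
  rewrite UV; split=> [[/Vb[x ->]]|[y ->]].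
    rewrite eL => xL; have : (x <= B)%MS.
      rewrite eq_row_base; apply/sub_kermxP/matrixP=> i j.
      by rewrite !ord1 xL mxE.
    by case/submxP => y ->; exists y; rewrite comb_mul.
  rewrite -comb_mul; split; first by apply/Vb; eexists.
  have : (y *m B <= kermx L)%MS by rewrite -(eq_row_base (kermx L)) submxMl.
  by rewrite eL => /sub_kermxP ->; rewrite mxE.
split=> //.
- by rewrite mxrank_ker leq_subr.
- by rewrite mxrank_ker; have := rank_leq_col L; lia.
split=> [VU|er v Vv].
  apply: hasdim_uniq dU _; apply: hasdim_ext dV => v.
  by split=> [/VU //|/UV[]].
apply/UV; split=> //; have /Vb[x ->] := Vv; rewrite eL.
have /eqP: \rank L = 0%N.
  by have := rank_leq_row L; move: er; rewrite mxrank_ker; lia.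
by rewrite mxrank_eq0 => /eqP->; rewrite mulmx0 mxE.
Qed.

Lemma hasdim_vspace (vT : vectType F) (W : {vspace vT}) (psi : vT -> K) U :
    (forall a u v, psi (a *: u + v) = c a * psi u + psi v) ->
    (forall u, u \in W -> psi u = 0 -> u = 0) ->
    (forall v, U v <-> exists2 u, u \in W & v = psi u) ->
  hasdim U (\dim W).
Proof.
move=> psiL psi0 UW; pose b : 'cV[K]_(\dim W) := \col_i psi (vbasis W)`_i.
have p0 : psi 0 = 0.
  have := psiL (-1) 0 0.
  by rewrite scaler0 addr0 rmorphN rmorph1 mulN1r addNr.
have eb x : comb b x = psi (\sum_i x 0 i *: (vbasis W)`_i).
  rewrite combE.
  elim/big_ind2: _ => [|u1 u2 v1 v2 -> ->|i _]; rewrite ?p0 //.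
    by have := psiL 1 u1 v1; rewrite scale1r rmorph1 mul1r => ->.
  by have := psiL (x 0 i) (vbasis W)`_i 0; rewrite !addr0 p0 addr0 mxE => ->.
exists b => [x|v].
  rewrite eb => /psi0 h; apply/rowP => i; rewrite mxE.
  have := basis_free (vbasisP W) => /freeP; apply; apply: h.
  apply: memv_suml => j _; apply: memvZ; apply: (basis_mem (vbasisP W)).
  by rewrite mem_nth // size_tuple.
rewrite UW; split=> [[u uW ->]|[x ->]].
  exists (\row_i coord (vbasis W) i u); rewrite eb {1}(coord_vbasis uW).
  by congr psi; apply: eq_bigr => i _; rewrite mxE.
exists (\sum_i x 0 i *: (vbasis W)`_i) => //.
apply: memv_suml => j _; apply: memvZ; apply: (basis_mem (vbasisP W)).
by rewrite mem_nth // size_tuple.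
Qed.

End Dimension.

(** * Homogeneous polynomials *)

Section Polynomials.
Variables (R : comNzRingType) (n : nat).
Implicit Types (p q : {mpoly R[n]}) (s : 'I_n -> {mpoly R[n]}).

Lemma mpoly_ind_ring (P : {mpoly R[n]} -> Prop) :
    (forall a, P a%:MP) -> (forall p q, P p -> P q -> P (p + q)) ->
    (forall k p, P p -> P ('X_k * p)) ->
  forall p, P p.
Proof.
move=> PC PD PX; elim/mpolyind => [|a m p _ _ Pp]; first by rewrite -mpolyC0.
apply: PD => // {p Pp}; rewrite -mul_mpolyC mpolyXE_id mulrC.
elim: (index_enum _) => [|k r IHr]; first by rewrite big_nil mul1r.
rewrite big_cons -mulrA; elim: (m k) => [|e IHe]; first by rewrite expr0 mul1r.
by rewrite exprS -mulrA; apply: PX.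
Qed.

Lemma dhomogB d p q :
  p \is d.-homog -> q \is d.-homog -> p - q \is d.-homog.
Proof. exact: rpredB. Qed.

Lemma dhomog_cast d e p : p \is d.-homog -> d = e -> p \is e.-homog.
Proof. by move=> + <-. Qed.

Lemma dhomogXU k : 'X_k \is [in R[n], 1.-homog].
Proof. by rewrite dhomogX /= mdeg1. Qed.

Lemma dhomogXUn k d : 'X_k ^+ d \is [in R[n], d.-homog].
Proof. by apply: dhomog_cast (dhomogMn d (dhomogXU k)) _; rewrite mul1n. Qed.

(** Allows a cofactor to be replaced by its homogeneous component of the expected degree. *)
Lemma pihomogMl d e p q :
  p \is e.-homog -> pihomog mdeg (e + d) (p * q) = p * pihomog mdeg d q.
Proof.
move=> hp; pose k := maxn (mmeasure mdeg q) d.+1.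
rewrite {1}(pihomog_partitionE (leq_maxl (mmeasure mdeg q) d.+1)) mulr_sumr.
rewrite raddf_sum /= (bigD1 (Ordinal (leq_maxr (mmeasure mdeg q) d.+1))) //=.
rewrite pihomog_dE ?dhomogM ?pihomogP // big1 ?addr0 // => i nid.
apply: (@pihomog_ne0 _ _ _ (e + i)%N); last by rewrite dhomogM ?pihomogP.
by rewrite eqn_add2l; apply: contra nid => /eqP eid; apply/eqP/val_inj.
Qed.

Definition subst s p : {mpoly R[n]} := mmap (@mpolyC n R) s p.
HB.instance Definition _ s := GRing.RMorphism.copy (subst s) (mmap (@mpolyC n R) s).

Lemma substC s a : subst s a%:MP = a%:MP. Proof. exact: mmapC. Qed.
Lemma substX s k : subst s 'X_k = s k.
Proof. by rewrite /subst mmapX mmap1U. Qed.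

Lemma dhomog_subst s p d : (forall k, s k \is 1.-homog) ->
  p \is d.-homog -> subst s p \is d.-homog.
Proof.
move=> hs /dhomogP hp; rewrite /subst /mmap big_seq; apply: rpred_sum => m /hp <-.
rewrite mul_mpolyC; apply: rpredZ; rewrite /mmap1 /= mdegE.
elim/big_ind2: _ => [|p1 p2 q1 q2 ? ?|k _]; rewrite ?dhomog1 ?dhomogM //.
by have := dhomogMn (m k) (hs k); rewrite mul1n.
Qed.

(** Each replacement of a factor ['X_k] by [s k] costs a multiple of their difference. When [s]
    kills or specialises one variable, this acts as division by a linear form. *)
Lemma subst_cong s p : exists q : 'I_n -> {mpoly R[n]},
  p = subst s p + \sum_k ('X_k - s k) * q k.
Proof.
elim/mpoly_ind_ring: p => [a|p1 p2 [q1 e1] [q2 e2]|k p [q ep]].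
- by exists (fun=> 0); rewrite substC big1 ?addr0 // => k _; rewrite mulr0.
- exists (fun k => q1 k + q2 k); rewrite rmorphD /= {1}e1 {1}e2 addrACA.
  by rewrite -big_split; congr (_ + _); apply: eq_bigr => k _; rewrite mulrDr.
- exists (fun l => (l == k)%:R * p + s k * q l); rewrite rmorphM /= substX.
  under eq_bigr => l _ do rewrite mulrDr.
  rewrite big_split /= (bigD1 k) //= eqxx mul1r [X in _ + (_ + X + _)]big1; last first.
    by move=> l /negbTE ->; rewrite mul0r mulr0.
  have -> : \sum_l ('X_l - s l) * (s k * q l) = s k * \sum_l ('X_l - s l) * q l.
    by rewrite mulr_sumr; apply: eq_bigr => l _; rewrite mulrCA.
  have -> : \sum_l ('X_l - s l) * q l = p - subst s p by rewrite {1}ep addrC addKr.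
  by ring.
Qed.

Lemma dhomog0E p : p \is 0.-homog -> p = (p@_0)%:MP.
Proof.
move=> hp; apply/mpolyP=> m; rewrite mcoeffC; have [->|nm] := eqVneq 0%MM m.
  by rewrite mulr1.
by rewrite mulr0 (dhomog_nemf_coeff hp) // mdeg_eq0 eq_sym.
Qed.

Lemma subst_cong_homog s p d : (forall k, s k \is 1.-homog) -> p \is d.-homog ->
  exists2 q : 'I_n -> {mpoly R[n]}, (forall k, q k \is d.-1.-homog) &
    p = subst s p + \sum_k ('X_k - s k) * q k.
Proof.
move=> hs hp; case: d hp => [|d] hp.
  exists (fun=> 0) => [k|]; first exact: dhomog0.
  rewrite big1 ?addr0 => [|k _]; last by rewrite mulr0.
  by rewrite (dhomog0E hp) substC.
have [q eq] := subst_cong s p; exists (fun k => pihomog mdeg d (q k)) => [k|].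
  exact: pihomogP.
rewrite -[LHS](pihomog_dE hp) {1}eq raddfD /= pihomog_dE ?dhomog_subst //.
congr (_ + _); rewrite raddf_sum /=; apply: eq_bigr => k _.
by rewrite -[d.+1]add1n pihomogMl // dhomogB ?dhomogXU.
Qed.

End Polynomials.

Section Forms.
Variables (R : comNzRingType) (n : nat).
Implicit Types (p q : {mpoly R[n]}).

Lemma pihomogMl_lt d e p q :
  p \is e.-homog -> (d < e)%N -> pihomog mdeg d (p * q) = 0.
Proof.
move=> hp lt; rewrite (pihomog_partitionE (leqnn (mmeasure mdeg q))) mulr_sumr.
rewrite raddf_sum /= big1 // => i _.
apply: (@pihomog_ne0 _ _ _ (e + i)%N); last by rewrite dhomogM ?pihomogP.
by rewrite neq_ltn ltn_addr ?orbT.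
Qed.

Lemma dhomog_mul_lt d e p q :
  p \is e.-homog -> p * q \is d.-homog -> (d < e)%N -> p * q = 0.
Proof. by move=> hp hpq lt; rewrite -(pihomog_dE hpq) (pihomogMl_lt _ hp lt). Qed.

Lemma dhomog_mul_factor d e p q : p \is e.-homog -> p * q \is (e + d).-homog ->
  exists2 q', q' \is d.-homog & p * q = p * q'.
Proof.
move=> hp hpq; exists (pihomog mdeg d q); first exact: pihomogP.
by rewrite -(pihomogMl _ _ hp) pihomog_dE.
Qed.

Lemma dhomog_mderiv d k p : p \is d.-homog -> p^`M(k) \is d.-1.-homog.
Proof.
move=> hp; apply/dhomogP => m; rewrite mcoeff_msupp mcoeff_mderiv => nz.
have : (m + U_(k))%MM \in msupp p.
  by rewrite mcoeff_msupp; apply: contraNneq nz => ->; rewrite mul0rn.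
by move/(dhomog_mf hp) => /= <-; rewrite mdegD mdeg1 addn1.
Qed.

Lemma mcoeff_Xmderiv k p m : ('X_k * p^`M(k))@_m = p@_m *+ m k.
Proof.
have X_ind (P : {mpoly R[n]} -> Prop) :
    (forall a m', P (a *: 'X_[m'])) -> (forall q r, P q -> P r -> P (q + r)) -> P p.
  move=> PX PD; elim/mpolyind: p => [|a m' q _ _ Pq]; last exact: PD.
  by rewrite -(scale0r 'X_[m]).
apply: (X_ind (fun p => ('X_k * p^`M(k))@_m = p@_m *+ m k)) => [a m'|q r eq er]; last first.
  by rewrite mderivD mulrDr !mcoeffD eq er mulrnDl.
rewrite mderivZ mderivX -!scalerAr !mcoeffZ -mpolyXD mcoeffX -mulrnAr; congr (_ * _).
have [m0|m1] := posnP (m' k).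
  rewrite m0 mul0r mcoeffX; case: eqP => [<-|_]; last by rewrite mul0rn.
  by rewrite m0 mulr0n.
have leU : (U_(k) <= m')%MM by rewrite lep1mP -lt0n.
rewrite addmC submK // mcoeffX; case: eqP => [<-|_].
  by rewrite mulr1.
by rewrite mulr0 mul0rn.
Qed.

Lemma mderivXU k l : ('X_k : {mpoly R[n]})^`M(l) = (k == l)%:R.
Proof.
rewrite mderivX mnmE; case: eqVneq => [->|_]; last by rewrite scale0r.
rewrite scale1r (_ : (_ - _)%MM = 0%MM) ?mpolyX0 //.
by apply/mnmP => i; rewrite mnmE subnn mnm0E.
Qed.

Lemma mderiv_exp l p (q : nat) : (p ^+ q)^`M(l) = q%:R * p ^+ q.-1 * p^`M(l).
Proof.
elim: q => [|q IHq]; first by rewrite expr0 -mpolyC1 mderivC !mul0r.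
rewrite exprS mderivM {}IHq; case: q => [|q]; first by rewrite !mul0r mulr0 addr0 mul1r mulrC.
by rewrite /= !exprS -[q.+2]addn1 natrD; ring.
Qed.

Lemma euler_identity d p : p \is d.-homog -> \sum_k 'X_k * p^`M(k) = d%:R * p.
Proof.
move=> hp; rewrite mulr_natl; apply/mpolyP => m; rewrite mcoeffMn raddf_sum /=.
under eq_bigr => k _ do rewrite mcoeff_Xmderiv.
rewrite sumrMnr -mdegE; have [mp|/memN_msupp_eq0->] := boolP (m \in msupp p).
  by rewrite -(dhomog_mf hp mp).
by rewrite !mul0rn.
Qed.

End Forms.

Section Eval.
Variables (F : finFieldType) (L : fieldType) (h : {rmorphism F -> L}).
Implicit Types (A B : {mpoly F[3]}) (P : 'rV[L]_3).

HB.instance Definition _ P :=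
  GRing.RMorphism.copy (eval_at h P) (mmap h (P 0)).

Lemma evalX P k : eval_at h P 'X_k = P 0 k.
Proof. by rewrite /eval_at mmapX mmap1U. Qed.

Lemma evalC P a : eval_at h P a%:MP = h a.
Proof. exact: mmapC. Qed.

Lemma evalZ P a A : eval_at h P (a *: A) = h a * eval_at h P A.
Proof. exact: mmapZ. Qed.

Lemma eval_scale P d A a : A \is d.-homog ->
  eval_at h (a *: P) A = a ^+ d * eval_at h P A.
Proof.
move=> hA; rewrite /eval_at /mmap mulr_sumr [LHS]big_seq [RHS]big_seq.
apply: eq_bigr => m /(dhomog_mf hA) /= <-; rewrite mulrCA; congr (_ * _).
rewrite /mmap1 mdegE -prodrXr -big_split /=; apply: eq_bigr => k _.
by rewrite mxE exprMn.
Qed.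

Lemma meval_map P A : (map_mpoly h A).@[P 0] = eval_at h P A.
Proof.
elim/mpoly_ind_ring: A => [a|p q ep eq|k p ep].
- by rewrite map_mpolyC /= mevalC evalC.
- by rewrite !rmorphD /= ep eq.
- by rewrite !rmorphM /= ep map_mpolyX mevalXU evalX.
Qed.

Lemma dhomog_map d A : A \is d.-homog -> map_mpoly h A \is d.-homog.
Proof.
move=> /dhomogP hA; apply/dhomogP => m.
by rewrite (perm_mem (msupp_map_mpoly _ (fmorph_inj h))); apply: hA.
Qed.

Lemma mderiv_map k A : map_mpoly h A^`M(k) = (map_mpoly h A)^`M(k).
Proof.
by apply/mpolyP=> m; rewrite !(mcoeff_mderiv, mcoeff_map_mpoly) raddfMn.
Qed.

End Eval.

Section VanishingForms.
Variables (L : fieldType) (n : nat).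
Implicit Types (P : 'rV[L]_n) (p : {mpoly L[n]}).

(** When [P 0 c = 1], the forms with [k != c] are linear equations of the point [P]. *)
Definition line_at P (c k : 'I_n) : {mpoly L[n]} := 'X_k - P 0 k *: 'X_c.

Lemma dhomog_line P c k : line_at P c k \is 1.-homog.
Proof. by rewrite dhomogB ?dhomogXU //; apply: dhomogZ; apply: dhomogXU. Qed.

(** Substituting [P_k X_c] for each [X_k] turns [p] into [p(P) X_c^d], which is zero here; what
    remains of [subst_cong_homog] are the multiples of the [X_k - P_k X_c], and the one for [k = c]
    vanishes since [P_c = 1]. *)
Lemma vanishing_form P c d p : P 0 c = 1 -> p \is d.-homog -> p.@[P 0] = 0 ->
  exists2 q : 'I_n -> {mpoly L[n]}, (forall k, q k \is d.-1.-homog) &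
    p = \sum_(k | k != c) line_at P c k * q k.
Proof.
move=> Pc hp p0; pose s k : {mpoly L[n]} := P 0 k *: 'X_c.
have hs k : s k \is 1.-homog by apply: dhomogZ; apply: dhomogXU.
have [q hq ep] := subst_cong_homog hs hp; exists q => //.
have sp : subst s p = p.@[P 0] *: 'X_c ^+ d.
  rewrite /subst /meval /mmap scaler_suml [LHS]big_seq [RHS]big_seq.
  apply: eq_bigr => m /(dhomog_mf hp) /= <-; rewrite mul_mpolyC -scalerA.
  congr (_ *: _); rewrite /mmap1 mdegE -prodrXr.
  by rewrite -scaler_prod; apply: eq_bigr => k _; rewrite exprZn.
by rewrite ep sp p0 scale0r add0r (bigD1 c) //= /s Pc scale1r subrr mul0r add0r.
Qed.

End VanishingForms.

(** * The function field of a smooth plane curve *)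

Definition i0 := @Ordinal 3 0 isT.
Definition i1 := @Ordinal 3 1 isT.
Definition i2 := @Ordinal 3 2 isT.

Lemma ord3P (P : 'I_3 -> Prop) : P i0 -> P i1 -> P i2 -> forall k, P k.
Proof.
move=> P0 P1 P2 [[|[|[|//]]] lt3].
- by rewrite (_ : Ordinal lt3 = i0) //; apply: val_inj.
- by rewrite (_ : Ordinal lt3 = i1) //; apply: val_inj.
- by rewrite (_ : Ordinal lt3 = i2) //; apply: val_inj.
Qed.

Lemma ord3_distinct (x y z k : 'I_3) : y != x -> z != x -> y != z ->
  k != x -> k != y -> k != z -> False.
Proof. by move: k x y z; do 4 elim/ord3P. Qed.

Lemma sum3 (V : nmodType) (E : 'I_3 -> V) : \sum_k E k = E i0 + E i1 + E i2.
Proof.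
rewrite !big_ord_recl big_ord0 addr0 addrA.
by congr (E _ + E _ + E _); apply: val_inj.
Qed.

(** [sc_dz] makes Y/X a separating element: the derivation used below sends it to the Z-derivative
    of [f]. *)
Record smooth_curve (F : finFieldType) (n : nat) (f : {mpoly F[3]}) : Prop :=
  SmoothCurve {
    sc_deg : (1 < n)%N;
    sc_homog : f \is n.+1.-homog;
    sc_smooth : nonsingular f;
    sc_dz : f^`M(i2) != 0 }.

Section FunctionField.
Variables (F : finFieldType) (n : nat) (f : {mpoly F[3]}).
Hypothesis C : smooth_curve n f.
Implicit Types (A B : {mpoly F[3]}).

Lemma sc_neq0 : f != 0.
Proof. by apply: contraNneq (sc_dz C) => ->; rewrite mderiv0. Qed.

Lemma form_mul_lt d A B : A \is d.-homog -> A = f * B -> (d <= n)%N -> A = 0.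
Proof.
move=> hA eA le; rewrite eA; apply: (dhomog_mul_lt (sc_homog C)) (_ : (d < _)%N) => //.
by rewrite -eA.
Qed.

Variable K : function_field f.
Local Notation c := (ff_const K).
Local Notation gen := (ff_gen K).
Local Notation at_P P := (eval_at (to_Fbar F) P).

Lemma gen_neq0 k : gen 0 k != 0.
Proof.
apply/eqP => g0; have hX := dhomogXU F k.
have : eval_at c gen 'X_k = 0 by rewrite evalX.
move=> /(ff_rel K hX)[B /(form_mul_lt hX)]; rewrite ltnW ?(sc_deg C) // => /(_ isT).
by move/(congr1 (mcoeff U_(k)%MM))/eqP; rewrite mcoeffX eqxx mcoeff0 oner_eq0.
Qed.

(** Coordinates normalised to X = 1, so that [ev] represents a form [A] of degree d by A/X^d.
    Sections of all the O(d) thus live in the one field [K], and the degree has to be recorded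
    separately, as in [vl] and [forms]. *)
Definition aff_gen : 'rV[K]_3 := (gen 0 i0)^-1 *: gen.
Definition ev (A : {mpoly F[3]}) : K := eval_at c aff_gen A.

HB.instance Definition _ := GRing.RMorphism.copy ev (eval_at c aff_gen).

Lemma ev_const a : ev a%:MP = c a. Proof. exact: evalC. Qed.
Lemma evZ a A : ev (a *: A) = c a * ev A. Proof. exact: evalZ. Qed.

Lemma ev_gen d A : A \is d.-homog -> ev A = (gen 0 i0)^-1 ^+ d * eval_at c gen A.
Proof. exact: eval_scale. Qed.

Lemma evX0 : ev 'X_i0 = 1.
Proof. by rewrite /ev evalX mxE mulVf ?gen_neq0. Qed.

Lemma evX_neq0 k : ev 'X_k != 0.
Proof. by rewrite /ev evalX mxE mulf_neq0 ?invr_eq0 ?gen_neq0. Qed.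

Lemma ev_eq0 d A : A \is d.-homog -> ev A = 0 <-> exists B, A = f * B.
Proof.
move=> hA; rewrite (ev_gen hA) -(ff_rel K hA); split=> [/eqP|->]; last by rewrite mulr0.
by rewrite mulf_eq0 expf_eq0 invr_eq0 (negbTE (gen_neq0 _)) andbF => /eqP.
Qed.

Lemma ev_f : ev f = 0.
Proof. by apply/(ev_eq0 (sc_homog C)); exists 1; rewrite mulr1. Qed.

Lemma ev_small d A : A \is d.-homog -> (d <= n)%N -> ev A = 0 -> A = 0.
Proof. by move=> hA le /(ev_eq0 hA)[B eA]; apply: form_mul_lt hA eA le. Qed.

Lemma ev_frac g : exists d A B,
  [/\ A \is d.-homog, B \is d.-homog, ev B != 0 & g = ev A / ev B].
Proof.
have [d [A [B [hA hB nB ->]]]] := ff_frac g; exists d, A, B.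
have nx : (gen 0 i0)^-1 ^+ d != 0 by rewrite expf_eq0 invr_eq0 (negbTE (gen_neq0 _)) andbF.
have -> : ev B = (gen 0 i0)^-1 ^+ d * eval_at c gen B by exact: ev_gen.
split=> //; first exact: mulf_neq0.
have -> : ev A = (gen 0 i0)^-1 ^+ d * eval_at c gen A by exact: ev_gen.
by rewrite -mulf_div divff // mul1r.
Qed.

Section AtPoint.
Variable P : 'rV[Fbar F]_3.
Hypothesis Pf : on_curve f P.

Lemma ev0_at d A : A \is d.-homog -> ev A = 0 -> at_P P A = 0.
Proof.
by move=> hA /(ev_eq0 hA)[B ->]; rewrite rmorphM /=; case: Pf => _ ->; rewrite mul0r.
Qed.

Lemma at_ev_neq0 d A : A \is d.-homog -> at_P P A != 0 -> ev A != 0.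
Proof. by move=> hA; apply: contraNneq => /(ev0_at hA)->. Qed.

(* The twisted function [v] of degree [d], i.e. a section of O(d), is regular
   at [P]; the homogeneous coordinates of [P] give it the value [a]. *)
Definition vl d (v : K) (a : Fbar F) := exists e A B,
  [/\ A \is (e + d).-homog, B \is e.-homog, at_P P B != 0, v = ev A / ev B
    & a = at_P P A / at_P P B].

(** Two equal fractions in [K] differ, after cross-multiplication, by a form divisible by [f], and
    such a form vanishes at [P]. *)
Lemma vl_uniq d v a b : vl d v a -> vl d v b -> a = b.
Proof.
move=> [e [A [B [hA hB nB -> ->]]]] [e' [A' [B' [hA' hB' nB']]]].
have nb := at_ev_neq0 hB nB; have nb' := at_ev_neq0 hB' nB'.
move/eqP; rewrite eqr_div // -subr_eq0 -!rmorphM -rmorphB => /eqP e0 ->.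
apply/eqP; rewrite eqr_div // -subr_eq0 -!rmorphM -rmorphB /=; apply/eqP.
apply: (@ev0_at (e + d + e')) e0; apply: dhomogB; first exact: dhomogM hA hB'.
by rewrite (_ : e + d + e' = e' + d + e)%N ?dhomogM //; lia.
Qed.

Lemma vl_form d A : A \is d.-homog -> vl d (ev A) (at_P P A).
Proof.
move=> hA; exists 0%N, A, 1; split; rewrite ?rmorph1 ?oner_eq0 ?divr1 //.
exact: dhomog1.
Qed.

Lemma vlM d e v w a b : vl d v a -> vl e w b -> vl (d + e) (v * w) (a * b).
Proof.
move=> [x [A [B [hA hB nB -> ->]]]] [y [A' [B' [hA' hB' nB' -> ->]]]].
exists (x + y)%N, (A * A'), (B * B'); rewrite !rmorphM /= !mulf_div mulf_neq0 //.
split=> //; last exact: dhomogM.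
by rewrite addnACA; apply: dhomogM.
Qed.

Lemma vlD d v w a b : vl d v a -> vl d w b -> vl d (v + w) (a + b).
Proof.
move=> [x [A [B [hA hB nB -> ->]]]] [y [A' [B' [hA' hB' nB' -> ->]]]].
exists (x + y)%N, (A * B' + A' * B), (B * B').
rewrite !(rmorphM, rmorphD) /= !addf_div ?(at_ev_neq0 hB, at_ev_neq0 hB') //.
rewrite mulf_neq0 //; split=> //; last exact: dhomogM.
apply: rpredD; first by rewrite addnAC dhomogM.
by rewrite (_ : x + y + d = y + d + x)%N ?dhomogM //; lia.
Qed.

Lemma vl_const x : vl 0 (c x) (to_Fbar F x).
Proof.
have := @vl_form 0 x%:MP; rewrite ev_const evalC; apply.
by rewrite -[x%:MP]mulr1 mul_mpolyC; apply: dhomogZ; apply: dhomog1.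
Qed.

Lemma vl0 d : vl d 0 0.
Proof. by have := @vl_form d 0 (rpred0 _); rewrite !rmorph0. Qed.

Lemma vl1 : vl 0 1 1.
Proof. by have := vl_const 1; rewrite !rmorph1. Qed.

Lemma vlN d v a : vl d v a -> vl d (- v) (- a).
Proof.
move=> hv; rewrite -mulN1r -[- a]mulN1r -[d]add0n; apply: vlM hv.
by have := vl_const (-1); rewrite !rmorphN !rmorph1.
Qed.

Lemma vlB d v w a b : vl d v a -> vl d w b -> vl d (v - w) (a - b).
Proof. by move=> hv /vlN; apply: vlD. Qed.

Lemma vl_divf d e v a B : vl (d + e) v a -> B \is e.-homog -> at_P P B != 0 ->
  vl d (v / ev B) (a / at_P P B).
Proof.
move=> [x [A [D [hA hD nD -> ->]]]] hB nB; exists (x + e)%N, A, (D * B).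
rewrite !rmorphM /= mulf_neq0 // !invfM !mulrA.
split=> //; last exact: dhomogM.
by rewrite -addnA (addnC e).
Qed.

Lemma vlV g a : vl 0 g a -> a != 0 -> vl 0 g^-1 a^-1.
Proof.
move=> [x [A [D [hA hD nD -> ->]]]] na; rewrite !addn0 in hA *.
exists x, D, A; rewrite !invf_div addn0; split=> //.
by apply: contraNneq na => ->; rewrite mul0r.
Qed.

Lemma eval_gen_ev A B d : A \is d.-homog -> B \is d.-homog ->
  eval_at c gen A / eval_at c gen B = ev A / ev B.
Proof.
move=> hA hB; rewrite (ev_gen hA) (ev_gen hB) -mulf_div divff ?mul1r //.
by rewrite expf_eq0 invr_eq0 (negbTE (gen_neq0 _)) andbF.
Qed.

Lemma local_ringP (g : K) : local_ring P (g : K) <-> exists a, vl 0 g a.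
Proof.
split=> [[d [A [B [hA hB nB ->]]]]|[a [d [A [B [hA hB nB -> _]]]]]].
  by exists (at_P P A / at_P P B), d, A, B; rewrite addn0 (eval_gen_ev hA hB).
by rewrite addn0 in hA; exists d, A, B; rewrite (eval_gen_ev hA hB).
Qed.

Lemma maximal_idealP (g : K) : maximal_ideal P (g : K) <-> vl 0 g 0.
Proof.
split=> [[d [A [B [hA hB nB A0 ->]]]]|[d [A [B [hA hB nB -> e0]]]]].
  by exists d, A, B; rewrite addn0 (eval_gen_ev hA hB) A0 mul0r.
rewrite addn0 in hA; exists d, A, B; rewrite (eval_gen_ev hA hB); split=> //.
by apply/eqP; move/esym/eqP: e0; rewrite mulf_eq0 invr_eq0 (negbTE nB) orbF.
Qed.

End AtPoint.

Lemma vl_scale P x d v a : x != 0 -> vl P d v a -> vl (x *: P) d v (x ^+ d * a).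
Proof.
move=> nx [e [A [B [hA hB nB -> ->]]]]; exists e, A, B.
rewrite (eval_scale _ _ _ hA) (eval_scale _ _ _ hB) mulf_neq0 ?expf_neq0 //.
by split=> //; rewrite exprD -(mulrA (x ^+ e)) -[RHS]mulf_div divff ?expf_neq0 // mul1r mulrA.
Qed.

Lemma on_curve_scale P x : x != 0 -> on_curve f P -> on_curve f (x *: P).
Proof.
move=> nx [nP fP]; split; first by rewrite scaler_eq0 negb_or nx.
by rewrite (eval_scale _ _ _ (sc_homog C)) fP mulr0.
Qed.

End FunctionField.

Section Hilbert.
Variables (F : finFieldType) (n : nat) (f : {mpoly F[3]}).
Hypothesis C : smooth_curve n f.
Variable K : function_field f.
Local Notation c := (ff_const K).
Local Notation ev := (@ev F f K).

Definition forms d (v : K) := exists2 A, A \is d.-homog & v = ev A.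

Lemma formsM d e v w : forms d v -> forms e w -> forms (d + e) (v * w).
Proof. by move=> [A hA ->] [B hB ->]; exists (A * B); rewrite ?dhomogM ?rmorphM. Qed.

Definition mulf e (p : dhomog 3 F e) : dhomog 3 F (n.+1 + e) :=
  DHomog (dhomogM (sc_homog C) (dhomog_is_dhomog p)).

Lemma mulf_is_linear e : linear (@mulf e).
Proof. by move=> a p q; apply: val_inj; rewrite /= mulrDr -scalerAr. Qed.

HB.instance Definition _ e := GRing.isLinear.Build F _ _ _ (@mulf e) (@mulf_is_linear e).

(** Forms of degree [d] modulo [f] times forms of degree [d - n - 1] leave
    [C(d + 2, 2) - C(d - n + 1, 2)] dimensions; [C(n, 2)] is the genus of a smooth plane curve of
    degree [n + 1]. *)
Lemma hilbert d : (n < d)%N -> hasdim c (forms d) (d * n.+1 + 1 - 'C(n, 2)).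
Proof.
move=> ltnd; have [e ->] : exists e, d = (n.+1 + e)%N by exists (d - n.+1)%N; lia.
pose phi := linfun (@mulf e).
have phi0 : lker phi == 0%VS.
  apply/lker0P => p q; rewrite !lfunE /= => /(congr1 val) /= /(mulfI (sc_neq0 C)).
  exact: val_inj.
pose psi (p : dhomog 3 F (n.+1 + e)) := ev (val p).
suff <- : \dim (limg phi)^C%VS = ((n.+1 + e) * n.+1 + 1 - 'C(n, 2))%N.
  apply: (hasdim_vspace (psi := psi)) => [a u v|u uW|v].
  - by rewrite /psi /= rmorphD /= evZ.
  - move=> /(ev_eq0 C K (dhomog_is_dhomog u))[B eB].
    have [B' hB' eB'] : exists2 B', B' \is e.-homog & f * B = f * B'.
      by apply: dhomog_mul_factor (sc_homog C) _; rewrite -eB; apply: dhomog_is_dhomog.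
    have uI : u \in limg phi.
      apply/memv_imgP; exists (DHomog hB'); rewrite ?memvf // lfunE /=.
      by apply: val_inj; rewrite /= -eB' -eB.
    apply/eqP; rewrite -memv0 -(capv_compl (limg phi)) memv_cap uI //.
  - split=> [[A hA ->]|[u _ ->]]; last by exists (val u) => //; apply: dhomog_is_dhomog.
    have : DHomog hA \in (limg phi + (limg phi)^C)%VS by rewrite addv_complf memvf.
    move=> /memv_addP[p pI [q qC epq]]; exists q => //.
    have := congr1 psi epq; rewrite /psi /= => ->; rewrite rmorphD /=.
    case/memv_imgP: pI => r _ ->; rewrite lfunE /= rmorphM /= (ev_f C).
    by rewrite mul0r add0r.
rewrite dimv_compl limg_dim_eq; last by rewrite (eqP phi0) capv0.
rewrite !dimvf /dim /=.
have bin2D a : ('C(a.+2, 2) * 2 = a.+2 * a.+1)%N.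
  by rewrite -[X in (_ * X)%N]/(2`!) bin_ffact !ffactnS ffactn0 muln1.
have bin_add2 a : 'C(a + 2, a) = 'C(a.+2, 2).
  by rewrite -(addn2 a) -[LHS]bin_sub ?leq_addr // addKn.
rewrite !bin_add2.
have [k ek] : exists k, n = k.+2 by exists n.-2; have := sc_deg C; lia.
move: (bin2D (n.+1 + e)%N) (bin2D e) (bin2D k); rewrite -ek.
move: 'C(_, 2) 'C(_, 2) 'C(_, 2) => x y z ex ey ez.
suff : (x * 2 + z * 2 = (n.+1 + e) * n.+1 * 2 + 2 + y * 2)%N by lia.
by rewrite ex ey ez ek; ring.
Qed.

(* The forms of degree [d] modulo the multiples of a form [B] of degree [r]
   make up a space of dimension [r (n + 1)] for large [d]. *)
Lemma forms_dep r B d q (w : 'cV[K]_q) :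
    B \is r.-homog -> ev B != 0 -> (n < d)%N ->
    (forall i, forms (r + d) (w i 0)) -> (r * n.+1 < q)%N ->
  exists2 a : 'rV[F]_q, a != 0 & exists2 D, D \is d.-homog & comb c w a = ev B * ev D.
Proof.
move=> hB nB ltnd hw ltq.
have ltnrd : (n < r + d)%N by lia.
have [||a na [D hD eD]] :=
  hasdim_dep (hasdim_scale nB (hilbert ltnd)) (hilbert ltnrd) _ hw.
- move=> v [D hD eD]; exists (B * D); first exact: dhomogM.
  by rewrite rmorphM /= -eD mulrC divfK.
- suff : ('C(n, 2) <= d * n.+1)%N by nia.
  have := bin2 n; rewrite -divn2; have := leq_trunc_div (n * n.-1) 2; nia.
by exists a => //; exists D => //; rewrite -eD mulrC divfK.
Qed.

End Hilbert.

(** * A Nullstellensatz over a finite field *)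

Section LinearFunctional.
Variables (F : fieldType) (V : lmodType F).

Definition subspace (U : V -> Prop) :=
  U 0 /\ forall a u v, U u -> U v -> U (a *: u + v).

(** Zorn's lemma gives a subspace [M] maximal among those containing [U] and missing [v0]. By
    maximality every vector is a multiple of [v0] modulo [M], and [phi] is that multiple. *)
Lemma separating_functional (U : V -> Prop) v0 : subspace U -> ~ U v0 ->
  exists phi : V -> F, [/\ forall a u v, phi (a *: u + v) = a * phi u + phi v,
    forall u, U u -> phi u = 0 & phi v0 = 1].
Proof.
move=> subU nU0.
pose T := {W : V -> Prop | [/\ subspace W, ~ W v0 & forall u, U u -> W u]}.
pose R (A B : T) := `[< forall u, sval A u -> sval B u >].
have T0 : T by exists U.
have [A|A B C /asboolP AB /asboolP BC|A B /asboolP AB /asboolP BA|Ch tot|[M [subM nM0 UM]] maxM] :=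
  @classical_sets.Zorn T R.
- exact/asboolP.
- by apply/asboolP => u /AB/BC.
- case: A B AB BA => [A hA] [B hB] /= AB BA.
  have eAB : A = B by apply/funext => u; apply/propext; split; [apply: AB|apply: BA].
  by rewrite {AB BA} eAB in hA *; congr exist; apply: Prop_irrelevance.
- pose W u := U u \/ exists2 A, Ch A & sval A u.
  have hW : [/\ subspace W, ~ W v0 & forall u, U u -> W u].
    split; [split| |]; first by left; case: subU.
    + move=> a u v Wu Wv.
      suff [[Uu Uv]|[A ChA [Au Av]]] : (U u /\ U v) \/ exists2 A, Ch A & sval A u /\ sval A v.
      * by left; case: subU => _; apply.
      * by right; exists A => //; case: (svalP A) => -[_ hA] _ _; apply: hA.
      case: Wu Wv => [Uu|[A ChA Au]] [Uv|[B ChB Bv]].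
      * by left.
      * by right; exists B => //; split=> //; case: (svalP B) => _ _; apply.
      * by right; exists A => //; split=> //; case: (svalP A) => _ _; apply.
      * by right; have [/asboolP AB|/asboolP BA] := tot _ _ ChA ChB; [exists B|exists A] => //; split=> //;
          [apply: AB|apply: BA].
    + by case=> // -[A _]; case: (svalP A).
    + by left.
  by exists (exist _ W hW) => A ChA; apply/asboolP => u Au; right; exists A.
have dec u : exists a, M (u - a *: v0).
  have [Mu|nMu] := pselect (M u); first by exists 0; rewrite scale0r subr0.
  pose W w := exists a, M (w - a *: u).
  have [[b Mb]|nW0] := pselect (W v0).
    have nb : b != 0.
      by apply/eqP => b0; case: (nM0); rewrite -[v0]subr0 -(scale0r u) -b0.
    exists b^-1; have [M0 ML] := subM.
    have -> : u - b^-1 *: v0 = (- b^-1) *: (v0 - b *: u) + 0.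
      by rewrite addr0 scalerBr scalerA mulNr mulVf // scaleN1r opprK scaleNr addrC.
    exact: ML.
  have hW : [/\ subspace W, ~ W v0 & forall w, U w -> W w].
    split=> //; last by move=> w /UM Mw; exists 0; rewrite scale0r subr0.
    have [M0 ML] := subM; split; first by exists 0; rewrite scale0r subr0.
    move=> a w1 w2 [b1 M1] [b2 M2]; exists (a * b1 + b2).
    have := ML a _ _ M1 M2; congr M.
    by rewrite scalerBr scalerDl scalerA opprD addrACA.
  have MW w : M w -> W w by move=> Mw; exists 0; rewrite scale0r subr0.
  have /(congr1 sval)/= eW := maxM (exist _ W hW) (introT (asboolP _) MW).
  by case: nMu; rewrite -eW; exists 1; rewrite scale1r subrr; case: (subM).
have [phi hphi] := choice dec; exists phi; have [M0 ML] := subM.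
have uniq u a : M (u - a *: v0) -> phi u = a.
  move=> Ma; have [//|nz] := eqVneq (phi u) a; case: (nM0).
  have -> : v0 = (a - phi u)^-1 *: ((- 1) *: (u - a *: v0) + (u - phi u *: v0)) + 0.
    rewrite addr0 scaleN1r opprB addrA subrK -scalerBl scalerA mulVf ?scale1r //.
    by rewrite subr_eq0 eq_sym.
  by apply: (ML) => //; apply: ML.
split=> [a u v|u /UM Mu|]; apply: uniq.
- have := ML a _ _ (hphi u) (hphi v); congr M.
  by rewrite scalerBr scalerDl scalerA opprD addrACA.
- by rewrite scale0r subr0.
- by rewrite scale1r subrr.
Qed.
End LinearFunctional.

Section CommonZero.
Variables (F : finFieldType) (L : closedFieldType) (h : {rmorphism F -> L}).
Variables (n : nat) (I : {mpoly F[n]} -> Prop).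
Hypotheses (subI : subspace I) (idI : forall p q, I q -> I (p * q)) (I1 : ~ I 1).

(** A nonzero [L]-valued functional on the algebra modulo [I]. If it is an eigenvector for
    multiplication by every variable, its eigenvalues are the coordinates of a zero of [I]. *)
Definition functional (phi : {mpoly F[n]} -> L) := [/\
  forall a u v, phi (a *: u + v) = h a * phi u + phi v,
  forall u, I u -> phi u = 0 & exists u, phi u != 0].

Definition act k (q : {poly L}) (phi : {mpoly F[n]} -> L) u :=
  \sum_(i < size q) q`_i * phi ('X_k ^+ i * u).

Lemma actE k N (q : {poly L}) phi u : (size q <= N)%N ->
  act k q phi u = \sum_(i < N) q`_i * phi ('X_k ^+ i * u).
Proof.
move=> leN; rewrite /act (big_ord_widen N (fun i => q`_i * phi ('X_k ^+ i * u))) //.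
rewrite big_mkcond; apply: eq_bigr => i _; case: ltnP => // le.
by rewrite nth_default ?mul0r.
Qed.

(** [p(X_k)] kills [phi] and [p] splits over [L]. Apply the factors [X_k - z] one at a time: the
    last functional before zero is an eigenvector. Multiplications commute, so the eigenvalues
    already found for other variables survive. *)
Lemma functional_eigen phi k (p : {poly F}) : functional phi -> p != 0 ->
    I (map_poly (@mpolyC n F) p).['X_k] ->
  exists phi' r, [/\ functional phi', forall u, phi' ('X_k * u) = r * phi' u
    & forall l s, (forall u, phi ('X_l * u) = s * phi u) ->
        forall u, phi' ('X_l * u) = s * phi' u].
Proof.
move=> fphi np Ip; pose q := map_poly h p.
have [rs eq] := closed_field_poly_normal q.
have nq : lead_coef q != 0 by rewrite lead_coef_eq0 map_poly_eq0.
have {eq} : forall u, act k (\prod_(z <- rs) ('X - z%:P)) phi u = 0.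
  move=> u; apply: (mulfI nq); rewrite mulr0; case: fphi => phiL phiI _.
  have phi0 : phi 0 = 0 by apply: phiI; case: subI.
  have phiD v w : phi (v + w) = phi v + phi w.
    by have := phiL 1 v w; rewrite scale1r rmorph1 mul1r.
  have phiZ a v : phi (a *: v) = h a * phi v.
    by have := phiL a v 0; rewrite phi0 !addr0.
  have <- : act k q phi u = 0.
    rewrite -(phiI _ (idI u Ip)) /act horner_coef !size_map_poly.
    rewrite mulr_sumr (big_morph phi phiD phi0); apply: eq_bigr => i _.
    by rewrite !coef_map /= mul_mpolyC -scalerAr phiZ (mulrC u).
  rewrite {2}eq (@actE k (size (\prod_(z <- rs) ('X - z%:P))) (_ *: _)); last exact: size_scale_leq.
  by rewrite /act mulr_sumr; apply: eq_bigr => i _; rewrite coefZ mulrA.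
elim: rs phi fphi => [|z rs IHrs] phi fphi.
  case: fphi => _ _ [u nu] /(_ u)/eqP; rewrite big_nil /act size_poly1 big_ord1.
  by rewrite coef1 mul1r expr0 mul1r (negbTE nu).
rewrite big_cons => a0; pose phi1 u := phi ('X_k * u) - z * phi u.
have [eig|/existsNP[u nu]] := pselect (forall u, phi ('X_k * u) = z * phi u).
  by exists phi, z.
have fphi1 : functional phi1.
  case: fphi => phiL phiI _; split=> [a v w|v Iv|]; last first.
  - by exists u; rewrite subr_eq0; apply/eqP.
  - by rewrite /phi1 !phiI ?mulr0 ?subr0 //; apply: idI.
  - by rewrite /phi1 mulrDr -scalerAr !phiL; ring.
have [|phi' [r [f' e' p']]] := IHrs phi1 fphi1.
  move=> v; rewrite -(a0 v); set g := \prod_(_ <- _) _.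
  rewrite (@actE k (size g).+1 (_ * g)); last first.
    by have := size_polyMleq ('X - z%:P) g; rewrite size_XsubC.
  rewrite /act mulrBl; under [RHS]eq_bigr => i _.
    rewrite coefB coefXM coefCM mulrBl; over.
  rewrite sumrB big_ord_recl /= mul0r add0r.
  rewrite [X in _ - X]big_ord_recr /= [g`_(size g)]nth_default // mulr0 mul0r addr0.
  rewrite -sumrB.
  apply: eq_bigr => i _; rewrite /phi1 mulrBr /= exprS -mulrA.
  by congr (_ - _); ring.
exists phi', r; split=> // l s el; apply: p' => v.
by rewrite /phi1 mulrCA !el; ring.
Qed.

Hypothesis finI : forall k, exists2 p : {poly F},
  p != 0 & I (map_poly (@mpolyC n F) p).['X_k].

(** By [finI] every variable is algebraic modulo [I], so the variables can be diagonalised one after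
    another. For the resulting [phi], multiplication by [p] scales by [p(P)], while [phi] kills [I]
    and is not zero. *)
Lemma common_zero : exists P : 'rV[L]_n, forall p, I p -> mmap h (P 0) p = 0.
Proof.
have [phi0 [phi0L phi0I phi01]] := separating_functional subI I1.
suff [phi [P [fphi eig]]] : exists phi (P : 'rV[L]_n), functional phi /\
    forall k u, phi ('X_k * u) = P 0 k * phi u.
  exists P => p Ip; case: fphi => phiL phiI [u nu]; apply: (mulIf nu).
  have phi0' : phi 0 = 0 by apply: phiI; case: subI.
  rewrite mul0r -(phiI _ (idI u Ip)).
  elim/mpoly_ind_ring: p {Ip} => [a|p q ep eq|k p ep].
  - by rewrite mmapC [u * _]mulrC mul_mpolyC -[_ *: u]addr0 phiL phi0' addr0.
  - rewrite rmorphD /= mulrDl ep eq mulrDr -[u * p]scale1r phiL rmorph1.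
    by rewrite mul1r scale1r.
  - by rewrite rmorphM /= mmapX mmap1U mulrCA eig -ep mulrA.
suff [phi [P [fphi eig]]] : exists phi (P : 'rV[L]_n), functional phi /\
    forall k, k \in enum 'I_n -> forall u, phi ('X_k * u) = P 0 k * phi u.
  by exists phi, P; split=> // k; apply: eig; rewrite mem_enum.
elim: (enum _) => [|k s [phi [P [fphi eig]]]].
  exists (h \o phi0), 0; split=> //; split=> /= [a u v|u Iu|].
  - by rewrite phi0L rmorphD rmorphM.
  - by rewrite phi0I ?rmorph0.
  - by exists 1; rewrite phi01 rmorph1 oner_eq0.
have [p np Ip] := finI k.
have [phi' [r [f' e' p']]] := functional_eigen fphi np Ip.
exists phi', (\row_l if l == k then r else P 0 l); split=> // l; rewrite mxE inE.
by case: eqP => [-> _|_ /= ls]; [apply: e'|apply/p'/eig].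
Qed.

End CommonZero.

(** * Noether's theorem *)

Section Noether.
Variables (F : finFieldType) (n : nat) (f : {mpoly F[3]}).
Hypothesis C : smooth_curve n f.
Variable K : function_field f.
Local Notation c := (ff_const K).
Local Notation ev := (@ev F f K).
Local Notation forms := (@forms F f K).

Lemma forms_pihomog d q : ev (pihomog mdeg d (f * q)) = 0.
Proof.
have hf := sc_homog C; have [lt|ge] := ltnP d n.+1.
  by rewrite (pihomogMl_lt _ hf lt) rmorph0.
by rewrite -(subnKC ge) (pihomogMl _ _ hf) rmorphM /= (ev_f C) mul0r.
Qed.

(* With [X_k w = A_k] on the curve, write [Y A_0 - X A_1 = f a] and cyclically
   [f b], [f d]; then [Z a + X b + Y d = 0], so [a] is in the ideal [(X, Y)]
   and [A_0] can be corrected by a multiple of [f] to become divisible by [X]. *)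
Lemma forms_depth d w : (forall k, forms d.+1 (ev 'X_k * w)) -> forms d w.
Proof.
move=> hw; have hf := sc_homog C.
have [A hA eA] := hw i0; have [B hB eB] := hw i1; have [D hD eD] := hw i2.
have syz k l A1 A2 : A1 \is d.+1.-homog -> A2 \is d.+1.-homog ->
    ev 'X_k * w = ev A1 -> ev 'X_l * w = ev A2 -> exists a, 'X_l * A1 - 'X_k * A2 = f * a.
  move=> h1 h2 e1 e2.
  have hX : 'X_l * A1 - 'X_k * A2 \is (1 + d.+1).-homog.
    by apply: dhomogB; apply: dhomogM => //; apply: dhomogXU.
  by apply/(ev_eq0 C K hX); rewrite rmorphB !rmorphM /= -e1 -e2; ring.
have [a ea] := syz _ _ _ _ hA hB eA eB.
have [b eb] := syz _ _ _ _ hB hD eB eD.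
have [e ee] := syz _ _ _ _ hD hA eD eA.
have rel : 'X_i2 * a + 'X_i0 * b + 'X_i1 * e = 0.
  apply: (mulfI (sc_neq0 C)); rewrite mulr0 !mulrDr.
  by rewrite !(mulrCA f) -ea -eb -ee; ring.
have X2 k : 'X_k != 0 :> {mpoly F[3]}.
  by apply/eqP => /(congr1 (mcoeff U_(k)%MM))/eqP; rewrite mcoeffX eqxx mcoeff0 oner_eq0.
pose s (k : 'I_3) : {mpoly F[3]} := if k == i2 then 'X_k else 0.
have a0 : subst s a = 0.
  apply: (mulfI (X2 i2)); rewrite mulr0; have := congr1 (subst s) rel.
  by rewrite !(rmorphD, rmorphM) /= !substX rmorph0 /s /= !mul0r !addr0.
have [q] := subst_cong s a; rewrite a0 add0r sum3 /s /= subrr mul0r addr0 !subr0 => eqa.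
have div : 'X_i1 * (A - f * q i1) = 'X_i0 * (B + f * q i0).
  apply/eqP; rewrite -subr_eq0; apply/eqP.
  have -> : 'X_i1 * (A - f * q i1) - 'X_i0 * (B + f * q i0) =
    ('X_i1 * A - 'X_i0 * B) - f * ('X_i0 * q i0 + 'X_i1 * q i1) by ring.
  by rewrite ea -eqa subrr.
pose t (k : 'I_3) : {mpoly F[3]} := if k == i0 then 0 else 'X_k.
have t0 : subst t (A - f * q i1) = 0.
  apply: (mulfI (X2 i1)); rewrite mulr0; have := congr1 (subst t) div.
  by rewrite !rmorphM /= !substX /t /= mul0r.
have [r] := subst_cong t (A - f * q i1).
rewrite t0 add0r sum3 /t /= !subrr !mul0r !addr0 subr0 => er.
exists (pihomog mdeg d (r i0)); first exact: pihomogP.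
apply: (mulfI (evX_neq0 C K i0)); rewrite eA -rmorphM /=.
have := congr1 (ev \o pihomog mdeg d.+1) er; rewrite /= raddfB rmorphB /=.
rewrite forms_pihomog subr0 (pihomog_dE hA) => ->.
by rewrite -[d.+1]add1n (pihomogMl _ _ (dhomogXU _ _)).
Qed.

Section Charts.
Variables (d : nat) (v : K).
Hypothesis reg : forall P, on_curve f P -> exists a, vl P d v a.

(** In the chart [X_k = 1], the denominators of [v] form an ideal [I] containing [f] and [X_k - 1].
    If no power of [X_k] cleared [v], then [I] would be proper and have a zero [P] on the curve, yet
    regularity of [v] at [P] supplies a denominator not vanishing there. *)
Lemma clear_denominators k : exists N, forms (N + d) (ev 'X_k ^+ N * v).
Proof.
have [//|noN] := pselect (exists N, forms (N + d) (ev 'X_k ^+ N * v)).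
have nx := evX_neq0 C K k; set x := ev 'X_k in nx noN.
pose evk p := eval_at c (x^-1 *: aff_gen K) p.
have evkE e A : A \is e.-homog -> evk A = x^-1 ^+ e * ev A by apply: eval_scale.
have evk_lin a p q : evk (a *: p + q) = c a * evk p + evk q.
  by rewrite /evk rmorphD /= evalZ.
have evkM p q : evk (p * q) = evk p * evk q by rewrite /evk rmorphM.
pose I p := exists q, evk p * (v / x ^+ d) = evk q.
have subI : subspace I.
  split=> [|a p q [p' ep] [q' eq]]; first by exists 0; rewrite /evk !rmorph0 mul0r.
  by exists (a *: p' + q'); rewrite !evk_lin mulrDl -mulrA ep eq.
have idI p q : I q -> I (p * q).
  by move=> [q' eq]; exists (p * q'); rewrite !evkM -mulrA eq.
(* If [1] were a denominator, [v] would be a polynomial in the affine coordinates; homogenising it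
   by powers of [X_k] would give the excluded form. *)
have I1 : ~ I 1.
  move=> [q]; rewrite {1}/evk rmorph1 mul1r => ev_q; apply: noN.
  pose M := mmeasure mdeg q; exists M.
  exists (\sum_(e < M) 'X_k ^+ (M + d - e) * pihomog mdeg e q).
    apply: rpred_sum => e _.
    apply: dhomog_cast (dhomogM (dhomogMn _ (dhomogXU _ _)) (pihomogP _ _ _)) _.
    by have := ltn_ord e; lia.
  have evq : evk q = \sum_(e < M) x^-1 ^+ e * ev (pihomog mdeg e q).
    have -> : evk q = evk (\sum_(e < M) pihomog mdeg e q).
      by congr evk; apply: pihomog_partitionE.
    rewrite /evk rmorph_sum /=; apply: eq_bigr => e _.
    exact: evkE (pihomogP _ _ _).
  have -> : v = x ^+ d * evk q by rewrite -ev_q mulrC divfK ?expf_neq0.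
  rewrite evq rmorph_sum /= !mulr_sumr; apply: eq_bigr => e _.
  rewrite rmorphM rmorphXn /= -/x !mulrA; congr (_ * _).
  rewrite exprVn -exprD expfB //; last by have := ltn_ord e; lia.
have finI l : exists2 p : {poly F}, p != 0 & I (map_poly (@mpolyC 3 F) p).['X_l].
  have [r [A [B [hA hB nB ev_v]]]] := ev_frac C v.
  (* One more power of [X_l] than the dimension [r (n + 1)] of forms modulo the denominator [B] of
     [v]: some nonzero polynomial in [X_l] becomes a multiple of [B], hence a denominator. The size
     of [d'] keeps all exponents nonnegative and [n < d']. *)
  pose q := (r * n.+1).+1; pose d' := (n.+1 + q)%N.
  pose w : 'cV[K]_q := \col_i (x ^+ (r + d' - i) * ev 'X_l ^+ i).
  have [|||a na [D hD eD]] := @forms_dep _ _ _ C K r B d' q w hB nB.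
  - by rewrite /d'; lia.
  - move=> i; exists ('X_k ^+ (r + d' - i) * 'X_l ^+ i); last first.
      by rewrite mxE rmorphM !rmorphXn.
    apply: dhomog_cast (dhomogM (dhomogMn _ (dhomogXU _ _)) (dhomogMn _ (dhomogXU _ _))) _.
    by rewrite /d'; have := ltn_ord i; lia.
  - by [].
  exists (rVpoly a); first by apply: contraNneq na => p0; rewrite -[a]rVpolyK p0 linear0.
  have eBD : evk (map_poly (@mpolyC 3 F) (rVpoly a)).['X_l] = evk (B * D).
    rewrite (evkE _ _ (dhomogM hB hD)) rmorphM /= -eD combE mulr_sumr.
    have -> : (map_poly (@mpolyC 3 F) (rVpoly a)).['X_l] = \sum_(i < q) a 0 i *: 'X_l ^+ i.
      rewrite (horner_coef_wide (n := q)); last by rewrite size_map_poly; apply: size_poly.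
      by apply: eq_bigr => i _; rewrite coef_map /= coef_rVpoly_ord mul_mpolyC.
    rewrite /evk rmorph_sum /=; apply: eq_bigr => i _; rewrite -/(evk _).
    have hX := dhomogMn i (dhomogXU F l).
    rewrite (evkE _ _ (rpredZ _ hX)) evZ rmorphXn /= [w i 0]mxE mul1n.
    have -> : x ^+ (r + d' - i) = x ^+ (r + d') * x^-1 ^+ i.
      by rewrite exprVn expfB //; rewrite /d'; have := ltn_ord i; lia.
    rewrite [RHS]mulrCA [LHS]mulrCA; congr (_ * _); rewrite !mulrA; congr (_ * _).
    by rewrite [x^-1 ^+ (r + d')]exprVn mulVf ?mul1r ?expf_neq0.
  have [q' eq'] : I (B * D).
    rewrite mulrC; apply: idI; exists (A * 'X_i0 ^+ d).
    have hX : A * 'X_i0 ^+ d \is (r + 1 * d).-homog by apply: dhomogM (dhomogMn _ (dhomogXU _ _)).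
    rewrite (evkE _ _ hB) (evkE _ _ hX) mul1n rmorphM rmorphXn /= (evX0 C K) expr1n mulr1 ev_v.
    rewrite exprD -[x ^- d]exprVn; move: (x^-1 ^+ r) (x^-1 ^+ d) => y z.
    by field.
  by exists q'; rewrite eBD.
have [P hP] := common_zero (to_Fbar F) subI idI I1 finI.
have ev0I p : evk p = 0 -> I p by move=> p0; exists 0; rewrite p0 mul0r /evk rmorph0.
have Pk : P 0 k = 1.
  have : I ('X_k - 1).
    apply: ev0I; rewrite /evk rmorphB rmorph1 /= -/(evk _).
    by rewrite (evkE _ _ (dhomogXU F k)) expr1 mulVf // subrr.
  by move/hP/eqP; rewrite rmorphB rmorph1 /= mmapX mmap1U subr_eq0 => /eqP.
have Pf : on_curve f P.
  split; first by apply: contra_eq_neq Pk => ->; rewrite mxE eq_sym oner_eq0.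
  by apply: hP; apply: ev0I; rewrite (evkE _ _ (sc_homog C)) (ev_f C) mulr0.
have [a [e [A [B [hA hB nB ev_v _]]]]] := reg Pf.
case/eqP: (nB); apply: hP; exists A; have {}nB := at_ev_neq0 C K Pf hB nB.
rewrite (evkE _ _ hB) (evkE _ _ hA) ev_v exprD.
rewrite -[x ^- d]exprVn; move: (x^-1 ^+ e) (x^-1 ^+ d) => y z.
by field.
Qed.

(** A monomial of degree at least [N0 + N1 + N2] has an exponent large enough to clear [v]. Then
    [forms_depth] lowers the degree of the monomials one unit at a time, down to the monomial [1];
    [r] bounds the distance to the range where clearing is automatic. *)
Lemma noether : forms d v.
Proof.
have [N0 h0] := clear_denominators i0; have [N1 h1] := clear_denominators i1.
have [N2 h2] := clear_denominators i2.
pose mon a b e : K := ev 'X_i0 ^+ a * ev 'X_i1 ^+ b * ev 'X_i2 ^+ e.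
have formsX k a : forms a (ev 'X_k ^+ a).
  by exists ('X_k ^+ a); [apply: dhomogXUn | rewrite rmorphXn].
suff main r M a b e : (N0 + N1 + N2 <= M + r)%N -> (a + b + e = M)%N ->
    forms (M + d) (mon a b e * v).
  by have := main _ 0%N 0%N 0%N 0%N (leqnn _) erefl; rewrite /mon !expr0 !mul1r.
elim: r => [|r IHr] in M a b e * => leM eM.
  have [|[]] : (N0 <= a)%N \/ (N1 <= b)%N \/ (N2 <= e)%N by lia.
  - move=> le; have := formsM (formsM (formsX i0 (a - N0)%N) (formsM (formsX i1 b) (formsX i2 e))) h0.
    have -> : (a - N0 + (b + e) + (N0 + d) = M + d)%N by lia.
    by congr forms; rewrite /mon -{2}(subnK le) exprD; ring.
  - move=> le; have := formsM (formsM (formsX i1 (b - N1)%N) (formsM (formsX i0 a) (formsX i2 e))) h1.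
    have -> : (b - N1 + (a + e) + (N1 + d) = M + d)%N by lia.
    by congr forms; rewrite /mon -{2}(subnK le) exprD; ring.
  - move=> le; have := formsM (formsM (formsX i2 (e - N2)%N) (formsM (formsX i0 a) (formsX i1 b))) h2.
    have -> : (e - N2 + (a + b) + (N2 + d) = M + d)%N by lia.
    by congr forms; rewrite /mon -{2}(subnK le) exprD; ring.
apply: forms_depth; rewrite -addSn; elim/ord3P; rewrite mulrA.
- have -> : ev 'X_i0 * mon a b e = mon a.+1 b e by rewrite /mon exprS !mulrA.
  by apply: IHr; lia.
- have -> : ev 'X_i1 * mon a b e = mon a b.+1 e by rewrite /mon exprS; ring.
  by apply: IHr; lia.
- have -> : ev 'X_i2 * mon a b e = mon a b e.+1 by rewrite /mon exprS; ring.
  by apply: IHr; lia.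
Qed.

End Charts.

End Noether.

(** * Uniformizers and orders *)

Section Frobenius.
Variable F : finFieldType.

(** The powers [x^(p^k)] are polynomials of bounded degree in [x] over the finite field [F], so two
    coincide, and injectivity of Frobenius brings the coincidence back to [x]. [Q] is a power of the
    characteristic, so the derivative of a [Q]-th power is zero. *)
Lemma Fbar_frobenius (x : Fbar F) : exists Q, [/\ (1 < Q)%N, Q%:R = 0 :> F & x ^+ Q = x].
Proof.
have [p p_pr pF] := finPcharP F.
have pL : p \in [pchar (Fbar F)] by rewrite (fmorph_pchar (to_Fbar F)).
have [q mq qx] := svalP (tagged (countable_algebraic_closure F)) x.
rewrite -/(to_Fbar F) in qx.
have nq : q != 0 by apply: monic_neq0.
pose d := (size q).-1.
pose r k : 'rV[F]_d := poly_rV ('X^(p ^ k) %% q).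
have rE k : x ^+ (p ^ k) = (map_poly (to_Fbar F) (rVpoly (r k))).[x].
  rewrite poly_rV_K; last first.
    by rewrite -ltnS /d prednK ?size_poly_gt0 // ltn_modp.
  have /(congr1 (fun g => (map_poly (to_Fbar F) g).[x])) := divp_eq 'X^(p ^ k) q.
  rewrite map_polyXn hornerXn => ->; rewrite rmorphD rmorphM /= hornerD hornerM.
  by rewrite (rootP qx) mulr0 add0r.
have /injectivePn[a [b nab eab]] : ~~ injectiveb (fun k : 'I_(#|'rV[F]_d|.+1) => r k).
  by apply/negP => /injectiveP/leq_card; rewrite card_ord ltnn.
have key (u v : nat) : (u < v)%N -> r u = r v ->
    exists Q, [/\ (1 < Q)%N, Q%:R = 0 :> F & x ^+ Q = x].
  move=> ltuv euv; exists (p ^ (v - u))%N; have p1 := prime_gt1 p_pr.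
  have [k ek] : exists k, (v - u = k.+1)%N by exists (v - u).-1; lia.
  split.
  - by rewrite ek -(exp1n k.+1) ltn_exp2r.
  - by rewrite ek expnS natrM (pcharf0 pF) mul0r.
  have pnat : [pchar (Fbar F)].-nat (p ^ u)%N.
    by rewrite (eq_pnat _ (pcharf_eq pL)) pnatX pnat_id.
  have : (x ^+ (p ^ (v - u)) - x) ^+ (p ^ u) == 0.
    rewrite exprDn_pchar // exprNn_pchar // -exprM -expnD subnK ?(ltnW ltuv) //.
    by rewrite !rE euv subrr.
  by rewrite expf_eq0 subr_eq0 => /andP[_ /eqP].
have [lt|gt|e] := ltngtP a b; first exact: key lt eab.
  exact: key gt (esym eab).
by case/eqP: nab; apply: val_inj.
Qed.

End Frobenius.

Section Descent.
Variables (F : finFieldType) (L : fieldType) (h : {rmorphism F -> L}).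

Lemma mpoly_descent (ps : seq {mpoly L[3]}) : exists r (b : 'cV[L]_r),
  (forall x, comb h b x = 0 -> x = 0) /\
  forall p, p \in ps -> exists2 pk : 'I_r -> {mpoly F[3]},
    (forall d, p \is d.-homog -> forall k, pk k \is d.-homog) &
    p = \sum_k b k 0 *: map_mpoly h (pk k).
Proof.
have [r [U dU hU]] := hasdim_span h (flatten [seq [seq p@_m | m <- msupp p] | p <- ps]).
have [b fb Ub] := dU; exists r, b; split=> // p pps.
have /choice[kap hkap] : forall m, exists x, m \in msupp p -> p@_m = comb h b x.
  move=> m; have [mp|_] := boolP (m \in msupp p); last by exists 0.
  have /Ub[x ex] : U p@_m; last by exists x.
  by apply: hU; apply/flatten_mapP; exists p => //; apply: map_f.
exists (fun k => \sum_(m <- msupp p) kap m 0 k *: 'X_[m]) => [d /dhomogP hp k|].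
  rewrite big_seq; apply: rpred_sum => m mp; apply: rpredZ.
  by rewrite dhomogX; apply/eqP; apply: hp.
rewrite {1}[p]mpolyE.
under [RHS]eq_bigr => k _ do rewrite rmorph_sum scaler_sumr /=.
rewrite exchange_big /= [LHS]big_seq [RHS]big_seq; apply: eq_bigr => m mp.
rewrite (hkap m mp) combE scaler_suml; apply: eq_bigr => k _.
by rewrite map_mpolyZ map_mpolyX scalerA mulrC.
Qed.

Lemma mpoly_free r (b : 'cV[L]_r) (g : 'I_r -> {mpoly F[3]}) :
    (forall x, comb h b x = 0 -> x = 0) ->
    \sum_k b k 0 *: map_mpoly h (g k) = 0 ->
  forall k, g k = 0.
Proof.
move=> fb g0 k; apply/mpolyP => m; rewrite mcoeff0.
have /fb/rowP/(_ k) : comb h b (\row_k (g k)@_m) = 0; last by rewrite !mxE.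
have := congr1 (mcoeff m) g0; rewrite mcoeff0 raddf_sum /= => <-; rewrite combE; apply: eq_bigr => l _.
by rewrite mcoeffZ mcoeff_map_mpoly mxE mulrC.
Qed.

(** The coefficients of [D], [E] and [H] are expanded along one common [F]-free family of [L]. The
    relation is linear in them with coefficients over [F], so it holds for each component, and some
    component of [D] is nonzero at [P] because [D] is. *)
Lemma relation_descent (A T f : {mpoly F[3]}) (D E H : {mpoly L[3]}) d e (P : 'rV[L]_3) :
    D \is d.-homog -> E \is e.-homog ->
    D * map_mpoly h A = map_mpoly h T * E + map_mpoly h f * H -> D.@[P 0] != 0 ->
  exists D' E' H' : {mpoly F[3]}, [/\ D' \is d.-homog, E' \is e.-homog,
    eval_at h P D' != 0 & D' * A = T * E' + f * H'].
Proof.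
move=> hD hE eD nD.
have [r [b [fb dec]]] := mpoly_descent [:: D; E; H].
have [|Dk hDk eDk] := dec D; first by rewrite !inE eqxx.
have [|Ek hEk eEk] := dec E; first by rewrite !inE eqxx orbT.
have [|Hk _ eHk] := dec H; first by rewrite !inE eqxx !orbT.
have rel k : Dk k * A = T * Ek k + f * Hk k.
  apply/eqP; rewrite -subr_eq0; apply/eqP.
  apply: (mpoly_free (g := fun k => Dk k * A - (T * Ek k + f * Hk k)) fb _ k).
  transitivity ((\sum_l b l 0 *: map_mpoly h (Dk l)) * map_mpoly h A
      - (map_mpoly h T * (\sum_l b l 0 *: map_mpoly h (Ek l))
         + map_mpoly h f * (\sum_l b l 0 *: map_mpoly h (Hk l)))).
    rewrite mulr_suml !mulr_sumr -big_split -sumrB; apply: eq_bigr => l _ /=.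
    by rewrite rmorphB rmorphD !rmorphM /= -!mul_mpolyC; ring.
  by rewrite -eDk -eEk -eHk eD subrr.
have [k nk] : exists k, eval_at h P (Dk k) != 0.
  apply/existsP; apply: contraR nD => /existsPn D0.
  rewrite eDk raddf_sum big1 //= => k _; rewrite mevalZ meval_map.
  by move: (D0 k); rewrite negbK => /eqP->; rewrite mulr0.
by exists (Dk k), (Ek k), (Hk k); split; [exact: hDk|exact: hEk| |].
Qed.

End Descent.

Lemma third_index (x z : 'I_3) : x != z -> exists2 y, y != x & y != z.
Proof.
by move: x z; elim/ord3P; elim/ord3P => // _;
  do [by exists i0 | by exists i1 | by exists i2].
Qed.

Section Uniformizers.
Variables (F : finFieldType) (n : nat) (f : {mpoly F[3]}).
Hypothesis C : smooth_curve n f.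
Variable K : function_field f.
Local Notation ev := (@ev F f K).
Local Notation at_P P := (eval_at (to_Fbar F) P).
Local Notation map_Fbar := (map_mpoly (to_Fbar F)).

Section AtPoint.
Variable P : 'rV[Fbar F]_3.
Hypothesis Pf : on_curve f P.
Variables (x y z : 'I_3).
Hypotheses (nxy : y != x) (nxz : z != x) (nyz : y != z) (Px : P 0 x = 1).

Let sum_ne (V : nmodType) (E : 'I_3 -> V) : \sum_(k | k != x) E k = E y + E z.
Proof.
rewrite (bigD1 y) //= (bigD1 z) /=; last by rewrite nxz eq_sym.
rewrite big1 ?addr0 // => k /andP[/andP[kx ky] kz].
by case: (ord3_distinct nxy nxz nyz kx ky kz).
Qed.

(** First-order expansion at [P]: the two lines vanish there, so the cofactors take the values of
    the partial derivatives. *)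
Lemma linear_part d A : A \is d.-homog -> at_P P A = 0 ->
  exists A1 A2 : {mpoly Fbar F[3]}, [/\ A1 \is d.-1.-homog, A2 \is d.-1.-homog,
    map_Fbar A = line_at P x y * A1 + line_at P x z * A2,
    at_P P A^`M(y) = A1.@[P 0] & at_P P A^`M(z) = A2.@[P 0]].
Proof.
move=> hA A0; have [|q hq eA] := vanishing_form Px (dhomog_map (to_Fbar F) hA).
  by rewrite meval_map.
rewrite sum_ne in eA; exists (q y), (q z).
have ez k : (line_at P x k).@[P 0] = 0.
  by rewrite /line_at mevalB mevalZ !mevalXU Px mulr1 subrr.
have ed k l : k != x -> l != x -> ((line_at P x k)^`M(l)).@[P 0] = if k == l then 1 else 0.
  move=> nk nl; rewrite /line_at mderivB mderivZ !mderivX mevalB !mevalZ.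
  have -> : (U_(x)%MM : 'X_{1..3}) l = 0%N by rewrite mnmE eq_sym (negbTE nl).
  rewrite mul0r mulr0 subr0 mnmE; case: eqVneq => [->|]; last by rewrite mul0r.
  rewrite (_ : (_ - _)%MM = 0%MM) ?mpolyX0 ?meval1 ?mulr1 //.
  by apply/mnmP => i; rewrite mnmE subnn mnm0E.
have nzy : z != y by rewrite eq_sym.
move: (ez y) (ez z) (ed y y nxy nxy) (ed y z nxy nxz) (ed z y nxz nxy) (ed z z nxz nxz).
rewrite !eqxx (negbTE nyz) (negbTE nzy) eA.
move: (line_at P x y) (line_at P x z) eA => l1 l2 eA ey ez' eyy eyz ezy ezz.
split; [exact: hq|exact: hq|by []| |]; rewrite -meval_map mderiv_map eA mderivD !mderivM.
  by rewrite !mevalD !mevalM ey ez' eyy ezy; ring.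
by rewrite !mevalD !mevalM ey ez' eyz ezz; ring.
Qed.

Variables (N : nat) (T : {mpoly F[3]}).
Hypotheses (hT : T \is N.-homog) (PT : at_P P T = 0).
Hypothesis jac : at_P P (T^`M(y) * f^`M(z) - T^`M(z) * f^`M(y)) != 0.

(* Cramer's rule expresses a form vanishing at [P] in terms of [T] and [f], up
   to the jacobian; the coefficients are defined over [Fbar] only, and expanding
   them along a basis brings the identity back to [F]. *)
Lemma divide_at d A : A \is d.-homog -> at_P P A = 0 -> exists D E,
  [/\ D \is (N.-1 + n).-homog, E \is (n + d.-1).-homog, at_P P D != 0
    & ev D * ev A = ev T * ev E].
Proof.
move=> hA A0.
have [A1 [A2 [hA1 hA2 eA _ _]]] := linear_part hA A0.
have [T1 [T2 [hT1 hT2 eT dT1 dT2]]] := linear_part hT PT.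
have [f1 [f2 [hf1 hf2 ef df1 df2]]] := linear_part (sc_homog C) (proj2 Pf).
pose D := T1 * f2 - T2 * f1; pose E := f2 * A1 - f1 * A2; pose H := T1 * A2 - T2 * A1.
have hD : D \is (N.-1 + n).-homog by apply: dhomogB; apply: dhomogM.
have hE : E \is (n + d.-1).-homog by apply: dhomogB; apply: dhomogM.
have eD : D * map_Fbar A = map_Fbar T * E + map_Fbar f * H.
  by rewrite eA eT ef /D /E /H; ring.
have nD : D.@[P 0] != 0.
  by rewrite /D mevalB !mevalM -dT1 -dT2 -df1 -df2 -!rmorphM -rmorphB.
have [D' [E' [H' [hD' hE' nD' eD']]]] := relation_descent hD hE eD nD.
exists D', E'; split=> //.
by rewrite -!rmorphM eD' rmorphD !rmorphM /= (ev_f C) mul0r addr0.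
Qed.

Lemma ev_jac_neq0 : ev T != 0.
Proof.
apply/eqP => /(ev_eq0 C K hT)[B eT]; case/eqP: jac; rewrite eT !mderivM.
case: Pf => _ f0; rewrite !(rmorphB, rmorphD, rmorphM) /= f0; ring.
Qed.

(** The jacobian condition says that [T = 0] and [f = 0] are transversal at [P]. By [divide_at],
    every form vanishing at [P] is then, on the curve, a multiple of [T] up to a factor nonzero at
    [P]. *)
Lemma jac_uniformizer : uniformizer P (ev T / ev 'X_x ^+ N).
Proof.
have atx : at_P P 'X_x = 1 by rewrite evalX.
have nT := ev_jac_neq0; have nx := evX_neq0 C K x.
split; first by rewrite mulf_neq0 ?invr_eq0 ?expf_neq0.
  apply/(maximal_idealP C); exists N, T, ('X_x ^+ N).
  rewrite addn0 !rmorphXn /= atx expr1n oner_eq0 PT mul0r.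
  by split=> //; apply: dhomogXUn.
move=> g /(maximal_idealP C)[d [A [B [hA hB nB -> A0]]]].
rewrite addn0 in hA; have {A0} A0 : at_P P A = 0.
  by apply/eqP; move/esym/eqP: A0; rewrite mulf_eq0 invr_eq0 (negbTE nB) orbF.
have [D [E [hD hE nD eD]]] := divide_at hA A0.
have nB' := at_ev_neq0 C K Pf hB nB; have nD' := at_ev_neq0 C K Pf hD nD.
have const_eq0 A' : A' \is 0.-homog -> at_P P A' = 0 -> A' = 0.
  move=> /dhomog0E ->; rewrite evalC => /eqP; rewrite fmorph_eq0 => /eqP->.
  exact: mpolyC0.
have N0 : (0 < N)%N.
  by rewrite lt0n; apply: contraNneq nT => N0; rewrite (const_eq0 T) ?rmorph0 //; apply: dhomog_cast hT N0.
have [d0|d0] := posnP d.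
  rewrite (const_eq0 A (dhomog_cast hA d0) A0) rmorph0 !mul0r.
  by apply/(local_ringP C); exists 0; apply: vl0.
apply/(local_ringP C).
exists (at_P P (E * 'X_x ^+ N) / at_P P (D * B)), (N.-1 + n + d)%N, (E * 'X_x ^+ N), (D * B).
rewrite !rmorphM mulf_neq0 //= !rmorphXn /=; split=> //.
- apply: dhomog_cast (dhomogM hE (dhomogXUn F x N)) _.
  by move: d0 N0; clear; lia.
- exact: dhomogM.
- have -> : ev A = ev T * ev E / ev D by rewrite -eD mulrC mulKf.
  by field; rewrite nT nB' nD' expf_neq0.
Qed.

End AtPoint.

Lemma local_ring_scale P a (g : K) : a != 0 ->
  local_ring (a *: P) g <-> local_ring P g.
Proof.
move=> na; split=> /(local_ringP C)[b gb]; apply/(local_ringP C); exists b.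
  rewrite -[b]mul1r -(expr0 (a^-1)) -[P]scale1r -(mulVf na) -scalerA.
  by apply: vl_scale => //; rewrite invr_eq0.
by rewrite -[b]mul1r -(expr0 a); apply: vl_scale.
Qed.

Lemma maximal_ideal_scale P a (g : K) : a != 0 ->
  maximal_ideal (a *: P) g <-> maximal_ideal P g.
Proof.
move=> na; split=> /(maximal_idealP C) gb; apply/(maximal_idealP C).
  rewrite -[0](mulr0 (a^-1 ^+ 0)) -[P]scale1r -(mulVf na) -scalerA.
  by apply: vl_scale => //; rewrite invr_eq0.
by rewrite -[0](mulr0 (a ^+ 0)); apply: vl_scale.
Qed.

Lemma uniformizer_scale P a (t : K) : a != 0 ->
  uniformizer (a *: P) t <-> uniformizer P t.
Proof.
move=> na; split=> -[nt mt dt]; split=> //.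
- exact/(maximal_ideal_scale _ _ na).
- by move=> g /(maximal_ideal_scale _ _ na)/dt/(local_ring_scale _ _ na).
- exact/(maximal_ideal_scale _ _ na).
- by move=> g /(maximal_ideal_scale _ _ na)/dt/(local_ring_scale _ _ na).
Qed.

(** Euler's identity forces some coordinate other than [z] to be nonzero: if [P] had only its
    [z]-coordinate, then [P_z f_z(P) = (n + 1) f(P) = 0], in any characteristic. *)
Lemma smooth_chart P : on_curve f P -> exists x y z,
  [/\ y != x, z != x, y != z, P 0 x != 0 & at_P P f^`M(z) != 0].
Proof.
move=> Pf; have [z nz] := sc_smooth C Pf; have [nP fP] := Pf.
have [x [nxz Px]] : exists x, x != z /\ P 0 x != 0.
  have [x /andP[]|noX] := pickP (fun x => (x != z) && (P 0 x != 0)); first by exists x.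
  have Pk k : k != z -> P 0 k = 0.
    by move=> kz; apply/eqP; have := noX k; rewrite kz /= => /negbFE.
  have Pz : P 0 z != 0.
    by apply: contraNneq nP => Pz; apply/eqP/rowP => k; rewrite mxE;
      have [->|/Pk] := eqVneq k z.
  have := congr1 (at_P P) (euler_identity (sc_homog C)).
  rewrite rmorphM /= fP mulr0 rmorph_sum (bigD1 z) //= big1 => [|k /Pk Pk0]; last first.
    by rewrite rmorphM /= evalX Pk0 mul0r.
  by rewrite addr0 rmorphM /= evalX => /eqP; rewrite mulf_eq0 (negbTE Pz) (negbTE nz).
have [y nyx nyz] := third_index nxz.
by exists x, y, z; split; rewrite // eq_sym.
Qed.

(** The uniformizer needs coefficients in [F] although [P] has coordinates in [Fbar]. With
    [X_x = 1], the form [X_y^q - X_y X_x^(q-1)] vanishes at [P] by the choice of [q]; as [q = 0] in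
    [F], its [y]-derivative is [- X_x^(q-1)] and its [z]-derivative is zero. *)
Lemma exists_transversal P : on_curve f P -> exists x y z a N (T : {mpoly F[3]}),
  [/\ [/\ a != 0, y != x, z != x & y != z], (a *: P) 0 x = 1,
    T \is N.-homog, at_P (a *: P) T = 0
    & at_P (a *: P) (T^`M(y) * f^`M(z) - T^`M(z) * f^`M(y)) != 0].
Proof.
move=> Pf; have [x [y [z [yx zx yz Px fz]]]] := smooth_chart Pf.
have nPx : (P 0 x)^-1 != 0 by rewrite invr_eq0.
pose R := (P 0 x)^-1 *: P.
have Rx : R 0 x = 1 by rewrite mxE mulVf.
have [q [q1 q0 Rq]] := Fbar_frobenius (R 0 y).
pose T : {mpoly F[3]} := 'X_y ^+ q - 'X_y * 'X_x ^+ q.-1.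
have hT : T \is q.-homog.
  apply: dhomogB; first exact: dhomogXUn.
  by apply: dhomog_cast (dhomogM (dhomogXU F y) (dhomogXUn F x q.-1)) _; rewrite add1n prednK 1?ltnW.
exists x, y, z, (P 0 x)^-1, q, T; split=> //.
  by rewrite -/R rmorphB rmorphM !rmorphXn /= !evalX Rx expr1n mulr1 Rq subrr.
have yz' : (y == z) = false by apply/negbTE.
have xy' : (x == y) = false by rewrite eq_sym; apply/negbTE.
have xz' : (x == z) = false by rewrite eq_sym; apply/negbTE.
have q0' : q%:R = 0 :> {mpoly F[3]} by rewrite -mpolyC_nat q0 mpolyC0.
have -> : T^`M(z) = 0.
  by rewrite /T mderivB mderivM !mderiv_exp !mderivXU yz' xz' /=; ring.
have -> : T^`M(y) = - 'X_x ^+ q.-1.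
  by rewrite /T mderivB mderivM !mderiv_exp !mderivXU eqxx xy' q0' /=; ring.
rewrite -/R mul0r subr0 mulNr rmorphN rmorphM rmorphXn /= evalX Rx expr1n mul1r oppr_eq0.
rewrite (eval_scale _ _ _ (dhomog_mderiv z (sc_homog C))).
by rewrite mulf_neq0 ?expf_neq0.
Qed.

Lemma exists_uniformizer P : on_curve f P -> exists t : K, uniformizer P t.
Proof.
move=> Pf; have [x [y [z [a [N [T [[na yx zx yz] Rx hT T0 jT]]]]]]] := exists_transversal Pf.
exists (ev T / ev 'X_x ^+ N); apply/(uniformizer_scale _ _ na).
by apply: (jac_uniformizer _ yx zx yz Rx hT T0 jT); apply: (on_curve_scale C).
Qed.

End Uniformizers.

Section Orders.
Variables (F : finFieldType) (n : nat) (f : {mpoly F[3]}).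
Hypothesis C : smooth_curve n f.
Variable K : function_field f.
Local Notation c := (ff_const K).
Local Notation ev := (@ev F f K).
Local Notation at_P P := (eval_at (to_Fbar F) P).

Definition ordge P (k : int) (g : K) :=
  exists t : K, uniformizer P t /\ local_ring P (g / t ^ k).

Section AtPoint.
Variable P : 'rV[Fbar F]_3.
Hypothesis Pf : on_curve f P.

Lemma local_ringM (g h : K) : local_ring P g -> local_ring P h -> local_ring P (g * h).
Proof.
move=> /(local_ringP C)[a ga] /(local_ringP C)[b hb]; apply/(local_ringP C).
by exists (a * b); apply: (vlM ga hb).
Qed.

Lemma local_ringD (g h : K) : local_ring P g -> local_ring P h -> local_ring P (g + h).
Proof.
move=> /(local_ringP C)[a ga] /(local_ringP C)[b hb]; apply/(local_ringP C).
by exists (a + b); apply: (vlD C Pf ga hb).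
Qed.

Lemma local_ring_const a : local_ring P (c a).
Proof. by apply/(local_ringP C); exists (to_Fbar F a); apply: vl_const. Qed.

Lemma local_ring1 : local_ring P (1 : K).
Proof. by rewrite -(rmorph1 c); apply: local_ring_const. Qed.

Lemma local_ring0 : local_ring P (0 : K).
Proof. by rewrite -(rmorph0 c); apply: local_ring_const. Qed.

Lemma local_ringX (g : K) k : local_ring P g -> local_ring P (g ^+ k).
Proof.
move=> hg; elim: k => [|k IH]; first by rewrite expr0; apply: local_ring1.
by rewrite exprS; apply: local_ringM.
Qed.

Lemma maximal_local (g : K) : maximal_ideal P g -> local_ring P g.
Proof. by move=> /(maximal_idealP C) h; apply/(local_ringP C); exists 0. Qed.

Lemma uniformizer_ratio (t t' : K) (k : int) :
  uniformizer P t -> uniformizer P t' -> local_ring P (t' ^ k / t ^ k).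
Proof.
move=> [nt mt dt] [nt' mt' dt'].
case: k => k; first by rewrite -!exprnP -expr_div_n; apply/local_ringX/dt.
by rewrite NegzE -!invr_expz invrK mulrC -!exprnP -expr_div_n; apply/local_ringX/dt'.
Qed.

Lemma ordgeE (t g : K) k : uniformizer P t -> ordge P k g <-> local_ring P (g / t ^ k).
Proof.
move=> ut; split=> [[t' [ut' gt']]|gt]; last by exists t.
have nt' : t' != 0 by case: ut'.
rewrite -(divfK (_ : t' ^ k != 0) g) ?expfz_neq0 // -(mulrA (g / t' ^ k)).
by apply: local_ringM => //; apply: uniformizer_ratio.
Qed.

Lemma exists_unif : exists t : K, uniformizer P t.
Proof. exact: exists_uniformizer C _ _ Pf. Qed.

Lemma ordgeM k l (g h : K) : ordge P k g -> ordge P l h -> ordge P (k + l) (g * h).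
Proof.
move=> [t [ut gt]] /(ordgeE _ _ ut) ht; exists t; split=> //.
have nt : t != 0 by case: ut.
by rewrite expfzDr // -mulf_div; apply: local_ringM.
Qed.

Lemma ordgeD k (g h : K) : ordge P k g -> ordge P k h -> ordge P k (g + h).
Proof.
by move=> [t [ut gt]] /(ordgeE _ _ ut) ht; exists t; rewrite mulrDl; split=> //; apply: local_ringD.
Qed.

Lemma ordge_local (g : K) : ordge P 0 g <-> local_ring P g.
Proof.
by have [t ut] := exists_unif; rewrite (ordgeE _ _ ut) expr0z divr1.
Qed.

Lemma ordge_const a : ordge P 0 (c a).
Proof. by apply/ordge_local; apply: local_ring_const. Qed.

Lemma ordgeZ k a (g : K) : ordge P k g -> ordge P k (c a * g).
Proof. by move=> hg; rewrite -[k]add0r; apply: ordgeM (ordge_const a) hg. Qed.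

Lemma ordge0 k : ordge P k (0 : K).
Proof.
by have [t ut] := exists_unif; exists t; rewrite mul0r; split=> //; apply: local_ring0.
Qed.

Lemma ordgeN k (g : K) : ordge P k g -> ordge P k (- g).
Proof. by move=> /(ordgeZ (-1)); rewrite rmorphN rmorph1 mulN1r. Qed.

Lemma ordgeB k (g h : K) : ordge P k g -> ordge P k h -> ordge P k (g - h).
Proof. by move=> hg /ordgeN; apply: ordgeD. Qed.

Lemma ordge_sum k (I : Type) (r : seq I) (Q : pred I) (g : I -> K) :
  (forall i, Q i -> ordge P k (g i)) -> ordge P k (\sum_(i <- r | Q i) g i).
Proof. by move=> hg; elim/big_rec: _ => [|i x Qi]; [apply: ordge0|apply/ordgeD/hg]. Qed.

Lemma ordge_unifX t (k : int) : uniformizer P t -> ordge P k (t ^ k).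
Proof.
move=> ut; exists t; split=> //; rewrite divff ?expfz_neq0 //; last by case: ut.
exact: local_ring1.
Qed.

Lemma ordge_le k l (g : K) : k <= l -> ordge P l g -> ordge P k g.
Proof.
move=> lekl [t [ut gt]]; exists t; split=> //.
have nt : t != 0 by case: ut.
have [m em] : exists m : nat, l = k + m%:Z.
  by exists `|l - k|%N; rewrite gez0_abs ?subr_ge0 // [RHS]addrC subrK.
have -> : g / t ^ k = g / t ^ l * t ^+ m.
  rewrite em expfzDr // -exprnP invfM mulrA divfK ?expf_neq0 //.
apply: local_ringM => //; apply: local_ringX; case: ut => _ mt _.
exact: maximal_local.
Qed.

Lemma maximal_ordge (g : K) : maximal_ideal P g <-> ordge P 1 g.
Proof.
have [t ut] := exists_unif; have [nt mt dt] := ut; rewrite (ordgeE _ _ ut) expr1z.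
split=> [/dt //|/(local_ringP C)[a ga]]; apply/(maximal_idealP C).
rewrite -(divfK nt g) -(mulr0 a); apply: (vlM ga); exact/(maximal_idealP C).
Qed.

Lemma const_not_maximal a : a != 0 -> ~ ordge P 1 (c a).
Proof.
move=> na /maximal_ordge/(maximal_idealP C) h.
have /eqP := vl_uniq C Pf (vl_const K P a) h.
by rewrite fmorph_eq0 (negbTE na).
Qed.

(* The functions [c a] with [a] in F and the powers of a uniformizer [t] are
   independent modulo high powers of [t]; compare with the dimension of the
   forms modulo a numerator of [g]. *)
Lemma order_bounded (g : K) : g != 0 -> exists k : nat, ~ ordge P k%:Z g.
Proof.
move=> ng; apply/existsNP => allk.
have [d [A [B [hA hB nB eg]]]] := ev_frac C g.
have nA : ev A != 0 by apply: contraNneq ng => A0; rewrite eg A0 mul0r.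
have [t ut] := exists_unif; have [nt /(maximal_idealP C)[N [T [S [hT hS nS et _]]]] dt] := ut.
rewrite addn0 in hT; have nS' := at_ev_neq0 C K Pf hS nS.
have [x [_ [_ [_ _ _ nPx _]]]] := smooth_chart C Pf.
have nx := evX_neq0 C K x; have nPX : at_P P 'X_x != 0 by rewrite evalX.
(* One power of [t] more than the dimension [d (n + 1)] of forms modulo the numerator [A], so some
   nontrivial combination [s] of [1, t, ..., t^(q-1)] is a regular multiple of [g]. *)
pose q := (d * n.+1).+1; pose e := (d + n.+1)%N.
pose w : 'cV[K]_q := \col_i (ev T ^+ i * ev S ^+ (q - i) * ev 'X_x ^+ e).
have [|||a na [D hD eD]] := @forms_dep _ _ _ C K d A (N * q + n.+1) q w hA nA.
- by clear; lia.
- move=> i; exists (T ^+ i * S ^+ (q - i) * 'X_x ^+ e); last first.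
    by rewrite mxE !rmorphM !rmorphXn.
  apply: dhomog_cast (dhomogM (dhomogM (dhomogMn _ hT) (dhomogMn _ hS)) (dhomogXUn _ _ _)) _.
  by rewrite /e; have := ltn_ord i; clear; nia.
- by [].
pose s := \sum_(i < q) c (a 0 i) * t ^+ i.
have es : s = g * (ev B * ev D / (ev S ^+ q * ev 'X_x ^+ e)).
  rewrite eg mulrA mulrA divfK // -eD combE !mulr_suml; apply: eq_bigr => i _.
  have -> : ev S ^+ q = ev S ^+ (q - i) * ev S ^+ i by rewrite -exprD subnK // ltnW.
  rewrite mxE et expr_div_n.
  by field; rewrite !expf_neq0.
have su : local_ring P (ev B * ev D / (ev S ^+ q * ev 'X_x ^+ e)).
  apply/(local_ringP C); rewrite -!rmorphXn -!rmorphM /=; eexists.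
  exists (N * q + e)%N, (B * D), (S ^+ q * 'X_x ^+ e); split=> //.
  - by apply: dhomog_cast (dhomogM hB hD) _; rewrite /e; clear; lia.
  - by apply: dhomogM (dhomogMn _ hS) (dhomogXUn _ _ _).
  - by rewrite rmorphM !rmorphXn /= mulf_neq0 ?expf_neq0.
have sq : ordge P q%:Z s.
  rewrite es -[q%:Z]addr0; apply: ordgeM; last exact/ordge_local.
  by have /contrapT := allk q.
(* At the lowest nonzero coefficient, all later terms have order above [i] and [s] has order at
   least [q > i]; so the constant [c (a 0 i)] would have positive order. *)
have [i ni mini] : exists2 i : 'I_q, a 0 i != 0 & forall j : 'I_q, (j < i)%N -> a 0 j = 0.
  have /existsP[i0 ni0] : [exists i, a 0 i != 0].
    apply: contraR na => /existsPn a0; apply/eqP/rowP => i; rewrite mxE.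
    by apply/eqP/negPn/a0.
  case: (@arg_minnP _ i0 (fun i => a 0 i != 0) (fun i => val i) ni0) => i ni mini; exists i => // j ltji.
  by apply/eqP/negPn/negP => /mini; rewrite leqNgt ltji.
apply: (const_not_maximal ni).
have {sq} : ordge P i.+1%:Z s by apply: ordge_le sq; rewrite lez_nat.
rewrite /s (bigD1 i) //= => sq.
have : ordge P i.+1%:Z (c (a 0 i) * t ^+ i).
  rewrite -[X in ordge _ _ X](addrK (\sum_(j < q | j != i) c (a 0 j) * t ^+ j)).
  apply: ordgeB => //; apply: ordge_sum => j nij.
  have [ltij|leji] := ltnP i j; last first.
    rewrite mini ?rmorph0 ?mul0r; first exact: ordge0.
    by rewrite ltn_neqAle nij.
  apply: ordgeZ; apply: (@ordge_le _ j%:Z); first by rewrite lez_nat.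
  by rewrite exprnP; apply: ordge_unifX.
have := ordge_unifX (- i%:Z) ut => h1 h2.
have := ordgeM h2 h1; rewrite -invr_expz -exprnP mulfK ?expf_neq0 //.
by rewrite -[i.+1%:Z]/(1 + i%:Z) ?intS addrK.
Qed.

End AtPoint.
End Orders.

Section ExactOrders.
Variables (F : finFieldType) (n : nat) (f : {mpoly F[3]}).
Hypothesis C : smooth_curve n f.
Variable K : function_field f.
Local Notation c := (ff_const K).
Local Notation ev := (@ev F f K).
Local Notation at_P P := (eval_at (to_Fbar F) P).

Definition ordeq P k (g : K) := ordge P k g /\ ~ ordge P (k + 1) g.

Lemma ordge_scale P a k (g : K) : a != 0 -> ordge (a *: P) k g <-> ordge P k g.
Proof.
by move=> na; split=> -[t [ut gt]]; exists t; split;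
  [exact/(uniformizer_scale C _ _ na)|exact/(local_ring_scale C _ _ na)
  |exact/(uniformizer_scale C _ _ na)|exact/(local_ring_scale C _ _ na)].
Qed.

Section AtPoint.
Variable P : 'rV[Fbar F]_3.
Hypothesis Pf : on_curve f P.

Lemma ordeq_neq0 k (g : K) : ordeq P k g -> g != 0.
Proof. by case=> _ h; apply/eqP => g0; apply: h; rewrite g0; apply: ordge0 C _ _ Pf _. Qed.

Lemma has_orderP (g : K) k : has_order P g k <-> ordeq P k g.
Proof.
have step (t : K) : uniformizer P t ->
    maximal_ideal P (g / t ^ k) <-> ordge P (k + 1) g.
  move=> ut; have nt : t != 0 by case: ut.
  rewrite (maximal_ordge C Pf) (ordgeE C _ _ ut) (ordgeE C _ _ ut).
  by rewrite expfzDr // invfM mulrA.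
split=> [[t [ut gt ngt]]|[[t [ut gt]] ngt]]; last by exists t; split=> // /(step t ut).
by split; [exists t|move/(step t ut)].
Qed.

Lemma not_ordge1 : ~ ordge P 1 (1 : K).
Proof.
by rewrite -(rmorph1 c) => /(const_not_maximal C Pf); apply; apply: oner_neq0.
Qed.

Lemma ordeqV k (g : K) : ordeq P k g -> ordge P (- k) g^-1.
Proof.
move=> [[t [ut gt]] ngt]; exists t; split=> //; have nt : t != 0 by case: ut.
rewrite -invr_expz -invfM.
have /(local_ringP C)[a ga] := gt; apply/(local_ringP C); exists a^-1; apply: vlV => //.
apply/eqP => a0; apply: ngt; rewrite a0 in ga.
have /(maximal_ordge C Pf)/(ordgeE C _ _ ut) : maximal_ideal P (g / t ^ k).
  exact/(maximal_idealP C).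
by move=> h; apply/(ordgeE C _ _ ut); rewrite expfzDr // invfM mulrA.
Qed.

Lemma ordeq_ge k l (g : K) : ordeq P k g -> ordge P l g -> l <= k.
Proof.
move=> [_ nk] hl; rewrite leNgt; apply/negP => ltkl; apply: nk.
by apply: (ordge_le C) hl; rewrite lezD1.
Qed.

Lemma ordeqM k l (g h : K) : ordeq P k g -> ordeq P l h -> ordeq P (k + l) (g * h).
Proof.
move=> og oh; have [[hg ng] [hh nh]] := (og, oh); split; first exact: (ordgeM C).
move=> h2; apply: ng; have := ordgeM C h2 (ordeqV oh).
by rewrite mulfK ?(ordeq_neq0 oh) // addrAC addrK addrC.
Qed.

Lemma ordeq_inv k (g : K) : ordeq P k g -> ordeq P (- k) g^-1.
Proof.
move=> og; have [hg ng] := og; split; first exact: ordeqV.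
move=> h; have ng0 := ordeq_neq0 og.
have := ordgeM C hg h; rewrite divff // addrA subrr add0r.
by move=> /not_ordge1.
Qed.

Lemma ordeq_div k l (g h : K) : ordeq P k g -> ordeq P l h -> ordeq P (k - l) (g / h).
Proof. by move=> og oh; apply: ordeqM og _; apply: ordeq_inv. Qed.

Lemma ordeq1 : ordeq P 0 (1 : K).
Proof.
split; last exact: not_ordge1.
by rewrite -(rmorph1 c); apply: (ordge_const C K Pf).
Qed.

Lemma ordeqX k (g : K) m : ordeq P k g -> ordeq P (k * m%:Z) (g ^+ m).
Proof.
move=> og; elim: m => [|m IHm]; first by rewrite mulr0 expr0; apply: ordeq1.
by rewrite exprS intS mulrDr mulr1; apply: ordeqM.
Qed.

Lemma ordeq_vl (g : K) a : vl P 0 g a -> a != 0 -> ordeq P 0 g.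
Proof.
move=> ga na; split; first by apply/(ordge_local C Pf)/(local_ringP C); exists a.
move=> /(maximal_ordge C Pf)/(maximal_idealP C) g0; case/eqP: na.
exact: (vl_uniq C Pf ga g0).
Qed.

Lemma ordeq_unif (t : K) : uniformizer P t -> ordeq P 1 t.
Proof.
move=> ut; have [nt mt dt] := ut; split; first exact/(maximal_ordge C Pf).
move=> /(ordgeE C _ _ ut); rewrite expfzDr // expr1z invfM mulrA divff // mul1r => h.
have : local_ring P (1 : K) by apply: local_ring1 C K P.
have /(maximal_ordge C Pf) := mt => h1.
have /(ordge_local C Pf) h2 := h; have := ordgeM C h1 h2.
by rewrite divff // addr0 => /not_ordge1.
Qed.

(** A function is a quotient of two forms of the same degree, each regular in a chart; for a regular
    function [order_bounded] makes the search for the order stop. *)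
Lemma ordeq_exists (g : K) : g != 0 -> exists k, ordeq P k g.
Proof.
have pos (h : K) : h != 0 -> local_ring P h -> exists k : nat, ordeq P k%:Z h.
  move=> nh hh; have [k nk] := order_bounded C Pf nh.
  elim: k nk => [[]|k IHk nk]; first exact/(ordge_local C Pf).
  have [hk|/IHk //] := pselect (ordge P k%:Z h).
  by exists k; split=> //; rewrite -PoszD addn1.
move=> ng; have [d [A [B [hA hB nB eg]]]] := ev_frac C g.
have nA : ev A != 0 by apply: contraNneq ng => A0; rewrite eg A0 mul0r.
have [x [_ [_ [_ _ _ nPx _]]]] := smooth_chart C Pf.
have nx := evX_neq0 C K x.
have chart A' : A' \is d.-homog -> local_ring P (ev A' / ev 'X_x ^+ d).
  move=> hA'; apply/(local_ringP C); rewrite -rmorphXn /=; eexists.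
  exists d, A', ('X_x ^+ d); rewrite addn0; split=> //; first exact: dhomogXUn.
  by rewrite rmorphXn /= evalX expf_neq0.
have [||k hk] := pos (ev A / ev 'X_x ^+ d); [|exact: chart|].
  by rewrite mulf_neq0 ?invr_eq0 ?expf_neq0.
have [||l hl] := pos (ev B / ev 'X_x ^+ d); [|exact: chart|].
  by rewrite mulf_neq0 ?invr_eq0 ?expf_neq0.
exists (k%:Z - l%:Z); have := ordeq_div hk hl; congr ordeq.
by rewrite eg; field; rewrite nB expf_neq0.
Qed.

Lemma reg_chart d (v : K) x : P 0 x != 0 ->
  (exists a, vl P d v a) <-> ordge P 0 (v / ev 'X_x ^+ d).
Proof.
move=> nPx; have nPX : at_P P ('X_x ^+ d) != 0 by rewrite rmorphXn /= evalX expf_neq0.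
have nx := evX_neq0 C K x.
rewrite (ordge_local C Pf) -rmorphXn /=; split=> [[a va]|/(local_ringP C)[a va]].
  apply/(local_ringP C); exists (a / at_P P ('X_x ^+ d)).
  exact: (vl_divf (d := 0) (e := d) va (dhomogXUn F x d) nPX).
exists (a * at_P P ('X_x ^+ d)).
have := vlM va (vl_form K P (dhomogXUn F x d)).
by rewrite rmorphXn /= divfK ?expf_neq0.
Qed.

End AtPoint.

Lemma ordeq_scale P (a : Fbar F) k (g : K) : a != 0 -> ordeq P k g -> ordeq (a *: P) k g.
Proof.
move=> na [h1 h2]; split; first exact/(ordge_scale _ _ _ na).
by move=> /(ordge_scale _ _ _ na).
Qed.

Lemma ordeqD P k (g h : K) : on_curve f P -> ordeq P k g -> ordge P (k + 1) h ->
  ordeq P k (g + h).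
Proof.
move=> Pf [hg ng] hh; split.
  by apply: (ordgeD C Pf hg); apply: (ordge_le C) hh; rewrite lerDl.
by move=> /(ordgeB C Pf)/(_ hh); rewrite addrK.
Qed.

Lemma ordeq_between P k d (g : K) : ordge P k g -> ~ ordge P (k + d%:Z) g ->
  exists2 d', (d' < d)%N & ordeq P (k + d'%:Z) g.
Proof.
move=> hg; elim: d => [|d IHd] hd; first by rewrite addr0 in hd.
have [hd'|hd'] := pselect (ordge P (k + d%:Z) g); last first.
  by have [d' /ltnW ltd od] := IHd hd'; exists d'.
by exists d => //; split=> //; rewrite -addrA -PoszD addn1.
Qed.

(** The orders in the family are pairwise distinct, so the nonzero term of least index dominates. *)
Lemma comb_order P r (w : 'cV[K]_r) (o : int) (a : 'rV[F]_r) : on_curve f P ->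
    (forall l : 'I_r, ordeq P (o + l%:Z) (w l 0)) -> a != 0 ->
  exists l : 'I_r, ordeq P (o + l%:Z) (comb c w a).
Proof.
move=> Pf ow; have [l al _|a0 /eqP[]] := pickP (fun l => a 0 l != 0); last first.
  by apply/rowP => l; rewrite mxE; apply/eqP; rewrite -[_ == _]negbK a0.
have [l0 al0 lmin] := @arg_minnP _ l (fun l' : 'I_r => a 0 l' != 0) (fun l' : 'I_r => nat_of_ord l') al.
exists l0; rewrite combE (bigD1 l0) //=; apply: ordeqD => //.
  rewrite -[_ + _]add0r; apply: (ordeqM Pf) (ow l0).
  by apply: (ordeq_vl Pf (vl_const K P _)); rewrite fmorph_eq0.
apply: (ordge_sum C Pf) => l' ne; have [->|nal] := eqVneq (a 0 l') 0.
  by rewrite rmorph0 mul0r; apply: (ordge0 C).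
apply: (ordgeZ C Pf); have [hw _] := ow l'; apply: (ordge_le C) hw.
have : (l0 < l')%N by rewrite ltn_neqAle lmin // andbT eq_sym; apply: contra ne => /eqP/val_inj->.
by clear; lia.
Qed.

End ExactOrders.

(** * Divisors and the spaces L(A) *)

Section DivisorInduction.
Variable I : finType.
Implicit Types A B : I -> int.

Definition inc A s : I -> int := fun k => A k + (k == s)%:Z.

Lemma div_le_ind (Q : (I -> int) -> Prop) A B : (forall k, A k <= B k) -> Q A ->
    (forall A' s, (forall k, A k <= A' k) -> (forall k, inc A' s k <= B k) ->
       Q A' -> Q (inc A' s)) ->
  Q B.
Proof.
move=> leAB QA step; have [m] : exists m, m = (\sum_k `|B k - A k|)%N by eexists.
elim: m B leAB step => [|m IHm] B leAB step.
  move=> /esym/eqP; rewrite sum_nat_eq0 => /forallP BA.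
  suff -> : B = A by [].
  by apply/funext => k; apply/eqP; rewrite -subr_eq0 -absz_eq0; apply: BA.
move=> eB; have [s ltAB] : exists s, A s < B s.
  apply/existsP; move: eB; apply: contra_eqT => /existsPn geAB.
  rewrite big1 // => k _; apply/eqP; rewrite absz_eq0 subr_eq0 eq_le leAB.
  by rewrite leNgt geAB.
pose B' k := B k - (k == s)%:Z.
have eB' : B = inc B' s by apply/funext => k; rewrite /inc /B' subrK.
have leAB' k : A k <= B' k.
  by rewrite /B'; case: eqVneq => [->|_]; rewrite ?subr0 // lerBrDr lezD1.
rewrite eB'; apply: (step) => // [k|]; first by rewrite -eB'.
apply: IHm => // [A' s' le1 le2|].
  apply: (step) => // k; apply: le_trans (le2 k) _.
  by rewrite /B' gerBl; case: (k == s).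
move: eB; rewrite (bigD1 s) //= => eB; rewrite (bigD1 s) //=; move: eB.
have -> : (\sum_(i | i != s) `|B i - A i| = \sum_(i | i != s) `|B' i - A i|)%N.
  by apply: eq_bigr => k /negbTE nks; rewrite /B' nks subr0.
have : B' s = B s - 1 by rewrite /B' eqxx.
by move: ltAB (leAB' s); clear; lia.
Qed.

(** Go up from [A] to the pointwise maximum of [A] and [B], then down to [B]. *)
Lemma div_walk (Q : (I -> int) -> Prop) A B :
  (forall A' s, Q A' <-> Q (inc A' s)) -> Q A -> Q B.
Proof.
move=> step QA; pose M k := Num.max (A k) (B k).
have QM : Q M.
  apply: (div_le_ind _ QA) => [k|A' s _ _ /step //].
  by rewrite /M le_max lexx.
apply: contrapT => nQB; suff : ~ Q M by [].
apply: (div_le_ind (Q := fun A' => ~ Q A') _ nQB) => [k|A' s _ _ nQ Qi]; last by apply: nQ; apply/(step A' s).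
by rewrite /M le_max lexx orbT.
Qed.

End DivisorInduction.

Record rational_points (F : finFieldType) (f : {mpoly F[3]}) (I : finType)
  (pt : I -> 'rV[F]_3) : Prop := RationalPoints {
    rp_on : forall s, on_curve f (geom_point (pt s));
    rp_ne : forall s s', s != s' -> ~~ (pt s == pt s')%MS }.

Section Divisors.
Variables (F : finFieldType) (n : nat) (f : {mpoly F[3]}).
Hypothesis C : smooth_curve n f.
Variable K : function_field f.
Local Notation c := (ff_const K).
Variables (I : finType) (pt : I -> 'rV[F]_3).
Hypothesis rp : rational_points f pt.
Implicit Types (A B : I -> int) (R : 'rV[Fbar F]_3).
Local Notation gpt s := (geom_point (pt s)).

Definition Dv A : divisor F := fun R => \sum_s A s * point_divisor (pt s) R.

Lemma same_pointP P R : on_curve f R -> (geom_point P == R)%MS ->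
  exists2 a, a != 0 & R = a *: geom_point P.
Proof.
move=> [nR _] /andP[_ /sub_rVP[a eR]]; exists a => //.
by apply: contraNneq nR => a0; rewrite eR a0 scale0r.
Qed.

Lemma Dv_at A s R : (gpt s == R)%MS -> Dv A R = A s.
Proof.
move=> sR; rewrite /Dv (bigD1 s) //= /point_divisor sR mulr1 big1 ?addr0 //.
move=> s' ns; case: (boolP (_ == _)%MS) => [s'R|]; last by rewrite mulr0.
have /negP[] := rp_ne rp ns; move/andP: s'R => [h1 h2]; move/andP: sR => [h3 h4].
by apply/andP; split; rewrite -(map_submx (to_Fbar F)); [apply: submx_trans h1 h4|apply: submx_trans h3 h2].
Qed.

Lemma Dv_away A R : (forall s, ~~ (gpt s == R)%MS) -> Dv A R = 0.
Proof.
by move=> h; rewrite /Dv big1 // => s _; rewrite /point_divisor (negbTE (h s)) mulr0.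
Qed.

Lemma Dv_cases R : (exists s, (gpt s == R)%MS) \/ (forall s, ~~ (gpt s == R)%MS).
Proof.
have [s sR|h] := pickP (fun s => (gpt s == R)%MS); first by left; exists s.
by right=> s; rewrite h.
Qed.

Lemma DvD A B R : Dv (fun s => A s + B s) R = Dv A R + Dv B R.
Proof. by rewrite /Dv -big_split; apply: eq_bigr => s _; rewrite mulrDl. Qed.

Lemma DvB A B R : Dv (fun s => A s - B s) R = Dv A R - Dv B R.
Proof. by rewrite /Dv -sumrB; apply: eq_bigr => s _; rewrite mulrBl. Qed.

Lemma DvZ a A R : Dv (fun s => a * A s) R = a * Dv A R.
Proof. by rewrite /Dv mulr_sumr; apply: eq_bigr => s _; rewrite mulrA. Qed.

Lemma Dv_le A B R : (forall s, A s <= B s) -> Dv A R <= Dv B R.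
Proof. by move=> le; apply: ler_sum => s _; apply: ler_wpM2r. Qed.

(** The Riemann-Roch space L(A). The condition concerns every geometric point, although [A] is
    supported on finitely many rational ones. *)
Definition LL A (v : K) := forall R, on_curve f R -> ordge R (- Dv A R) v.

Lemma LL_le A B v : (forall s, A s <= B s) -> LL A v -> LL B v.
Proof.
move=> le hv R Rf; apply: (ordge_le C) (hv R Rf).
by rewrite lerN2; apply: Dv_le.
Qed.

Lemma LL_subsp A : subsp c (LL A).
Proof.
split=> [R Rf|a u v hu hv R Rf]; first exact: (ordge0 C).
exact: (ordgeD C Rf (ordgeZ C Rf a (hu R Rf)) (hv R Rf)).
Qed.

Lemma LL_mul A B u v : LL A u -> LL B v -> LL (fun s => A s + B s) (u * v).
Proof. by move=> hu hv R Rf; rewrite DvD opprD; exact: (ordgeM C (hu R Rf) (hv R Rf)). Qed.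

Lemma LL_incP A s v : LL A v <-> LL (inc A s) v /\ ordge (gpt s) (- A s) v.
Proof.
have le k : A k <= inc A s k by rewrite /inc lerDl; case: (k == s).
split=> [hv|[hv hs] R Rf].
  split; first exact: LL_le hv.
  have := hv _ (rp_on rp s); rewrite (@Dv_at _ s) // submx_refl //.
have [[s' s'R]|h] := Dv_cases R; last first.
  by have := hv R Rf; rewrite !Dv_away.
have [a na eR] := same_pointP Rf s'R.
rewrite (Dv_at _ s'R) eR; apply/(ordge_scale C) => //.
have := hv R Rf; rewrite (Dv_at _ s'R) eR => /(ordge_scale C _ _ _ na).
by rewrite /inc; case: eqVneq => [->|_]; rewrite ?addr0.
Qed.

Lemma eval_geom (P : 'rV[F]_3) (A : {mpoly F[3]}) :
  eval_at (to_Fbar F) (geom_point P) A = to_Fbar F A.@[P 0].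
Proof.
elim/mpoly_ind_ring: A => [b|p q ep eq|j p ep].
- by rewrite evalC mevalC.
- by rewrite mevalD !rmorphD /= ep eq.
- by rewrite mevalM !rmorphM /= ep !evalX mevalXU mxE.
Qed.

Lemma vl_rational (P : 'rV[F]_3) d (v : K) a :
  vl (geom_point P) d v a -> exists b, a = to_Fbar F b.
Proof. by move=> [e [A [B [_ _ _ _ ->]]]]; rewrite !eval_geom; eexists; rewrite -fmorph_div. Qed.

(** [lam v] is the value of [v / t^k] at the point. The point is rational, so this value lies in
    [F]; hence one more point adds at most one dimension over [F]. *)
Lemma leading_coef s k : exists lam : K -> F,
  (forall a u v, ordge (gpt s) k u -> ordge (gpt s) k v ->
     lam (c a * u + v) = a * lam u + lam v) /\
  forall v, ordge (gpt s) k v -> lam v = 0 <-> ordge (gpt s) (k + 1) v.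
Proof.
have Pf := rp_on rp s; have [t ut] := exists_unif C K Pf.
have nt : t != 0 by case: ut.
have /choice[lam hlam] : forall v : K, exists a : F, ordge (gpt s) k v ->
    vl (gpt s) 0 (v / t ^ k) (to_Fbar F a).
  move=> v; have [hv|nv] := pselect (ordge (gpt s) k v); last by exists 0.
  have /(ordgeE C _ _ ut)/(local_ringP C)[a va] := hv.
  by have [b eb] := vl_rational va; exists b; rewrite -eb.
exists lam; split=> [a u v hu hv|v hv].
  apply: (fmorph_inj (to_Fbar F)); rewrite rmorphD rmorphM /=.
  apply: (vl_uniq C Pf (hlam _ (ordgeD C Pf (ordgeZ C Pf a hu) hv))).
  rewrite mulrDl -mulrA; apply: (vlD C Pf); last exact: hlam.
  by rewrite -[0%N]addn0; apply: vlM (vl_const K _ a) (hlam _ hu).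
have -> : ordge (gpt s) (k + 1) v <-> maximal_ideal (gpt s) (v / t ^ k).
  rewrite (maximal_ordge C Pf) (ordgeE C _ _ ut) (ordgeE C _ _ ut).
  by rewrite expfzDr // invfM mulrA.
split=> [l0|/(maximal_idealP C) h].
  by apply/(maximal_idealP C); have := hlam _ hv; rewrite l0 rmorph0.
by apply/eqP; rewrite -(fmorph_eq0 (to_Fbar F)); apply/eqP/(vl_uniq C Pf (hlam _ hv) h).
Qed.

End Divisors.

(** * Simple poles of twisted functions at a rational point *)

Section RationalPoint.
Variables (F : finFieldType) (n : nat) (f : {mpoly F[3]}).
Hypothesis C : smooth_curve n f.
Variable K : function_field f.
Local Notation ev := (@ev F f K).
Local Notation at_P P := (eval_at (to_Fbar F) P).

Variables (P : 'rV[F]_3) (x y z : 'I_3).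
Local Notation Q := (geom_point P).
Hypotheses (Qf : on_curve f Q) (Px : P 0 x = 1).
Hypotheses (nyx : y != x) (nzx : z != x) (nyz : y != z).
Local Notation ly := (line_at P x y).
Local Notation lz := (line_at P x z).

Let Qx : Q 0 x != 0.
Proof. by rewrite mxE Px rmorph1 oner_eq0. Qed.

Lemma line_atE k R : at_P R (line_at P x k) = R 0 k - to_Fbar F (P 0 k) * R 0 x.
Proof. by rewrite rmorphB /= evalX evalZ evalX. Qed.

Lemma line_at_Q k : at_P Q (line_at P x k) = 0.
Proof. by rewrite line_atE !mxE Px rmorph1 mulr1 subrr. Qed.

Lemma line_neq0 k : k != x -> ev (line_at P x k) != 0.
Proof.
move=> nk; apply/eqP => /(ev_small C (dhomog_line P x k)); rewrite ltnW ?(sc_deg C) //.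
move=> /(_ isT)/(congr1 (mcoeff U_(k)%MM))/eqP.
rewrite mcoeffB mcoeffZ !mcoeffX eqxx mcoeff0 (_ : (U_(x)%MM == U_(k)%MM) = false).
  by rewrite /= mulr0 subr0 oner_eq0.
apply/negbTE; apply: contra nk => /eqP/mnmP/(_ k); rewrite !mnmE eqxx.
by case: eqP => [->|].
Qed.

Lemma lines_away R : on_curve f R -> ~~ (Q == R)%MS -> at_P R ly != 0 \/ at_P R lz != 0.
Proof.
move=> [nR _] away; apply/orP; apply: contraR away; rewrite negb_or !negbK !line_atE.
rewrite !subr_eq0 => /andP[/eqP ey /eqP ez].
have eR : R = R 0 x *: Q.
  apply/rowP => k; rewrite !mxE mulrC.
  have [->|kx] := eqVneq k x; first by rewrite Px rmorph1 mul1r.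
  have [->|ky] := eqVneq k y; first exact: ey.
  have [->|kz] := eqVneq k z; first exact: ez.
  by case: (ord3_distinct nyx nzx nyz kx ky kz).
have nx : R 0 x != 0 by apply: contraNneq nR => x0; rewrite eR x0 scale0r.
apply/andP; split; rewrite eR; last exact: scalemx_sub (submx_refl _).
have := scalemx_sub (R 0 x)^-1 (submx_refl (R 0 x *: Q)).
by rewrite scalerA mulVf // scale1r.
Qed.

Lemma line_order k : k != x -> ordge Q 1 (ev (line_at P x k) / ev 'X_x).
Proof.
move=> nk; apply/(maximal_ordge C Qf)/(maximal_idealP C).
exists 1%N, (line_at P x k), 'X_x; rewrite addn0 evalX line_at_Q mul0r.
by split=> //; [apply: dhomog_line|apply: dhomogXU].
Qed.

(* A twisted function of degree [e <= n - 2] has no simple pole at [P] only: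
   multiplying by the equation of a line through [P] makes it a form of degree
   [e + 1], and two such lines make the equation of the line a factor. *)
Lemma no_simple_pole e (w : K) : (e.+2 <= n)%N ->
    (forall R, on_curve f R -> ~~ (Q == R)%MS -> exists a, vl R e w a) ->
    ordge Q (-1) (w / ev 'X_x ^+ e) ->
  forms e w.
Proof.
move=> len reg wQ.
have lw k : k != x -> forms e.+1 (ev (line_at P x k) * w).
  move=> nk; apply: (noether C) => R Rf.
  have [QR|away] := boolP (Q == R)%MS; last first.
    have [a ha] := reg R Rf away; eexists.
    by rewrite -add1n; apply: vlM (vl_form K R (dhomog_line P x k)) ha.
  have [a na eR] := same_pointP Rf QR.
  have Rx : R 0 x != 0 by rewrite eR mxE mulf_neq0.
  apply/(reg_chart C Rf e.+1 _ Rx); rewrite eR; apply/(ordge_scale C) => //.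
  have := ordgeM C (line_order nk) wQ; rewrite addrN; congr ordge.
  by rewrite exprS invfM; ring.
have [A hA eA] := lw y nyx; have [B hB eB] := lw z nzx.
have eAB : lz * A = ly * B.
  apply/eqP; rewrite -subr_eq0; apply/eqP.
  have hAB : lz * A - ly * B \is (1 + e.+1).-homog.
    by apply: dhomogB; apply: dhomogM => //; apply: dhomog_line.
  apply: (ev_small (K := K) C hAB len).
  by rewrite rmorphB !rmorphM /= -eA -eB; ring.
pose s k : {mpoly F[3]} := if k == y then P 0 y *: 'X_x else 'X_k.
have hs k : s k \is 1.-homog.
  by rewrite /s; case: eqP => _; [apply: dhomogZ|]; apply: dhomogXU.
have sx : s x = 'X_x by rewrite /s eq_sym (negbTE nyx).
have subst_line k : subst s (line_at P x k) = s k - P 0 k *: 'X_x.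
  by rewrite /line_at rmorphB -mul_mpolyC rmorphM /= substC !substX sx mul_mpolyC.
have A0 : subst s A = 0.
  have nl : lz != 0 by apply: contraNneq (line_neq0 nzx) => ->; rewrite rmorph0.
  apply: (mulfI nl); rewrite mulr0; have := congr1 (subst s) eAB.
  rewrite !rmorphM /= !subst_line /s eqxx subrr mul0r.
  by rewrite [z == y]eq_sym (negbTE nyz).
have [q hq] := subst_cong_homog hs hA; rewrite A0 add0r (bigD1 y) //= big1 ?addr0.
  rewrite /s eqxx => eq; exists (q y); first exact: hq.
  by apply: (mulfI (line_neq0 nyx)); rewrite eA eq rmorphM.
by move=> k /negbTE nk; rewrite /s nk subrr mul0r.
Qed.

(** Write [f = ly a + lz b] and take [w = b / ly = - a / lz] on the curve, which can have a pole
    only where both lines vanish. The numerator [T = ly T1 + lz T2] of a uniformizer gives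
    [w T = T1 b - T2 a], so the pole is at most simple; without a pole, [a] and [b] would vanish at
    [P], and with them all partial derivatives of [f]. The degree [n - 1] is the first beyond the
    range of [no_simple_pole]. *)
Lemma simple_pole : exists w : K,
  [/\ forall R, on_curve f R -> ~~ (Q == R)%MS -> exists a, vl R n.-1 w a,
      ordge Q (-1) (w / ev 'X_x ^+ n.-1) & ~ ordge Q 0 (w / ev 'X_x ^+ n.-1)].
Proof.
have n1 : n = n.-1.+1 by rewrite prednK // ltnW ?(sc_deg C).
have decomp d A : A \is d.-homog -> at_P Q A = 0 -> exists A1 A2,
    [/\ A1 \is d.-1.-homog, A2 \is d.-1.-homog & A = ly * A1 + lz * A2].
  move=> hA /eqP; rewrite eval_geom fmorph_eq0 => /eqP A0.
  have [q hq eA] := vanishing_form Px hA A0.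
  exists (q y), (q z); split=> //; rewrite [LHS]eA (bigD1 y) //= (bigD1 z) /=; last first.
    by rewrite nzx eq_sym.
  rewrite big1 ?addr0 // => k /andP[/andP[kx ky] kz].
  by case: (ord3_distinct nyx nzx nyz kx ky kz).
have [a [b [ha hb ef]]] := decomp _ _ (sc_homog C) (proj2 Qf).
have ny := line_neq0 nyx; have nz := line_neq0 nzx.
have rel : ev ly * ev a = - (ev lz * ev b).
  have /= := congr1 (fun p => ev p) ef; rewrite (ev_f C K) rmorphD !rmorphM /= => /esym/eqP.
  by rewrite addr_eq0 => /eqP.
pose w := ev b / ev ly; have ew : w = - (ev a / ev lz).
  by rewrite /w -mulNr; apply/eqP; rewrite eqr_div // mulNr mulrC -[X in X == _]opprK -rel mulrC.
have hb' : b \is (1 + n.-1).-homog by apply: dhomog_cast hb _.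
have ha' : a \is (1 + n.-1).-homog by apply: dhomog_cast ha _.
exists w; split=> [R Rf away||].
- have [nl|nl] := lines_away Rf away.
    by eexists; exists 1%N, b, ly; split=> //; apply: dhomog_line.
  exists (- (at_P R a / at_P R lz)); rewrite ew; apply: vlN.
  by exists 1%N, a, lz; split=> //; apply: dhomog_line.
- have [t ut] := exists_unif C K Qf.
  have [nt /(maximal_idealP C)[N [T [S [hT hS nS et e0]]]] _] := ut.
  rewrite addn0 in hT; have T0 : at_P Q T = 0.
    by apply/eqP; move/esym/eqP: e0; rewrite mulf_eq0 invr_eq0 (negbTE nS) orbF.
  have [T1 [T2 [hT1 hT2 eT]]] := decomp _ _ hT T0.
  have nS' := at_ev_neq0 C K Qf hS nS.
  apply/(ordgeE C _ _ ut); rewrite -invr_expz invrK expr1z.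
  have [N0|N0] := posnP N.
    have : T = 0.
      move: T0; rewrite (dhomog0E (dhomog_cast hT N0)) evalC => /eqP.
      by rewrite fmorph_eq0 => /eqP->; rewrite mpolyC0.
    by move=> T00; case/eqP: nt; rewrite et T00 rmorph0 mul0r.
  have -> : w / ev 'X_x ^+ n.-1 * t = (ev (T1 * b - T2 * a) / ev S) / ev 'X_x ^+ n.-1.
    rewrite mulrAC; congr (_ / _); rewrite et eT rmorphD rmorphB !rmorphM /=.
    rewrite mulrA; congr (_ / _); rewrite mulrDr {1}/w ew.
    rewrite (mulrA (ev b / ev ly)) divfK // mulNr (mulrA (ev a / ev lz)) divfK //.
    by rewrite (mulrC (ev b)) (mulrC (ev a)).
  apply/(ordge_local C Qf)/(reg_chart C Qf) => //; eexists.
  exists N, (T1 * b - T2 * a), S; split=> //.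
  by apply: dhomogB; [apply: dhomog_cast (dhomogM hT1 hb) _|apply: dhomog_cast (dhomogM hT2 ha) _];
    move: N0 n1; clear; lia.
- move=> /(reg_chart C Qf _ _ Qx)[v wv].
  have b0 : at_P Q b = 0.
    have := vlM wv (vl_form K Q (dhomog_line P x y)).
    rewrite line_at_Q mulr0 /w divfK // addn1 => h.
    by apply: (vl_uniq C Qf _ h); rewrite -n1; apply: vl_form.
  have a0 : at_P Q a = 0.
    have := vlN (vlM wv (vl_form K Q (dhomog_line P x z))).
    rewrite line_at_Q mulr0 oppr0 ew mulNr opprK divfK // addn1 => h.
    by apply: (vl_uniq C Qf _ h); rewrite -n1; apply: vl_form.
  have [k] := sc_smooth C Qf; have -> : f^`M(k) = (ly * a + lz * b)^`M(k) by rewrite -ef.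
  move: (line_at_Q y) (line_at_Q z); move: ly lz => l1 l2 e1 e2; rewrite mderivD !mderivM.
  by rewrite !(rmorphD, rmorphM) /= e1 e2 a0 b0 !mulr0 !mul0r !addr0 eqxx.
Qed.

End RationalPoint.

(** * Riemann-Roch *)

Section RiemannRoch.
Variables (F : finFieldType) (n : nat) (f : {mpoly F[3]}).
Hypothesis C : smooth_curve n f.
Variable K : function_field f.
Local Notation c := (ff_const K).
Local Notation ev := (@ev F f K).
Variables (I : finType) (pt : I -> 'rV[F]_3).
Hypothesis rp : rational_points f pt.
Variable H : I -> int.
Local Notation gpt s := (geom_point (pt s)).
Local Notation z := (ev 'X_i2).
Local Notation LL := (@LL F f K I pt).
Local Notation Dv := (@Dv F I pt).

(* [H] is the divisor of the linear form [Z]. *)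
Hypotheses (H0 : forall s, 0 <= H s) (Hdeg : \sum_s H s = n.+1%:Z).
Hypothesis Hz : forall R x, on_curve f R -> R 0 x != 0 ->
  ordeq R (Dv H R) (z / ev 'X_x).
Implicit Types A B : I -> int.

Definition Hk (k : int) : I -> int := fun s => k * H s.

(** A function [v] with poles bounded by kH corresponds to the section [v Z^k] of O(k), whose order
    is read off after division by a power of a coordinate nonzero at [R]. *)
Lemma ordge_zX R x (k : nat) v l : on_curve f R -> R 0 x != 0 ->
  ordge R (l - Dv (Hk k%:Z) R) v <-> ordge R l (v * z ^+ k / ev 'X_x ^+ k).
Proof.
move=> Rf Rx; have o := ordeqX C Rf k (Hz Rf Rx).
have nx := evX_neq0 C K x; have nz := evX_neq0 C K i2.
rewrite DvZ mulrC; split=> [h|h].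
  by have := ordgeM C h (proj1 o); rewrite subrK; congr ordge; rewrite expr_div_n mulrA.
have := ordgeM C h (ordeqV C Rf o); congr ordge; rewrite expr_div_n invf_div.
by field; rewrite !expf_neq0.
Qed.

Lemma LL_Hk (k : nat) v : LL (Hk k%:Z) v <-> forms k (v * z ^+ k).
Proof.
split=> [hv|[A hA eA] R Rf].
  apply: (noether C) => R Rf; have [x [_ [_ [_ _ _ Rx _]]]] := smooth_chart C Rf.
  apply/(reg_chart C Rf _ _ Rx)/(ordge_zX _ _ _ Rf Rx).
  by rewrite sub0r; apply: hv.
have [x [_ [_ [_ _ _ Rx _]]]] := smooth_chart C Rf.
rewrite -sub0r; apply/(ordge_zX _ _ _ Rf Rx)/(reg_chart C Rf _ _ Rx).
by rewrite eA; eexists; apply: vl_form.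
Qed.

Lemma hasdim_Hk (k : nat) : (n < k)%N ->
  hasdim c (LL (Hk k%:Z)) (k * n.+1 + 1 - 'C(n, 2)).
Proof.
move=> ltnk; have nz : z ^- k != 0 by rewrite invr_eq0 expf_neq0 ?(evX_neq0 C).
apply: hasdim_ext (hasdim_scale nz (hilbert C K ltnk)) => v.
by rewrite invrK LL_Hk.
Qed.

Lemma LL_inc_dim A s r : hasdim c (LL (inc A s)) r -> exists r',
  [/\ hasdim c (LL A) r', (r' <= r <= r'.+1)%N
    & (forall v, LL (inc A s) v -> LL A v) <-> r' = r].
Proof.
move=> d; have [lam [lamL lam0]] := leading_coef C K rp s (- inc A s s).
have ge v : LL (inc A s) v -> ordge (gpt s) (- inc A s s) v.
  by move=> hv; have := hv _ (rp_on rp s); rewrite (Dv_at rp _ (s := s)) ?submx_refl.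
have [a u v hu hv|v|r' [d' le1 le2 iff']] := hasdim_ker (U := LL A) (lam := lam) d.
- by apply: lamL; apply: ge.
- rewrite (LL_incP C rp A s); have e : - A s = - inc A s s + 1.
    by rewrite /inc eqxx opprD addrNK.
  rewrite e; split=> -[hv h]; split=> //; first by apply/lam0 => //; apply: ge.
  by apply/lam0 => //; apply: ge.
by exists r'; rewrite le1 le2.
Qed.

(** Finiteness holds for a large multiple of [H] by [hilbert]; adding or removing a point changes
    the dimension by at most one, so it spreads to all divisors. *)
Lemma LL_hasdim A : exists r, hasdim c (LL A) r.
Proof.
apply: (div_walk (Q := fun A => exists r, hasdim c (LL A) r) (A := Hk n.+1%:Z)); last first.
  by eexists; apply: hasdim_Hk.
move=> A' s; split=> [[r d]|[r /LL_inc_dim[r' [d _ _]]]]; last by exists r'.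
have [|/existsNP[v /not_implyP[hv nv]]] := pselect (forall v, LL (inc A' s) v -> LL A' v).
  move=> sub; exists r; apply: hasdim_ext d => v; split=> [|/sub //].
  by move/(LL_incP C rp A' s) => [].
have [lam [lamL lam0]] := leading_coef C K rp s (- inc A' s s).
have ge w : LL (inc A' s) w -> ordge (gpt s) (- inc A' s s) w.
  by move=> hw; have := hw _ (rp_on rp s); rewrite (Dv_at rp _ (s := s)) ?submx_refl.
have LL0 w : LL (inc A' s) w -> lam w = 0 -> LL A' w.
  move=> hw l0; apply/(LL_incP C rp A' s); split=> //.
  have -> : - A' s = - inc A' s s + 1 by rewrite /inc eqxx opprD addrNK.
  by apply/lam0 => //; apply: ge.
have nl : lam v != 0 by apply/eqP => l0; apply: nv; apply: LL0.
have [LZ LL_] := LL_subsp C K pt (inc A' s).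
exists r.+1; apply: hasdim_ext (hasdim_add d nv) => w; split=> [[a ha]|hw].
  have := LL_ a _ _ hv (proj1 (proj1 (LL_incP C rp A' s _) ha)).
  by rewrite addrC subrK.
exists (lam w / lam v); have e : w - c (lam w / lam v) * v = c (- (lam w / lam v)) * v + w.
  by rewrite [c (- _)]raddfN mulNr addrC.
rewrite e; apply: LL0; first exact: LL_.
rewrite lamL; [|exact: ge|exact: ge].
by rewrite mulNr divfK // addNr.
Qed.

Lemma ell_exists : exists l : (I -> int) -> nat, forall A, hasdim c (LL A) (l A).
Proof. by have /choice[l hl] := LL_hasdim; exists l. Qed.

Lemma rescaled_point s x : gpt s 0 x != 0 -> exists (P : 'rV[F]_3) (a : Fbar F),
  [/\ P 0 x = 1, a != 0 & geom_point P = a *: gpt s].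
Proof.
rewrite mxE fmorph_eq0 => nx; exists ((pt s 0 x)^-1 *: pt s), (to_Fbar F (pt s 0 x)^-1).
by rewrite mxE mulVf // fmorph_eq0 invr_eq0 nx /geom_point map_mxZ.
Qed.

Lemma scale_same_point a (P R : 'rV[Fbar F]_3) : a != 0 -> (a *: P == R)%MS = (P == R)%MS.
Proof.
move=> na; have sc : (a *: P :=: P)%MS by apply: eqmx_scale.
by rewrite !sc.
Qed.

Lemma other_indices (x : 'I_3) : exists y w, [/\ y != x, w != x & y != w].
Proof. by move: x; elim/ord3P; [exists i1, i2|exists i0, i2|exists i0, i1]. Qed.

Lemma point_chart s : exists x, gpt s 0 x != 0.
Proof.
by have [x [_ [_ [_ _ _ Rx _]]]] := smooth_chart C (rp_on rp s); exists x.
Qed.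

Definition W := Hk (n%:Z - 2).

Lemma Dv_inc_away A s R : ~~ (gpt s == R)%MS -> Dv (inc A s) R = Dv A R.
Proof.
move=> nR; have [[s' s'R]|away] := Dv_cases pt R; last by rewrite !Dv_away.
rewrite !(Dv_at rp _ s'R) /inc; case: eqVneq s'R nR => [->->//|_ _ _].
by rewrite addr0.
Qed.

(** After multiplication by [Z^(n - 2)] this is [no_simple_pole] in its largest degree. *)
Lemma residue s v : LL (inc W s) v -> LL W v.
Proof.
move=> hv; have n2 := sc_deg C.
have eW : W = Hk (n - 2)%N%:Z by rewrite /W -subzn.
have [x sx] := point_chart s; have [P [a [Px na eP]]] := rescaled_point sx.
have [y [w [yx wx yw]]] := other_indices x.
have Pf : on_curve f (geom_point P) by rewrite eP; apply: (on_curve_scale C na (rp_on rp s)).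
rewrite eW; apply/LL_Hk.
apply: (no_simple_pole C Pf Px yx wx yw); first by move: n2; clear; lia.
  move=> R Rf; rewrite eP scale_same_point // => away.
  have [x' [_ [_ [_ _ _ Rx' _]]]] := smooth_chart C Rf.
  apply/(reg_chart C Rf _ _ Rx')/(ordge_zX _ _ _ Rf Rx').
  by rewrite sub0r -eW -(Dv_inc_away _ away); apply: hv.
rewrite eP; apply/(ordge_scale C _ _ _ na)/(ordge_zX _ _ _ (rp_on rp s) sx).
have := hv _ (rp_on rp s); rewrite -eW !(Dv_at rp _ (s := s)) ?submx_refl //.
by rewrite /inc eqxx opprD addrC.
Qed.

(** Multiplying the function of [simple_pole] by a power of a coordinate nonzero at the point raises
    its degree from [n - 1] to [k] and keeps the pole. *)
Lemma pole s (k : nat) : (n <= k)%N ->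
  exists2 v, LL (inc (Hk k%:Z) s) v & ~ ordge (gpt s) (- Hk k%:Z s) v.
Proof.
move=> lenk; have [x sx] := point_chart s; have [P [a [Px na eP]]] := rescaled_point sx.
have [y [w [yx wx yw]]] := other_indices x.
have sf := rp_on rp s.
have Pf : on_curve f (geom_point P) by rewrite eP; apply: (on_curve_scale C na sf).
have [h [hreg hge hnge]] := simple_pole C K Pf Px yx wx yw.
have nz := evX_neq0 C K i2; have nx := evX_neq0 C K x.
pose v := h * ev 'X_x ^+ (k - n.-1) / z ^+ k.
have ev_v : v * z ^+ k / ev 'X_x ^+ k = h / ev 'X_x ^+ n.-1.
  have -> : ev 'X_x ^+ k = ev 'X_x ^+ (k - n.-1) * ev 'X_x ^+ n.-1.
    by rewrite -exprD subnK // (leq_trans (leq_pred n)).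
  by rewrite /v; field; rewrite !expf_neq0.
rewrite eP in hge hnge.
have {}hge := proj1 (ordge_scale C _ _ _ na) hge.
have {}hnge : ~ ordge (gpt s) 0 (h / ev 'X_x ^+ n.-1).
  by move=> h0; apply: hnge; apply/(ordge_scale C _ _ _ na).
have Ds A : Dv A (gpt s) = A s by rewrite (Dv_at rp _ (s := s)) ?submx_refl.
exists v => [R Rf|h0]; last first.
  apply: hnge; rewrite -ev_v; apply/(ordge_zX _ _ _ sf sx).
  by rewrite sub0r Ds.
have [sR|away] := boolP (gpt s == R)%MS.
  have [b nb eR] := same_pointP Rf sR; rewrite (Dv_at rp _ sR) eR.
  apply/(ordge_scale C _ _ _ nb).
  have := proj2 (ordge_zX _ _ _ sf sx) (eq_ind_r (ordge (gpt s) (-1)) hge ev_v).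
  by rewrite !Ds /inc eqxx opprD addrC.
rewrite Dv_inc_away // -sub0r.
have [x' [_ [_ [_ _ _ Rx' _]]]] := smooth_chart C Rf.
apply/(ordge_zX _ _ _ Rf Rx')/(reg_chart C Rf _ _ Rx').
have [|b hb] := hreg R Rf; first by rewrite eP scale_same_point.
have := vlM hb (vl_form K R (dhomogXUn F x (k - n.-1))).
rewrite subnKC ?(leq_trans (leq_pred n)) // => hb'; eexists.
by rewrite /v divfK ?expf_neq0 //; rewrite rmorphXn in hb'; apply: hb'.
Qed.

Variable ell : (I -> int) -> nat.
Hypothesis ellP : forall A, hasdim c (LL A) (ell A).

Definition deg A : int := \sum_s A s.

Lemma degB A B : deg (fun s => A s - B s) = deg A - deg B.
Proof. by rewrite /deg sumrB. Qed.

(** For the genus [C(n, 2)], this turns out to be the dimension of L(W - A). *)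
Definition excess A : int := (ell A)%:Z - deg A - 1 + 'C(n, 2)%:Z.

Lemma deg_inc A s : deg (inc A s) = deg A + 1.
Proof.
rewrite /deg big_split /=; congr (_ + _).
by rewrite (bigD1 s) //= eqxx big1 // => k /negbTE->.
Qed.

Lemma ell_inc A s : (ell A <= ell (inc A s) <= (ell A).+1)%N.
Proof.
by have [r [d le _]] := LL_inc_dim (ellP (inc A s)); rewrite (hasdim_uniq (ellP A) d).
Qed.

Lemma ell_incE A s : ell A = ell (inc A s) <-> forall v, LL (inc A s) v -> LL A v.
Proof.
by have [r [d _ iff']] := LL_inc_dim (ellP (inc A s)); rewrite (hasdim_uniq (ellP A) d) iff'.
Qed.

Lemma ell_incS A s : ell A <> ell (inc A s) -> exists2 u, LL (inc A s) u &
  ordeq (gpt s) (- inc A s s) u.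
Proof.
move=> ne; have [u hu nu] : exists2 u, LL (inc A s) u & ~ LL A u.
  apply: contrapT => h; apply: ne; apply/ell_incE => v hv.
  by apply: contrapT => nv; apply: h; exists v.
exists u => //; split.
  by have := hu _ (rp_on rp s); rewrite (Dv_at rp _ (s := s)) ?submx_refl.
move=> h; apply: nu; apply/(LL_incP C rp A s); split=> //.
by move: h; rewrite /inc eqxx opprD addrNK.
Qed.

Lemma ell_mul A B (v : K) : v != 0 -> LL A v -> (ell B <= ell (fun s => A s + B s)%R)%N.
Proof.
move=> nv hv; apply: hasdim_leq (hasdim_scale nv (ellP B)) (ellP _) _ => w hw.
by have := LL_mul C hv hw; rewrite mulrC divfK.
Qed.

Lemma excess_inc A s : excess (inc A s) <= excess A.
Proof. by rewrite /excess deg_inc; have := ell_inc A s; clear; lia. Qed.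

Lemma excess_le A B : (forall s, A s <= B s) -> excess B <= excess A.
Proof.
move=> le; apply: (div_le_ind (Q := fun B => excess B <= excess A) le (lexx _)).
by move=> A' s _ _; apply: le_trans; apply: excess_inc.
Qed.

Lemma deg_Hk k : deg (Hk k) = k * n.+1%:Z.
Proof. by rewrite /deg /Hk -mulr_sumr Hdeg. Qed.

Lemma bin2_lt : (n <= n * n.+1)%N /\ ('C(n, 2) * 2 = n * n.-1)%N.
Proof.
split; first by rewrite leq_pmulr.
by rewrite -[X in (_ * X)%N]/(2`!) bin_ffact !ffactnS ffactn0 muln1.
Qed.

Lemma excess_Hk (k : nat) : (n < k)%N -> excess (Hk k%:Z) = 0.
Proof.
move=> ltnk; rewrite /excess deg_Hk (hasdim_uniq (ellP _) (hasdim_Hk ltnk)).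
have le : ('C(n, 2) <= k * n.+1)%N.
  have [_ e] := bin2_lt; move: e ltnk; case: (n) => [|m] //=; move: 'C(_, 2); clear; nia.
by rewrite -subzn; [rewrite PoszD PoszM; ring|rewrite (leq_trans le) ?leq_addr].
Qed.

(** [H] may be zero at some points. The extra [1] makes the range from [W - top k] to [top k]
    contain the coefficients -1, 0 and 1 at such points. *)
Definition top (k : nat) : I -> int := fun s => Hk k%:Z s + 1.

(** From [Hk k] to [top k] each point is added exactly once, and each time the function given by
    [pole] makes the dimension jump together with the degree. *)
Lemma excess_top (k : nat) : (n < k)%N -> excess (top k) = 0.
Proof.
move=> ltnk; apply: (div_le_ind (Q := fun A => excess A = 0) (A := Hk k%:Z)) => [s||A' s le1 le2 e0].
- by rewrite /top lerDl.
- exact: excess_Hk.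
have eA : A' s = Hk k%:Z s.
  apply/eqP; rewrite eq_le le1 andbT; have := le2 s.
  by rewrite /inc /top eqxx lerD2r.
have [v hv nv] := pole s (ltnW ltnk).
have hv' : LL (inc A' s) v.
  by apply: (LL_le C) hv => k'; rewrite /inc lerD2r.
have ne : ell A' <> ell (inc A' s).
  move/ell_incE => /(_ v hv') h; apply: nv; rewrite -eA.
  by have := h _ (rp_on rp s); rewrite (Dv_at rp _ (s := s)) ?submx_refl.
move: e0 ne; rewrite /excess deg_inc; have := ell_inc A' s; clear; lia.
Qed.

Definition defect A : int := excess A - (ell (fun s => W s - A s))%:Z.

(** The degree grows by one, l(A) by at most one, and l(W - A) drops by at most one, so only a
    double jump could increase the defect. It would give [u] and [v] whose product has order exactly
    [- W s - 1] at the point and is otherwise bounded by [W], against [residue]. *)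
Lemma defect_inc A s : defect (inc A s) <= defect A.
Proof.
pose B k := W k - inc A s k.
have eB : (fun k => W k - A k) = inc B s.
  by apply/funext => k; rewrite /B /inc opprD addrA subrK.
rewrite /defect eB -/B.
have [e|ne] := pselect (ell A = ell (inc A s)).
  by have := ell_inc B s; rewrite /excess deg_inc -e; clear; lia.
have [e|ne'] := pselect (ell B = ell (inc B s)).
  by have := ell_inc A s; rewrite /excess deg_inc -e; clear; lia.
have [u hu ou] := ell_incS ne; have [v hv ov] := ell_incS ne'.
have huv : LL (inc W s) (u * v).
  have := LL_mul C hu hv; congr LL; apply/funext => k.
  by rewrite /B /inc; ring.
have := residue huv; have sf := rp_on rp s.
move=> /(_ _ sf); rewrite (Dv_at rp _ (s := s)) ?submx_refl // => h.
have := ordeq_ge C (ordeqM C sf ou ov) h.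
by rewrite /B /inc eqxx; clear; lia.
Qed.

Lemma defect_le A B : (forall s, A s <= B s) -> defect B <= defect A.
Proof.
move=> le; apply: (div_le_ind (Q := fun B => defect B <= defect A) le (lexx _)).
by move=> A' s _ _; apply: le_trans; apply: defect_inc.
Qed.

(** Such a function lies in L(0), so it is a constant, and it vanishes at a point of the support of
    [H]. *)
Lemma LL_negH v : LL (Hk (-1)) v -> v = 0.
Proof.
move=> hv; have [s Hs] : exists s, 0 < H s.
  apply: contrapT => h; have := Hdeg; rewrite big1 // => s _.
  by apply/eqP; rewrite eq_le H0 andbT leNgt; apply/negP => ?; apply: h; exists s.
have /LL_Hk[A hA] : LL (Hk 0%N%:Z) v.
  by apply: (LL_le C) hv => k; rewrite /Hk mul0r mulN1r oppr_le0.
rewrite expr0 mulr1 (dhomog0E hA) ev_const => ev_v; have sf := rp_on rp s.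
have := hv _ sf; rewrite (Dv_at rp _ (s := s)) ?submx_refl // /Hk mulN1r opprK => hs.
have [a0|na] := eqVneq (A@_0%MM) 0; first by rewrite ev_v a0 rmorph0.
case: (const_not_maximal (K := K) C sf na); rewrite -ev_v.
by apply: (ordge_le C) hs; rewrite -gtz0_ge1.
Qed.

Lemma ell_zero A : (forall v, LL A v -> v = 0) -> ell A = 0%N.
Proof.
move=> A0; apply: hasdim_uniq (ellP A) _; apply: hasdim_ext (hasdim0 c) => v.
by split=> [->|/A0 //]; case: (LL_subsp C K pt A).
Qed.

Lemma ell_W_top (k : nat) : (n < k)%N -> ell (fun s => W s - top k s) = 0%N.
Proof.
move=> ltnk; apply: ell_zero => v hv; apply: LL_negH; apply: (LL_le C) hv => s.
rewrite /W /top /Hk; have := H0 s; move: (H s) => h; move: ltnk; clear; nia.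
Qed.

Theorem riemann_roch A (k : nat) : (n < k)%N ->
    (forall s, W s - top k s <= A s) -> (forall s, A s <= top k s) ->
  (ell A)%:Z = deg A + 1 - 'C(n, 2)%:Z + (ell (fun s => W s - A s))%:Z.
Proof.
move=> ltnk geA leA; have w0 := ell_W_top ltnk; have e0 := excess_top ltnk.
have top0 : defect (top k) = 0 by rewrite /defect e0 w0.
(* The defect changes sign under [A -> W - A] because [deg W = 2 C(n, 2) - 2]; here [A] is
   [top k]. *)
have bot0 : defect (fun s => W s - top k s) = 0.
  have -> : defect (fun s => W s - top k s) = excess (fun s => W s - top k s) - (ell (top k))%:Z.
    rewrite /defect; congr (_ - (ell _)%:Z); apply/funext => s.
    by rewrite opprB addrC subrK.
  have -> : excess (fun s => W s - top k s) = - deg (fun s => W s - top k s) - 1 + 'C(n, 2)%:Z.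
    by rewrite /excess w0 add0r.
  have -> : (ell (top k))%:Z = deg (top k) + 1 - 'C(n, 2)%:Z.
    by move: e0; rewrite /excess; clear; lia.
  have -> : deg (fun s => W s - top k s) = deg W - deg (top k) by rewrite /deg sumrB.
  rewrite deg_Hk; have [_ e2] := bin2_lt; have n1 := sc_deg C.
  by move: e2 n1; case: (n) => [|[|m]] // e2 _; move: e2; move: 'C(_, 2) (deg _); clear; nia.
have le1 := defect_le geA; have le2 := defect_le leA.
rewrite top0 in le2; rewrite bot0 in le1.
by move: le1 le2; rewrite /defect /excess; clear; lia.
Qed.

Lemma excess_between A (k k' : nat) : (n < k)%N -> (n < k')%N ->
  (forall s, Hk k%:Z s <= A s) -> (forall s, A s <= top k' s) -> excess A = 0.
Proof.
move=> ltk ltk' /excess_le h1 /excess_le h2; apply/eqP; rewrite eq_le.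
by rewrite -{1}(excess_Hk ltk) h1 -(excess_top ltk') h2.
Qed.

(** Multiplication by a nonzero [v] embeds L(B) in L(A + B). Both dimensions are given by the degree
    formula with zero excess, so [deg A] cannot be negative. *)
Lemma LL_neg_degree A B v : excess B = 0 -> excess (fun s => A s + B s) = 0 ->
  deg A < 0 -> LL A v -> v = 0.
Proof.
move=> eB eAB degA hv; apply/eqP; apply: contraLR degA => nv; rewrite -leNgt.
have := ell_mul B nv hv; move: eB eAB; rewrite /excess.
have -> : deg (fun s => A s + B s) = deg A + deg B by rewrite /deg big_split.
by clear; lia.
Qed.

Lemma LL_local A v : LL A v <->
  (forall s, ordge (gpt s) (- A s) v) /\
  forall R, on_curve f R -> (forall s, ~~ (gpt s == R)%MS) -> ordge R 0 v.
Proof.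
split=> [hv|[hs ha] R Rf].
  split=> [s|R Rf away]; last by have := hv R Rf; rewrite Dv_away.
  by have := hv _ (rp_on rp s); rewrite (Dv_at rp _ (s := s)) ?submx_refl.
have [[s sR]|away] := Dv_cases pt R; last by rewrite Dv_away //; apply: ha.
have [a na eR] := same_pointP Rf sR; rewrite (Dv_at rp _ sR) eR.
exact/(ordge_scale C _ _ _ na).
Qed.

(* Residue theorem: a differential cannot have a simple pole as its only pole. *)
Lemma gap_product s u v A B p q : LL A u -> LL B v ->
    (forall k, A k + B k <= inc W s k) ->
    ordeq (gpt s) (- p) u -> ordeq (gpt s) (- q) v -> p + q = W s + 1 -> False.
Proof.
move=> hu hv le ou ov epq; have sf := rp_on rp s.
have huv : LL (inc W s) (u * v) by apply: (LL_le C le); apply: (LL_mul C hu hv).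
have [h _] := iffLR (LL_local _ _) (residue huv).
have := ordeq_ge C (ordeqM C sf ou ov) (h s).
by move: epq; move: (W s); clear; lia.
Qed.

(* [y] has a pole of some order [gam] between [al] and [be] at the point, and
   the product of [y] with the function of index [gam - al] in the family has a
   simple pole there as the only pole outside of the canonical divisor [W]. *)
Lemma gap_window s A (al : int) (L l0 : nat) (v y : K) :
    LL A y -> A s = al + L%:Z - 1 -> (l0 < L)%N ->
    ordge (gpt s) (al + A s - 1 - W s) v ->
    ordeq (gpt s) (al - 1 + l0%:Z - W s) (y * v) ->
    (forall l, (l < L)%N -> exists M B,
       [/\ ordeq (gpt s) (al - 1 + l%:Z - W s) M, LL B M,
           B s = W s - al + 1 - l%:Z & forall k, k != s -> A k + B k <= W k]) ->
  False.
Proof.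
move=> hy eA ltl0 hv oyv gap; have sf := rp_on rp s.
have [hys hya] := iffLR (LL_local _ _) hy.
(* A larger order of [y] would push the order of [y * v] above [al - 1 + (L - 1) - W s], which
   [l0 < L] forbids. *)
have ny : ~ ordge (gpt s) (- A s + L%:Z) y.
  move=> h; have := ordeq_ge C oyv (ordgeM C h hv).
  by rewrite eA; move: (W s) ltl0; clear; lia.
have [d ltd oy] := ordeq_between (hys s) ny.
(* Chosen so that the pole order [A s - d] of [y] equals [al + l]; the order of [M] then makes that
   of the product [- W s - 1]. *)
pose l := (L.-1 - d)%N; have ltl : (l < L)%N by rewrite /l; move: ltl0; clear; lia.
have [M [B [oM hB Bs AB]]] := gap l ltl.
pose A' k := if k == s then A s - d%:Z else A k.
have hy' : LL A' y.
  apply/(LL_local); split=> // k; rewrite /A'; case: eqVneq => [->|_]; last exact: hys.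
  by case: oy => h _; rewrite opprB addrC.
apply: (gap_product (s := s) (A := A') (B := B) (p := A s - d%:Z)
   (q := W s - (al - 1 + l%:Z)) hy' hB).
- move=> k; rewrite /A' /inc; case: eqVneq => [->|/AB]; last by rewrite addr0.
  by rewrite Bs eA /l; move: (W s) ltd; clear; lia.
- by rewrite opprB addrC.
- by rewrite opprB.
by rewrite eA /l; move: (W s) ltd; clear; lia.
Qed.

End RiemannRoch.

(** * Differentials and residues *)

Section Derivation.
Variables (F : finFieldType) (n : nat) (f : {mpoly F[3]}).
Hypothesis C : smooth_curve n f.
Variable K : function_field f.
Local Notation c := (ff_const K).
Local Notation ev := (@ev F f K).
Local Notation at_P P := (eval_at (to_Fbar F) P).
Implicit Types A B : {mpoly F[3]}.

(** The derivative of [A] along the vector field [(f_z, - f_y)], which kills [f] and therefore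
    descends to the curve. *)
Definition jac (y z : 'I_3) A : {mpoly F[3]} := A^`M(y) * f^`M(z) - A^`M(z) * f^`M(y).

Definition wr y z A B : K := ev (jac y z A) * ev B - ev A * ev (jac y z B).

Lemma jacD y z A B : jac y z (A + B) = jac y z A + jac y z B.
Proof. by rewrite /jac !mderivD; ring. Qed.

Lemma jacM y z A B : jac y z (A * B) = jac y z A * B + A * jac y z B.
Proof. by rewrite /jac !mderivM; ring. Qed.

Lemma jac_ev0 d y z A : A \is d.-homog -> ev A = 0 -> ev (jac y z A) = 0.
Proof.
move=> hA /(ev_eq0 C K hA)[B ->].
have -> : jac y z (f * B) = f * jac y z B by rewrite /jac !mderivM; ring.
by rewrite rmorphM /= (ev_f C) mul0r.
Qed.

(** The form [A B' - A' B] vanishes on the curve, hence so does its image under [jac] ([jac_ev0]);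
    this is what makes the quotient rule independent of the fraction. *)
Lemma wr_quotient d e y z A B A' B' :
    A \is d.-homog -> B \is d.-homog -> A' \is e.-homog -> B' \is e.-homog ->
    ev B != 0 -> ev B' != 0 -> ev A / ev B = ev A' / ev B' ->
  wr y z A B / ev B ^+ 2 = wr y z A' B' / ev B' ^+ 2.
Proof.
move=> hA hB hA' hB' nB nB' /eqP; rewrite eqr_div // => /eqP e0.
have hE : A * B' - A' * B \is (d + e).-homog.
  by apply: dhomogB; [apply: dhomogM|rewrite addnC; apply: dhomogM].
have : ev (jac y z (A * B' - A' * B)) = 0.
  by apply: jac_ev0 hE _; rewrite rmorphB !rmorphM /= e0 subrr.
have -> : jac y z (A * B' - A' * B) =
    (jac y z A * B' + A * jac y z B') - (jac y z A' * B + A' * jac y z B).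
  by rewrite -!jacM /jac !mderivB; ring.
rewrite rmorphB !rmorphD !rmorphM /= /wr.
move: (ev (jac _ _ _)) (ev (jac _ _ _)) (ev (jac _ _ _)) (ev (jac _ _ _)) => db da' db' da.
move: (ev A) (ev B) (ev A') (ev B') e0 nB nB' => a b a' b' e0 nB nB' e1.
apply/eqP; rewrite eqr_div ?expf_neq0 // -subr_eq0; apply/eqP.
transitivity (b * b' * (da * b' + a * db' - (da' * b + a' * db))
  + (a' * b - a * b') * (b' * db + b * db')).
  by ring.
by rewrite e1 e0 subrr mulr0 mul0r addr0.
Qed.

Lemma derivation_exists : exists D : K -> K, forall d A B,
  A \is d.-homog -> B \is d.-homog -> ev B != 0 ->
  D (ev A / ev B) = wr i1 i2 A B / ev B ^+ 2.
Proof.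
have /choice[D hD] : forall g : K, exists x, forall d A B,
    A \is d.-homog -> B \is d.-homog -> ev B != 0 -> g = ev A / ev B ->
    x = wr i1 i2 A B / ev B ^+ 2.
  move=> g; have [d [A [B [hA hB nB eg]]]] := ev_frac C g.
  exists (wr i1 i2 A B / ev B ^+ 2) => e A' B' hA' hB' nB' eg'.
  by apply: wr_quotient hA hB hA' hB' nB nB' _; rewrite -eg.
by exists D => d A B hA hB nB; apply: hD hA hB nB erefl.
Qed.

(* Up to sign, [D] takes the same form in the three charts, by Euler's
   identity; this is where the twist [n - 2] of the canonical sheaf comes from. *)
Lemma wr_chart x y z d A B : y != x -> z != x -> y != z ->
    A \is d.-homog -> B \is d.-homog ->
  exists2 s : K, s = 1 \/ s = -1 & wr i1 i2 A B = s * (wr y z A B / ev 'X_x).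
Proof.
move=> nyx nzx nyz hA hB.
have swap x' y' z' : y' != x' -> z' != x' -> y' != z' ->
    wr y' z' A B / ev 'X_x' = - (wr x' z' A B / ev 'X_y').
  move=> nyx' nzx' nyz'.
  have sum_ne (E : 'I_3 -> K) : \sum_k E k = E x' + (E y' + E z').
    rewrite (bigD1 x') //= (bigD1 y') //= (bigD1 z') /=; last by rewrite nzx' eq_sym.
    rewrite big1 ?addr0 // => k /andP[/andP[kx ky] kz].
    by case: (ord3_distinct nyx' nzx' nyz' kx ky kz).
  have euler e A' : A' \is e.-homog -> ev 'X_x' * ev A'^`M(x') +
      (ev 'X_y' * ev A'^`M(y') + ev 'X_z' * ev A'^`M(z')) = e%:R * ev A'.
    move=> /euler_identity/(congr1 ev); rewrite rmorph_sum rmorphM rmorph_nat /= => <-.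
    by rewrite sum_ne !rmorphM.
  have eA := euler _ _ hA; have eB := euler _ _ hB; have ef := euler _ _ (sc_homog C).
  rewrite (ev_f C) mulr0 in ef.
  have nx := evX_neq0 C K x'; have ny := evX_neq0 C K y'.
  apply/eqP; rewrite -mulNr eqr_div // -subr_eq0; apply/eqP.
  rewrite /wr /jac !rmorphB !rmorphM /=.
  move: (ev A^`M(x')) (ev A^`M(y')) (ev A^`M(z')) (ev A) eA => a1 a2 a3 a eA.
  move: (ev B^`M(x')) (ev B^`M(y')) (ev B^`M(z')) (ev B) eB => b1 b2 b3 b eB.
  move: (ev f^`M(x')) (ev f^`M(y')) (ev f^`M(z')) ef => f1 f2 f3 ef.
  move: (ev 'X_x') (ev 'X_y') (ev 'X_z') eA eB ef {nx ny} => X1 X2 X3 eA eB ef.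
  transitivity (f3 * ((X1 * a1 + (X2 * a2 + X3 * a3)) * b - a * (X1 * b1 + (X2 * b2 + X3 * b3)))
     - (a3 * b - a * b3) * (X1 * f1 + (X2 * f2 + X3 * f3))); first by ring.
  by rewrite eA eB ef; ring.
have anti y' z' : wr z' y' A B = - wr y' z' A B.
  by rewrite /wr /jac !rmorphB !rmorphM /=; ring.
have w0 : wr i1 i2 A B = wr i1 i2 A B / ev 'X_i0 by rewrite (evX0 C K) divr1.
have w1 := etrans w0 (swap i0 i1 i2 isT isT isT).
have w2 : wr i1 i2 A B = wr i0 i1 A B / ev 'X_i2.
  by rewrite w0 [wr i1 i2 A B]anti mulNr (swap i0 i2 i1) // opprK.
move: x y z nyx nzx nyz; elim/ord3P; elim/ord3P; elim/ord3P => // _ _ _.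
- by exists 1; rewrite ?mul1r; [left|].
- by exists (-1); [right|rewrite mulN1r [wr i2 i1 A B]anti mulNr opprK].
- by exists (-1); [right|rewrite mulN1r].
- by exists 1; [left|rewrite mul1r [wr i2 i0 A B]anti mulNr].
- by exists 1; [left|rewrite mul1r].
- by exists (-1); [right|rewrite mulN1r [wr i1 i0 A B]anti mulNr opprK].
Qed.

Variable D : K -> K.
Hypothesis DE : forall d A B, A \is d.-homog -> B \is d.-homog -> ev B != 0 ->
  D (ev A / ev B) = wr i1 i2 A B / ev B ^+ 2.

Lemma D_add g h : D (g + h) = D g + D h.
Proof.
have [d [A [B [hA hB nB ->]]]] := ev_frac C g.
have [e [A' [B' [hA' hB' nB' ->]]]] := ev_frac C h.
have nBB : ev (B * B') != 0 by rewrite rmorphM mulf_neq0.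
have -> : ev A / ev B + ev A' / ev B' = ev (A * B' + A' * B) / ev (B * B').
  by rewrite addf_div // rmorphD !rmorphM.
have hN : A * B' + A' * B \is (d + e).-homog.
  by apply: rpredD; [apply: dhomogM|rewrite addnC; apply: dhomogM].
rewrite (DE hN (dhomogM hB hB') nBB) (DE hA hB nB) (DE hA' hB' nB').
rewrite /wr jacD !jacM.
move: (jac _ _ A) (jac _ _ B) (jac _ _ A') (jac _ _ B') => a1 b1 a1' b1'.
rewrite !(rmorphD, rmorphM) /=.
by move: nB nB'; move: (ev B) (ev B') => b b' nB nB'; field; rewrite ?nB ?nB'.
Qed.

Lemma D_mul g h : D (g * h) = g * D h + h * D g.
Proof.
have [d [A [B [hA hB nB ->]]]] := ev_frac C g.
have [e [A' [B' [hA' hB' nB' ->]]]] := ev_frac C h.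
have nBB : ev (B * B') != 0 by rewrite rmorphM mulf_neq0.
have -> : ev A / ev B * (ev A' / ev B') = ev (A * A') / ev (B * B').
  by rewrite mulf_div !rmorphM.
rewrite (DE (dhomogM hA hA') (dhomogM hB hB') nBB) (DE hA hB nB) (DE hA' hB' nB').
rewrite /wr !jacM.
move: (jac _ _ A) (jac _ _ B) (jac _ _ A') (jac _ _ B') => a1 b1 a1' b1'.
rewrite !(rmorphD, rmorphM) /=.
by move: nB nB'; move: (ev B) (ev B') => b b' nB nB'; field; rewrite ?nB ?nB'.
Qed.

Lemma D_const a : D (c a) = 0.
Proof.
have h1 : (1 : {mpoly F[3]}) \is 0.-homog by apply: dhomog1.
have := @DE 0%N a%:MP 1; rewrite ev_const rmorph1 divr1 /wr => ->.
- have j0 (b : F) : jac i1 i2 b%:MP = 0 by rewrite /jac !mderivC !mul0r subrr.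
  by rewrite -mpolyC1 !j0 rmorph0 mul0r mulr0 subrr mul0r.
- by rewrite -[a%:MP]mulr1 mul_mpolyC; apply: rpredZ.
- exact: h1.
- exact: oner_neq0.
Qed.

Lemma D_generator : D (ev 'X_i1 / ev 'X_i0) = ev f^`M(i2).
Proof.
rewrite (DE (dhomogXU _ _) (dhomogXU _ _)) ?(evX_neq0 C) // (evX0 C K) expr1n divr1 /wr.
have -> : jac i1 i2 'X_i1 = f^`M(i2) by rewrite /jac !mderivXU /=; ring.
have -> : jac i1 i2 'X_i0 = 0 by rewrite /jac !mderivXU /=; ring.
by rewrite (evX0 C K) rmorph0 mulr0 subr0 mulr1.
Qed.

Lemma D_generator_neq0 : D (ev 'X_i1 / ev 'X_i0) != 0.
Proof.
rewrite D_generator; apply/eqP => /(ev_small C (dhomog_mderiv i2 (sc_homog C))).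
by rewrite leqnn => /(_ isT)/eqP; apply/negP; apply: sc_dz C.
Qed.

Section AtPoint.
Variable P : 'rV[Fbar F]_3.
Hypothesis Pf : on_curve f P.

(** In a chart at [P] the numerator has degree [2 d + n - 1] and the denominator [X_x B^2] has
    degree [2 d + 1], whence a section of degree [n - 2]. *)
Lemma D_regular g : local_ring P (g : K) -> exists a, vl P (n - 2) (D g) a.
Proof.
have n2 := sc_deg C.
move=> /(local_ringP C)[a [d [A [B [hA hB nB -> _]]]]]; rewrite addn0 in hA.
have nB' := at_ev_neq0 C K Pf hB nB; rewrite (DE hA hB nB').
have [x [y [z [yx zx yz Px _]]]] := smooth_chart C Pf.
have [s sE ->] := wr_chart yx zx yz hA hB.
have [d0|d0] := posnP d.
  have w0 : wr y z A B = 0.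
    rewrite /wr (dhomog0E (dhomog_cast hA d0)) (dhomog0E (dhomog_cast hB d0)).
    by rewrite /jac !mderivC !mul0r subrr !rmorph0 mul0r mulr0 subrr.
  by rewrite w0 mul0r mulr0 mul0r; exists 0; apply: vl0.
have hw : exists2 E, E \is (d.-1 + n + d).-homog & wr y z A B = ev E.
  exists (jac y z A * B - A * jac y z B); last by rewrite /wr -!rmorphM -rmorphB.
  have hj A' : A' \is d.-homog -> jac y z A' \is (d.-1 + n).-homog.
    move=> h; have hf' k := dhomog_mderiv k (sc_homog C); have h' k := dhomog_mderiv k h.
    by apply: dhomogB; [apply: dhomogM (h' y) (hf' z)|apply: dhomogM (h' z) (hf' y)].
  apply: dhomogB; first by apply: dhomogM => //; apply: hj.
  by rewrite addnC; apply: dhomogM => //; apply: hj.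
have [E hE ->] := hw.
have h1 : exists b, vl P (n - 2) (ev E / ev 'X_x / ev B ^+ 2) b.
  eexists; exists (1 + d * 2)%N, E, ('X_x * B ^+ 2); split.
  - by apply: dhomog_cast hE _; move: d0 n2; clear; lia.
  - by apply: dhomogM; [apply: dhomogXU|apply: dhomogMn].
  - by rewrite rmorphM rmorphXn /= evalX mulf_neq0 // expf_neq0.
  - by rewrite rmorphM rmorphXn /= -mulrA -invfM.
  - reflexivity.
have [b hb] := h1; case: sE => ->; first by exists b; rewrite mul1r.
by exists (- b); rewrite mulN1r mulNr; apply: vlN.
Qed.

Lemma D_jac x y z N T : P 0 x = 1 -> y != x -> z != x -> y != z ->
    T \is N.-homog -> at_P P T = 0 -> at_P P (jac y z T) != 0 ->
  exists2 b, b != 0 & vl P (n - 2) (D (ev T / ev 'X_x ^+ N)) b.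
Proof.
move=> Px yx zx yz hT T0 jT; have n2 := sc_deg C; have nx := evX_neq0 C K x.
have N0 : (0 < N)%N.
  rewrite lt0n; apply: contraNneq jT => N0.
  by rewrite (dhomog0E (dhomog_cast hT N0)) /jac !mderivC !mul0r subrr rmorph0.
have j0 : jac y z ('X_x ^+ N) = 0.
  rewrite /jac !mderiv_exp !mderivXU [x == y]eq_sym (negbTE yx) [x == z]eq_sym (negbTE zx) /=.
  by ring.
have [s sE eD] := wr_chart yx zx yz hT (dhomogXUn F x N).
have hj : jac y z T \is (N.-1 + n).-homog.
  have hf' k := dhomog_mderiv k (sc_homog C); have h' k := dhomog_mderiv k hT.
  by apply: dhomogB; [apply: dhomogM (h' y) (hf' z)|apply: dhomogM (h' z) (hf' y)].
have h1 : vl P (n - 2) (ev (jac y z T) / ev ('X_x ^+ N.+1)) (at_P P (jac y z T)).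
  exists N.+1, (jac y z T), ('X_x ^+ N.+1); split=> //.
  - by apply: dhomog_cast hj _; move: N0 n2; clear; lia.
  - exact: dhomogXUn.
  - by rewrite rmorphXn /= evalX Px expr1n oner_eq0.
  - by rewrite rmorphXn /= evalX Px expr1n divr1.
have := DE hT (dhomogXUn F x N); rewrite rmorphXn expf_neq0 // => /(_ isT) ->.
rewrite eD /wr j0 rmorph0 mulr0 subr0 rmorphXn /=.
have -> : s * (ev (jac y z T) * ev 'X_x ^+ N / ev 'X_x) / (ev 'X_x ^+ N) ^+ 2 =
    s * (ev (jac y z T) / ev ('X_x ^+ N.+1)).
  have nXN : ev 'X_x ^+ N != 0 by rewrite expf_neq0.
  rewrite rmorphXn /= [_ ^+ N.+1]exprS; move: (ev 'X_x ^+ N) nXN => XN nXN.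
  by move: (ev (jac _ _ _)) (ev 'X_x) nx => j X nX; field; rewrite ?nX ?nXN.
case: sE => ->; first by exists (at_P P (jac y z T)); rewrite ?mul1r.
by exists (- at_P P (jac y z T)); rewrite ?oppr_eq0 // mulN1r; apply: vlN.
Qed.

End AtPoint.

(** Compare with the jacobian uniformizer [t']: in [D t' = (t' / t) D t + t D (t' / t)] the last
    term vanishes at [P] and the left side does not, so neither does [D t]. *)
Lemma D_uniformizer P t : on_curve f P -> uniformizer P (t : K) ->
  exists2 b, b != 0 & vl P (n - 2) (D t) b.
Proof.
move=> Pf ut.
have [x [y [z [a [N [T [[na yx zx yz] Rx hT T0 jT]]]]]]] := exists_transversal C Pf.
have [b nb hb] := D_jac Rx yx zx yz hT T0 jT.
have Rf : on_curve f (a *: P) by apply: (on_curve_scale C).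
have ut' := jac_uniformizer C K Rf yx zx yz Rx hT T0 jT.
move: (ev T / _) ut' hb => t' ut' hb.
have {}ut : uniformizer (a *: P) t by apply/(uniformizer_scale C).
have [nt mt dt] := ut; have [_ /dt/(local_ringP C)[e he] _] := ut'.
have [d hd] := D_regular Rf (maximal_local C mt).
have [d' hd'] := D_regular Rf (iffRL (local_ringP C _ _) (ex_intro _ e he)).
have nd : d != 0.
  apply: contraNneq nb => d0; apply/eqP; apply: (vl_uniq C Rf hb).
  have -> : D t' = t' / t * D t + t * D (t' / t) by rewrite -D_mul divfK.
  have /(maximal_idealP C) h0 := mt.
  by have := vlD C Rf (vlM he hd) (vlM h0 hd'); rewrite d0 mulr0 mul0r addr0.
exists ((a^-1) ^+ (n - 2) * d); first by rewrite mulf_neq0 ?expf_neq0 ?invr_eq0.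
have na' : a^-1 != 0 by rewrite invr_eq0.
by have := vl_scale na' hd; rewrite scalerA mulVf // scale1r.
Qed.

Lemma D_order P t x : on_curve f P -> uniformizer P (t : K) -> P 0 x != 0 ->
  ordeq P 0 (D t / ev 'X_x ^+ (n - 2)).
Proof.
move=> Pf ut Px; have [b nb hb] := D_uniformizer Pf ut.
have nX : at_P P ('X_x ^+ (n - 2)) != 0 by rewrite rmorphXn /= evalX expf_neq0.
have := vl_divf (d := 0) (e := (n - 2)%N) hb (dhomogXUn F x (n - 2)) nX.
rewrite rmorphXn => h; apply: (ordeq_vl C Pf h).
by rewrite mulf_neq0 // invr_eq0.
Qed.

End Derivation.

(** * Differentials as a line over the function field *)

Section Kaehler.
Variables (F : finFieldType) (n : nat) (f : {mpoly F[3]}).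
Hypothesis C : smooth_curve n f.
Variable K : function_field f.
Local Notation c := (ff_const K).
Local Notation ev := (@ev F f K).
Local Notation Omega := (kaehler c).
Local Notation "'d t" := (kaehler_d c t) (at level 10).

Section Derivations.
Variables (M : lmodType K) (del : K -> M).
Hypotheses (delD : forall g h, del (g + h) = del g + del h)
  (delM : forall g h, del (g * h) = g *: del h + h *: del g)
  (delC : forall a, del (c a) = 0).

Lemma derivation_chain p : del (ev p) = \sum_k ev p^`M(k) *: del (ev 'X_k).
Proof.
elim/mpoly_ind_ring: p => [a|p q ep eq|k p ep].
- rewrite ev_const delC big1 // => k _; by rewrite mderivC rmorph0 scale0r.
- rewrite rmorphD delD ep eq -big_split; apply: eq_bigr => k _ /=.
  by rewrite mderivD rmorphD scalerDl.
- rewrite rmorphM delM ep scaler_sumr; transitivity (\sum_l (ev 'X_k * ev p^`M(l)) *: del (ev 'X_l)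
    + \sum_l (ev ('X_k^`M(l) * p)) *: del (ev 'X_l)).
    congr (_ + _); first by apply: eq_bigr => l _; rewrite scalerA.
    rewrite (bigD1 k) //= big1 ?addr0 => [|l nl].
      by rewrite mderivXU eqxx mul1r.
    by rewrite mderivXU eq_sym (negbTE nl) mul0r rmorph0 scale0r.
  rewrite -big_split; apply: eq_bigr => l _ /=.
  by rewrite -scalerDl mderivM !rmorphD !rmorphM /= addrC.
Qed.

(** With X = 1 and [del] zero on Y, the chain rule on [f = 0] leaves [f_Z] times [del] of Z, and
    [f_Z] is nonzero on the curve because its degree is only [n]. *)
Lemma derivation0 : del (ev 'X_i1) = 0 -> forall g, del g = 0.
Proof.
move=> d1; have del0 : del 0 = 0 by rewrite -(rmorph0 c) delC.
have d0 : del (ev 'X_i0) = 0 by rewrite (evX0 C) -(rmorph1 c) delC.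
have d2 : del (ev 'X_i2) = 0.
  have := derivation_chain f; rewrite (ev_f C) del0 sum3 d0 d1 !scaler0 !add0r.
  move=> /esym/eqP; rewrite scaler_eq0 => /orP[/eqP h|/eqP //].
  have := ev_small C (dhomog_mderiv i2 (sc_homog C)) (leqnn n) h.
  by move/eqP; rewrite (negbTE (sc_dz C)).
have dev p : del (ev p) = 0.
  by rewrite derivation_chain sum3 d0 d1 d2 !scaler0 !addr0.
move=> g; have [d [A [B [hA hB nB eg]]]] := ev_frac C g.
have := delM g (ev B); rewrite {1}eg divfK // !dev scaler0 add0r => /esym/eqP.
by rewrite scaler_eq0 (negbTE nB) => /eqP.
Qed.

End Derivations.

Variable D : K -> K.
Hypothesis DE : forall d A B, A \is d.-homog -> B \is d.-homog -> ev B != 0 ->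
  D (ev A / ev B) = wr K i1 i2 A B / ev B ^+ 2.

Definition fgD (w : {freeg K / K}) : K := fglift (D : K -> K^o) w.

Lemma fgDB w w' : fgD (w - w') = fgD w - fgD w'.
Proof. exact: (@freeg.lift_is_additive _ _ _ (D : K -> K^o) w w'). Qed.

Lemma fgD0 : fgD 0 = 0.
Proof. by rewrite -(subrr 0) fgDB subrr. Qed.

Lemma fgDD w w' : fgD (w + w') = fgD w + fgD w'.
Proof. by rewrite -{1}[w']opprK fgDB -[- w']sub0r fgDB fgD0 sub0r opprK. Qed.

Lemma fgDU a x : fgD << a *g x >> = a * D x.
Proof. exact: (@freeg.liftU _ _ _ (D : K -> K^o) a x). Qed.

Lemma freegZU (a b x : K) : a *: << b *g x >> = << a * b *g x >> :> {freeg K / K}.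
Proof.
by apply/eqP/freeg_eqP => y; rewrite coeffZ !coeffU mulrA.
Qed.

Lemma fgDZ a w : fgD (a *: w) = a * fgD w.
Proof.
elim/freeg_ind_dom0: w => [|k x w _ _ IHw]; first by rewrite scaler0 fgD0 mulr0.
by rewrite scalerDr !fgDD IHw freegZU !fgDU mulrDr mulrA.
Qed.

Lemma fgD_rel w : kaehler_rel c w -> fgD w = 0.
Proof.
elim=> [|a w1 w2 _ e1 _ e2|x y|x y|a].
- exact: fgD0.
- by rewrite fgDD fgDZ e1 e2 mulr0 addr0.
- by rewrite !fgDB !fgDU (D_add C DE); ring.
- by rewrite !fgDB !fgDZ !fgDU (D_mul C DE); ring.
- by rewrite fgDU (D_const DE) mulr0.
Qed.

(* The [K]-linear map induced by [D]; read as a section of O(n - 2), the function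
   [DO e] has the divisor of [e]. *)
Definition DO (e : Omega) : K := fgD (kaehler_repr e).

Lemma DO_mk w : DO (kaehler_mk c w) = fgD w.
Proof.
apply/eqP; rewrite -subr_eq0 -fgDB; apply/eqP/fgD_rel/kaehler_predP.
by apply/kaehler_mkP; rewrite kaehler_reprK.
Qed.

Lemma DO_scale a e : DO (a *: e) = a * DO e.
Proof. by rewrite -[e]kaehler_reprK [a *: _]kaehler_scale_mk !DO_mk fgDZ. Qed.

Lemma DO_d x : DO ('d x) = D x.
Proof. by rewrite /kaehler_d DO_mk fgDU mul1r. Qed.

(** With [s] = Y/X, the map [x |-> dx - (D x / D s) ds] is a derivation killing [s], hence zero. So
    [ds] spans the differentials, and [DO] determines them. *)
Lemma kaehler_generator e : e = (DO e / D (ev 'X_i1)) *: 'd (ev 'X_i1).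
Proof.
set s := ev 'X_i1.
have nDs : D s != 0 by have := D_generator_neq0 C DE; rewrite (evX0 C) divr1.
have mkD w w' : kaehler_mk c (w + w') = kaehler_mk c w + kaehler_mk c w' by apply: kaehler_mkD.
have mkZ a w : kaehler_mk c (a *: w) = a *: kaehler_mk c w by rewrite [RHS]kaehler_scale_mk.
have rel w w' : kaehler_rel c (w - w') -> kaehler_mk c w = kaehler_mk c w'.
  by move=> h; apply/kaehler_mkP/kaehler_predP.
pose del x : Omega := 'd x - (D x / D s) *: 'd s.
have del0 x : del x = 0.
  apply: derivation0 => [g h|g h|a|].
  - have eD : 'd (g + h) = 'd g + 'd h.
      rewrite /kaehler_d -mkD; apply: rel; rewrite opprD addrA.
      exact: kaehler_relD.
    by rewrite /del eD (D_add C DE) mulrDl scalerDl opprD addrACA.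
  - have eM : 'd (g * h) = g *: 'd h + h *: 'd g.
      rewrite /kaehler_d -!mkZ -mkD; apply: rel; rewrite opprD addrA.
      exact: kaehler_relM.
    by rewrite /del eM (D_mul C DE) mulrDl scalerDl opprD addrACA !scalerBr !scalerA !mulrA.
  - have eC : 'd (c a) = 0.
      have mk0 : kaehler_mk c 0 = 0 by rewrite -[X in kaehler_mk c X](scale0r 0) mkZ scale0r.
      by rewrite /kaehler_d -[RHS]mk0; apply: rel; rewrite subr0; apply: kaehler_relC.
    by rewrite /del eC (D_const DE) mul0r scale0r subrr.
  - by rewrite /del divff // scale1r subrr.
have d_gen x : 'd x = (D x / D s) *: 'd s by apply/eqP; rewrite -subr_eq0 -/(del x) del0.
rewrite -[e in LHS]kaehler_reprK /DO; move: (kaehler_repr e) => w.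
elim/freeg_ind_dom0: w => [|k x w _ _ IHw].
  by rewrite fgD0 mul0r scale0r -[X in kaehler_mk c X](scale0r 0) mkZ scale0r.
rewrite mkD IHw fgDD mulrDl scalerDl; congr (_ + _).
rewrite -[k]mulr1 -freegZU mkZ fgDZ fgDU mul1r -mulrA -scalerA; congr (_ *: _).
exact: d_gen.
Qed.

Lemma DO_inj e e' : DO e = DO e' -> e = e'.
Proof. by move=> h; rewrite [e]kaehler_generator h -kaehler_generator. Qed.

Lemma kaehler_unif e t : D t != 0 -> e = (DO e / D t) *: 'd t.
Proof. by move=> nt; apply: DO_inj; rewrite DO_scale DO_d divfK. Qed.

Lemma diff_orderP P x e k : on_curve f P -> P 0 x != 0 ->
  has_diff_order P e k <-> ordeq P k (DO e / ev 'X_x ^+ (n - 2)).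
Proof.
move=> Pf Px; have nx := evX_neq0 C K x; split=> [[t [g [ut -> /(has_orderP C Pf) og]]]|o].
  rewrite DO_scale DO_d -[k]addr0 -mulrA.
  exact: (ordeqM C Pf og (D_order C DE Pf ut Px)).
have [t ut] := exists_unif C K Pf; have ot := D_order C DE Pf ut Px.
have nt : D t != 0 by have := ordeq_neq0 C Pf ot; rewrite mulf_eq0 negb_or => /andP[].
exists t, (DO e / D t); split=> //; first exact: kaehler_unif.
apply/(has_orderP C Pf); have := ordeq_div C Pf o ot; rewrite subr0; congr ordeq.
by field; rewrite nt expf_neq0.
Qed.

Lemma differentials_geP (E : divisor F) e : differentials_ge E e <->
  forall P x, on_curve f P -> P 0 x != 0 -> ordge P (E P) (DO e / ev 'X_x ^+ (n - 2)).
Proof.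
split=> [[-> P x Pf Px|h P x Pf Px]|h].
- have -> : DO 0 = 0 by have := DO_scale 0 0; rewrite scaler0 mul0r.
  by rewrite mul0r; apply: (ordge0 C).
- have [k /(diff_orderP _ _ Pf Px)[hk _] le] := h P Pf.
  exact: (ordge_le C le hk).
have [e0|ne] := eqVneq (DO e) 0.
  by left; apply: DO_inj; rewrite e0; have := DO_scale 0 0; rewrite scaler0 mul0r => ->.
right=> P Pf; have [x [_ [_ [_ _ _ Px _]]]] := smooth_chart C Pf.
have [|k ok] := ordeq_exists C Pf (g := DO e / ev 'X_x ^+ (n - 2)).
  by rewrite mulf_neq0 // invr_eq0 expf_neq0 ?(evX_neq0 C).
exists k; first exact/(diff_orderP _ _ Pf Px).
exact: (ordeq_ge C ok (h P x Pf Px)).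
Qed.

End Kaehler.

(** * Residues at simple poles *)

Section Residues.
Variables (F : finFieldType) (n : nat) (f : {mpoly F[3]}).
Hypothesis C : smooth_curve n f.
Variable K : function_field f.
Local Notation c := (ff_const K).
Local Notation ev := (@ev F f K).
Variable D : K -> K.
Hypothesis DE : forall d A B, A \is d.-homog -> B \is d.-homog -> ev B != 0 ->
  D (ev A / ev B) = wr K i1 i2 A B / ev B ^+ 2.
Local Notation DO := (DO D).

Section AtPoint.
Variable P : 'rV[Fbar F]_3.
Hypothesis Pf : on_curve f P.

Lemma D_unif_neq0 t : uniformizer P (t : K) -> D t != 0.
Proof.
move=> ut; have [x [_ [_ [_ _ _ Px _]]]] := smooth_chart C Pf.
by have := ordeq_neq0 C Pf (D_order C DE Pf ut Px); rewrite mulf_eq0 negb_or => /andP[].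
Qed.

(** Since [g] has at most a simple pole, its principal part reduces to a constant and the [t^-1]
    term: were the degree of [p] at least 2, multiplying by the top power of [t] would give its
    nonzero leading coefficient a positive order. *)
Lemma principal_part (g t : K) (p : {poly F}) : uniformizer P t -> ordge P (-1) g ->
    local_ring P (g - (map_poly c p).[t^-1]) ->
  vl P 0 (g * t) (to_Fbar F p`_1).
Proof.
move=> ut hg hp; have nt : t != 0 by case: ut.
have h1 : ordge P 1 t by case: (ordeq_unif C Pf ut).
have pE : (map_poly c p).[t^-1] = \sum_(i < size p) c p`_i * t ^- i.
  rewrite horner_coef size_map_poly; apply: eq_bigr => i _.
  by rewrite coef_map exprVn.
have hpt : ordge P (-1) (map_poly c p).[t^-1].
  rewrite -[X in ordge _ _ X](subKr g); apply: (ordgeB C Pf) => //.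
  by apply: (ordge_le C (l := 0)) => //; apply/(ordge_local C Pf).
have sz : (size p <= 2)%N.
  rewrite leqNgt; apply/negP => lt; have [N eN] : exists N, size p = N.+3.
    by exists (size p - 3)%N; move: lt; clear; lia.
  have lc : p`_N.+2 != 0.
    have : p != 0 by rewrite -size_poly_eq0 eN.
    by rewrite -lead_coef_eq0 /lead_coef eN.
  apply: (const_not_maximal (K := K) C Pf lc).
  have hX k : ordge P k%:Z (t ^+ k).
    elim: k => [|k IHk]; first by rewrite expr0; case: (ordeq1 C K Pf).
    by rewrite exprS intS; apply: (ordgeM C).
  have := ordgeM C (hX N.+2) hpt; rewrite pE eN big_ord_recr /= mulrDr => h2.
  have e : c p`_N.+2 = t ^+ N.+2 * (\sum_(i < N.+2) c p`_i * t ^- i) +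
      t ^+ N.+2 * (c p`_N.+2 * t ^- N.+2) - t ^+ N.+2 * (\sum_(i < N.+2) c p`_i * t ^- i).
    by rewrite addrAC subrr add0r mulrCA divff ?mulr1 // expf_neq0.
  rewrite e; apply: (ordgeB C Pf); first by apply: (ordge_le C) h2; clear; lia.
  rewrite mulr_sumr; apply: (ordge_sum C Pf) => i _.
  have -> : t ^+ N.+2 * (c p`_i * t ^- i) = c p`_i * (t ^+ (N.+2 - i)).
    by rewrite mulrCA -expfB ?ltn_ord.
  apply: (ordgeZ C Pf); apply: (ordge_le C) (hX _); have := ltn_ord i; clear; lia.
have {}pE : (map_poly c p).[t^-1] = c p`_0 + c p`_1 * t^-1.
  rewrite (horner_coef_wide (n := 2)) ?size_map_poly // !big_ord_recr big_ord0 /=.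
  by rewrite add0r !coef_map expr0 mulr1 expr1.
have : ordge P 1 (g * t - c p`_1).
  have -> : g * t - c p`_1 = t * (g - (map_poly c p).[t^-1]) + c p`_0 * t.
    by rewrite pE; field.
  apply: (ordgeD C Pf); last exact: (ordgeZ C Pf).
  by rewrite -[X in ordge P X _]addr0; apply: (ordgeM C h1); apply/(ordge_local C Pf).
move=> /(maximal_ordge C Pf)/(maximal_idealP C) h.
have := vlD C Pf h (vl_const K P p`_1); by rewrite subrK add0r.
Qed.

(** This is why the residue at a simple pole does not depend on the uniformizer. *)
Lemma log_derivative_ratio t t' : uniformizer P (t : K) -> uniformizer P (t' : K) ->
  vl P 0 (t * D t' / (t' * D t)) 1.
Proof.
move=> ut ut'; have [nt mt dt] := ut; have [nt' mt' dt'] := ut'.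
have nD := D_unif_neq0 ut; have nD' := D_unif_neq0 ut'.
have [x [_ [_ [_ _ _ Px _]]]] := smooth_chart C Pf; have nx := evX_neq0 C K x.
pose u := t / t'; have hu : local_ring P u by apply: dt'.
have nu : u != 0 by rewrite mulf_neq0 ?invr_eq0.
suff h : vl P 0 (t' * D t / (t * D t')) 1.
  by have := vlV h (oner_neq0 _); rewrite invf_div invr1.
(* From [t = u t'] and the product rule; the first summand on the right has a factor [t'] and is
   otherwise regular, so it vanishes at [P]. *)
have -> : t' * D t / (t * D t') = t' * (t' / t) * (D u / D t') + 1.
  have -> : D t = u * D t' + t' * D u by rewrite -(D_mul C DE) divfK.
  rewrite /u; by field; rewrite nt nD'.
rewrite -[X in vl _ _ _ X]add0r; apply: (vlD C Pf); last exact: vl1.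
apply/(maximal_idealP C)/(maximal_ordge C Pf).
rewrite -[1]addr0; apply: (ordgeM C).
  rewrite -[1]addr0; apply: (ordgeM C); first by case: (ordeq_unif C Pf ut').
  by apply/(ordge_local C Pf)/dt.
have [a /(ex_intro (fun a => vl P (n - 2) (D u) a)) hDu] := D_regular C DE Pf hu.
have /(reg_chart C Pf _ _ Px) h1 := hDu.
have h2 := ordeqV C Pf (D_order C DE Pf ut' Px).
have := ordgeM C h1 h2; rewrite oppr0 addr0; congr ordge.
by field; rewrite nD' expf_neq0.
Qed.

End AtPoint.

(** [res h] is the value of [(h / D t) t] at the point for one fixed uniformizer [t]; it lies in [F]
    because the point is rational, and [log_derivative_ratio] reconciles it with the uniformizer
    chosen inside [has_residue]. *)
Lemma residue_functional (P : 'rV[F]_3) x (Q := geom_point P) :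
    on_curve f Q -> Q 0 x != 0 ->
  exists res : K -> F, [/\
    forall a g h, ordge Q (-1) (g / ev 'X_x ^+ (n - 2)) ->
      ordge Q (-1) (h / ev 'X_x ^+ (n - 2)) -> res (c a * g + h) = a * res g + res h,
    forall eta a, ordge Q (-1) (DO eta / ev 'X_x ^+ (n - 2)) ->
      has_residue P eta a <-> a = res (DO eta)
    & forall h, ordge Q (-1) (h / ev 'X_x ^+ (n - 2)) ->
      res h = 0 <-> ordge Q 0 (h / ev 'X_x ^+ (n - 2))].
Proof.
move=> Qf Qx; have [t ut] := exists_unif C K Qf; have nD := D_unif_neq0 Qf ut.
have nt : t != 0 by case: ut.
have ot := D_order C DE Qf ut Qx; have nx := evX_neq0 C K x.
have h1 : ordge Q 1 t by case: (ordeq_unif C Qf ut).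
have polar k (h : K) : ordge Q k (h / ev 'X_x ^+ (n - 2)) <-> ordge Q k (h / D t).
  split=> hh.
    have := ordgeM C hh (ordeqV C Qf ot); rewrite oppr0 addr0; congr ordge.
    by field; rewrite nD expf_neq0.
  have := ordgeM C hh (proj1 ot); rewrite addr0; congr ordge.
  by field; rewrite nD expf_neq0.
have /choice[res hres] : forall h : K, exists a : F, ordge Q (-1) (h / ev 'X_x ^+ (n - 2)) ->
    vl Q 0 (h / D t * t) (to_Fbar F a).
  move=> h; have [hh|nh] := pselect (ordge Q (-1) (h / ev 'X_x ^+ (n - 2))); last by exists 0.
  have /polar h2 := hh; have := ordgeM C h2 h1; rewrite addNr.
  by move=> /(ordge_local C Qf)/(local_ringP C)[a va]; have [b eb] := vl_rational va; exists b; rewrite -eb.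
exists res; split=> [a g h hg hh|eta a he|h hh].
- apply: (fmorph_inj (to_Fbar F)); rewrite rmorphD rmorphM /=.
  have hgh : ordge Q (-1) ((c a * g + h) / ev 'X_x ^+ (n - 2)).
    by rewrite mulrDl -mulrA; apply: (ordgeD C Qf) => //; apply: (ordgeZ C Qf).
  apply: (vl_uniq C Qf (hres _ hgh)); rewrite !mulrDl -!mulrA.
  by apply: (vlD C Qf); [apply: (vlM (vl_const K _ a)); rewrite mulrA|rewrite mulrA]; apply: hres.
- split=> [[t' [g [p [ut' eeta hp ->]]]]|->].
    apply: (fmorph_inj (to_Fbar F)).
    have nD' := D_unif_neq0 Qf ut'; have nt' : t' != 0 by case: ut'.
    have eg : g = DO eta / D t' by rewrite eeta (DO_scale C DE) (DO_d C DE) mulfK.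
    have hg : ordge Q (-1) g.
      rewrite eg; have := ordgeM C he (ordeqV C Qf (D_order C DE Qf ut' Qx)).
      by rewrite oppr0 addr0; congr ordge; field; rewrite nD' expf_neq0.
    apply: (vl_uniq C Qf (principal_part Qf ut' hg hp)).
    have := vlM (hres _ he) (log_derivative_ratio Qf ut' ut); rewrite mulr1; congr vl.
    by rewrite eg; field; rewrite nD nD' nt.
  exists t, (DO eta / D t), (res (DO eta) *: 'X); split=> //.
  + exact: (kaehler_unif C DE).
  + have := vlB C Qf (hres _ he) (vl_const K Q (res (DO eta))); rewrite subrr.
    move=> /(maximal_idealP C)/(maximal_ordge C Qf)/(ordgeE C _ _ ut); rewrite expr1z.
    congr local_ring; rewrite map_polyZ map_polyX hornerZ hornerX.
    by field; rewrite nt.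
  + by rewrite coefZ coefX mulr1.
- split=> [r0|/polar h2].
    apply/polar; have := hres _ hh; rewrite r0 rmorph0.
    move=> /(maximal_idealP C)/(maximal_ordge C Qf)/(ordgeE C _ _ ut); rewrite expr1z mulfK //.
    by move/(ordge_local C Qf).
  apply/eqP; rewrite -(fmorph_eq0 (to_Fbar F)); apply/eqP/(vl_uniq C Qf (hres _ hh)).
  apply/(maximal_idealP C)/(maximal_ordge C Qf).
  by rewrite -[1]add0r; apply: (ordgeM C).
Qed.

End Residues.

(** * The curve and its code *)

Section HurwitzCurve.
Variables (F : finFieldType) (n : nat) (G : {mpoly F[3]}).
Hypotheses (n3 : (3 <= n)%N) (hG : G \is (n - 2).-homog).
Local Notation f := (curve_poly n G).
Hypothesis ns : nonsingular f.
Local Notation at_P P := (eval_at (to_Fbar F) P).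
Local Notation pt1 := (geom_point (@P1 F)).
Local Notation pt2 := (geom_point (@P2 F)).

Lemma curve_polyE k (A : {mpoly F[3]}) : curve_poly k A =
  'X_i0 * 'X_i1 ^+ k + 'X_i1 * 'X_i2 ^+ k + 'X_i2 * 'X_i0 ^+ k + 'X_i0 * 'X_i1 * 'X_i2 * A.
Proof. by []. Qed.

Lemma geom_P1 k : pt1 0 k = (k == i0)%:R.
Proof. by rewrite !mxE eqxx rmorph_nat. Qed.

Lemma geom_P2 k : pt2 0 k = (k == i1)%:R.
Proof. by rewrite !mxE eqxx rmorph_nat. Qed.

Lemma curve_homog : f \is n.+1.-homog.
Proof.
have h k l : ('X_k * 'X_l ^+ n : {mpoly F[3]}) \is n.+1.-homog.
  by rewrite -[n.+1]add1n; apply: dhomogM (dhomogXU _ _) (dhomogXUn _ _ _).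
rewrite curve_polyE; apply: rpredD; first by apply: rpredD; [apply: rpredD; apply: h|apply: h].
apply: dhomog_cast (dhomogM (dhomogM (dhomogM (dhomogXU _ _) (dhomogXU _ _)) (dhomogXU _ _)) hG) _.
by move: n3; clear; lia.
Qed.

Lemma curve_P1 : on_curve f pt1.
Proof.
split; first by apply/eqP => /rowP/(_ i0)/eqP; rewrite geom_P1 mxE oner_eq0.
have [k ->] : exists k, n = k.+1 by exists n.-1; rewrite prednK // (leq_trans _ n3).
rewrite /= curve_polyE !(rmorphD, rmorphM, rmorphXn) /= !evalX !geom_P1 /= !exprS.
by rewrite !(mul0r, mulr0, addr0).
Qed.

Lemma curve_P2 : on_curve f pt2.
Proof.
split; first by apply/eqP => /rowP/(_ i1)/eqP; rewrite geom_P2 mxE oner_eq0.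
have [k ->] : exists k, n = k.+1 by exists n.-1; rewrite prednK // (leq_trans _ n3).
rewrite /= curve_polyE !(rmorphD, rmorphM, rmorphXn) /= !evalX !geom_P2 /= !exprS.
by rewrite !(mul0r, mulr0, addr0).
Qed.

Lemma mderiv_P1 : at_P pt1 f^`M(i2) = 1.
Proof.
have -> : f^`M(i2) = 'X_i0 ^+ n + 'X_i1 * (n%:R * 'X_i2 ^+ n.-1 + 'X_i0 * (G + 'X_i2 * G^`M(i2))).
  by rewrite curve_polyE !mderivD !mderivM !mderiv_exp !mderivXU /=; ring.
move: (n%:R * _ + _) => B; rewrite rmorphD rmorphM rmorphXn /= !evalX !geom_P1 /=.
by rewrite expr1n mul0r addr0.
Qed.

Lemma mderiv_P2 : at_P pt2 f^`M(i0) = 1.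
Proof.
have -> : f^`M(i0) = 'X_i1 ^+ n + 'X_i2 * (n%:R * 'X_i0 ^+ n.-1 + 'X_i1 * (G + 'X_i0 * G^`M(i0))).
  by rewrite curve_polyE !mderivD !mderivM !mderiv_exp !mderivXU /=; ring.
move: (n%:R * _ + _) => B; rewrite rmorphD rmorphM rmorphXn /= !evalX !geom_P2 /=.
by rewrite expr1n mul0r addr0.
Qed.

Lemma curve_smooth : smooth_curve n f.
Proof.
split=> //; [exact: ltnW|exact: curve_homog|].
apply/eqP => f0; have := mderiv_P1; rewrite f0 rmorph0 => /eqP.
by rewrite eq_sym oner_eq0.
Qed.
Local Notation C := curve_smooth.

Variable K : function_field f.
Local Notation ev := (@ev F f K).
Local Notation x := (ev 'X_i0).
Local Notation y := (ev 'X_i1).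
Local Notation z := (ev 'X_i2).

(** The factor multiplying Z is nonzero at [P1], so Z vanishes there to the same order as
    [X Y^n]. *)
Lemma curve_relation : z * (x ^+ n + y * z ^+ n.-1 + x * y * ev G) = - (x * y ^+ n).
Proof.
have := congr1 ev (curve_polyE n G); rewrite [LHS](ev_f C K).
rewrite !rmorphD !rmorphM !rmorphXn /= => /esym e.
have ez : z ^+ n = z * z ^+ n.-1 by rewrite -exprS prednK // (leq_trans _ n3).
apply/eqP; rewrite -addr_eq0 -e ez; apply/eqP; ring.
Qed.

Lemma unif_P1 : uniformizer pt1 (y / x).
Proof.
have := @jac_uniformizer _ _ _ C K pt1 curve_P1 i0 i1 i2 isT isT isT _ 1 'X_i1.
rewrite expr1; apply.
- by rewrite geom_P1.
- exact: dhomogXU.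
- by rewrite evalX geom_P1.
- have -> : 'X_i1^`M(i1) * f^`M(i2) - 'X_i1^`M(i2) * f^`M(i1) = f^`M(i2).
    by rewrite !mderivXU /= mul1r mul0r subr0.
  by rewrite mderiv_P1 oner_eq0.
Qed.

Lemma unif_P2 : uniformizer pt2 (z / y).
Proof.
have := @jac_uniformizer _ _ _ C K pt2 curve_P2 i1 i2 i0 isT isT isT _ 1 'X_i2.
rewrite expr1; apply.
- by rewrite geom_P2.
- exact: dhomogXU.
- by rewrite evalX geom_P2.
- have -> : 'X_i2^`M(i2) * f^`M(i0) - 'X_i2^`M(i0) * f^`M(i2) = f^`M(i0).
    by rewrite !mderivXU /= mul1r mul0r subr0.
  by rewrite mderiv_P2 oner_eq0.
Qed.

Let nx : x != 0. Proof. exact: evX_neq0 C K i0. Qed.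
Let ny : y != 0. Proof. exact: evX_neq0 C K i1. Qed.
Let nz : z != 0. Proof. exact: evX_neq0 C K i2. Qed.

Lemma unit_order P E B : on_curve f P -> E \is n.-homog -> B \is n.-homog ->
  at_P P E = -1 -> at_P P B = 1 -> ordeq P 0 (ev E / ev B).
Proof.
move=> Pf hE hB E1 B1; apply: (ordeq_vl C Pf (a := -1)); last by rewrite oppr_eq0 oner_eq0.
exists n, E, B; rewrite addn0 E1 B1 oner_eq0 divr1; split=> //.
Qed.

Lemma order_Z_P1 : ordeq pt1 n%:Z (z / x).
Proof.
pose E := - ('X_i0 ^+ n + 'X_i1 * 'X_i2 ^+ n.-1 + 'X_i0 * 'X_i1 * G) : {mpoly F[3]}.
have hE : E \is n.-homog.
  rewrite dhomogN; apply: rpredD; first apply: rpredD; first exact: dhomogXUn.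
    by apply: dhomog_cast (dhomogM (dhomogXU _ _) (dhomogXUn _ _ _)) _; move: n3; clear; lia.
  apply: dhomog_cast (dhomogM (dhomogM (dhomogXU _ _) (dhomogXU _ _)) hG) _.
  by move: n3; clear; lia.
have oE : ordeq pt1 0 (ev E / ev ('X_i0 ^+ n)).
  apply: unit_order => //; [exact: curve_P1|exact: dhomogXUn| |].
    rewrite rmorphN !rmorphD !rmorphM !rmorphXn /= !evalX !geom_P1 /=.
    by rewrite expr1n mul0r mulr0 mul0r !addr0.
  by rewrite rmorphXn /= evalX geom_P1 /= expr1n.
have := ordeq_div C curve_P1 (ordeqX C curve_P1 n (ordeq_unif C curve_P1 unif_P1)) oE.
rewrite mul1r subr0; congr ordeq.
have nE : ev E != 0.
  by have := ordeq_neq0 C curve_P1 oE; rewrite mulf_eq0 negb_or => /andP[].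
rewrite expr_div_n rmorphXn /= invf_div mulf_div -[x ^+ n * _]mulrC -mulf_div divff ?expf_neq0 // mulr1.
apply/eqP; rewrite eqr_div // mulrC; apply/eqP.
have := curve_relation; rewrite /E rmorphN !rmorphD !rmorphM !rmorphXn /= mulrN => ->.
by rewrite opprK.
Qed.

(** The equation is read as [X (Y^n + Z X^(n-1) + Y Z G) = - Y Z^n], where the bracket is nonzero at
    [P2] and Z/Y is a uniformizer. *)
Lemma order_X_P2 : ordeq pt2 n%:Z (x / y).
Proof.
pose E := - ('X_i1 ^+ n + 'X_i2 * 'X_i0 ^+ n.-1 + 'X_i1 * 'X_i2 * G) : {mpoly F[3]}.
have hE : E \is n.-homog.
  rewrite dhomogN; apply: rpredD; first apply: rpredD; first exact: dhomogXUn.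
    by apply: dhomog_cast (dhomogM (dhomogXU _ _) (dhomogXUn _ _ _)) _; move: n3; clear; lia.
  apply: dhomog_cast (dhomogM (dhomogM (dhomogXU _ _) (dhomogXU _ _)) hG) _.
  by move: n3; clear; lia.
have oE : ordeq pt2 0 (ev E / ev ('X_i1 ^+ n)).
  apply: unit_order => //; [exact: curve_P2|exact: dhomogXUn| |].
    rewrite rmorphN !rmorphD !rmorphM !rmorphXn /= !evalX !geom_P2 /=.
    by rewrite expr1n mul0r mulr0 mul0r !addr0.
  by rewrite rmorphXn /= evalX geom_P2 /= expr1n.
have := ordeq_div C curve_P2 (ordeqX C curve_P2 n (ordeq_unif C curve_P2 unif_P2)) oE.
rewrite mul1r subr0; congr ordeq.
have nE : ev E != 0.
  by have := ordeq_neq0 C curve_P2 oE; rewrite mulf_eq0 negb_or => /andP[].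
rewrite expr_div_n rmorphXn /= invf_div mulf_div -[y ^+ n * _]mulrC -mulf_div divff ?expf_neq0 // mulr1.
apply/eqP; rewrite eqr_div // mulrC; apply/eqP.
have ex : x ^+ n = x * x ^+ n.-1 by rewrite -exprS prednK // (leq_trans _ n3).
have := curve_relation; rewrite /E rmorphN !rmorphD !rmorphM !rmorphXn /= mulrN => e.
apply/eqP; rewrite -subr_eq0 opprK; apply/eqP.
have {}e := congr1 (fun w => w + x * y ^+ n) e; rewrite addNr /= in e.
have e2 : z ^+ n = z * z ^+ n.-1 by rewrite -exprS prednK // (leq_trans _ n3).
rewrite e2 -e ex; ring.
Qed.

End HurwitzCurve.

(** * The code: residue description, dimension and distance *)

Section GoppaCode.
Variables (F : finFieldType) (n : nat) (G : {mpoly F[3]}).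
Hypotheses (n3 : (3 <= n)%N) (hG : G \is (n - 2).-homog).
Local Notation f := (curve_poly n G).
Hypothesis ns : nonsingular f.
Local Notation C := (curve_smooth n3 hG ns).
Variable K : function_field f.
Local Notation c := (ff_const K).
Local Notation ev := (@ev F f K).
Variables (m : nat) (Q : 'I_m -> 'rV[F]_3).
Hypotheses (Qf : forall k, on_curve f (geom_point (Q k)))
  (Qne : forall k l, k != l -> ~~ (Q k == Q l)%MS)
  (QP : forall k, ~~ (Q k == P1)%MS /\ ~~ (Q k == P2)%MS).

Definition pts (s : bool + 'I_m) : 'rV[F]_3 :=
  match s with inl true => P1 | inl false => P2 | inr k => Q k end.

Definition mkdiv (a b : int) (e : 'I_m -> int) (s : bool + 'I_m) : int :=
  match s with inl true => a | inl false => b | inr k => e k end.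

(** On [Z = 0] the equation becomes [X Y^n = 0]: the line meets the curve [n] times at [P1] and once
    at [P2]. *)
Definition divZ : bool + 'I_m -> int := mkdiv n%:Z 1 (fun=> 0).

Lemma sum_mkdiv (V : nmodType) (E : bool + 'I_m -> V) :
  \sum_s E s = E (inl true) + E (inl false) + \sum_k E (inr k).
Proof. by rewrite big_sumType big_bool. Qed.

Lemma deg_mkdiv a b e : deg (mkdiv a b e) = a + b + \sum_k e k.
Proof. exact: sum_mkdiv. Qed.

Lemma P1_neq_P2 : ~~ (@P1 F == P2)%MS.
Proof.
apply/negP => /andP[/sub_rVP[a /rowP/(_ i0)/eqP]].
by rewrite !mxE /= mulr0 oner_eq0.
Qed.

Lemma pts_rational : rational_points f pts.
Proof.
split=> [[[]|k]|s s' nss']; [exact: curve_P1|exact: curve_P2|exact: Qf|].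
have P12 := P1_neq_P2; have P21 : ~~ (@P2 F == P1)%MS by rewrite andbC.
case: s s' nss' => [[]|k] [[]|l] //= nkl; try by [case: (QP k)|rewrite andbC; case: (QP l)].
by apply: Qne; apply: contra nkl => /eqP->.
Qed.
Local Notation rp := pts_rational.
Local Notation LL := (@LL F f K _ pts).

Lemma divZ_ge0 s : 0 <= divZ s.
Proof. by case: s => [[]|k]. Qed.

Lemma deg_divZ : \sum_s divZ s = n.+1%:Z.
Proof. by rewrite sum_mkdiv /= big1 // addr0 -PoszD addn1. Qed.

Lemma same_point_at P R : on_curve f R -> (geom_point P == R)%MS ->
  forall x, (R 0 x == 0) = (geom_point P 0 x == 0).
Proof.
move=> Rf /(same_pointP Rf)[a na ->] x.
by rewrite [in LHS]mxE mulf_eq0 (negbTE na).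
Qed.

Lemma divZ_order R x : on_curve f R -> R 0 x != 0 ->
  ordeq R (Dv pts divZ R) (ev 'X_i2 / ev 'X_x).
Proof.
move=> Rf Rx; have nx := evX_neq0 C K x.
have [R1|nR1] := boolP (geom_point (@P1 F) == R)%MS.
  rewrite (Dv_at rp _ (s := inl true)) //=; have [a na eR] := same_pointP Rf R1.
  have -> : x = i0.
    move: Rx; rewrite (same_point_at Rf R1) geom_P1.
    by case: (x =P _) => // _; rewrite eqxx.
  by rewrite eR; apply: (ordeq_scale C na); apply: order_Z_P1.
have [R2|nR2] := boolP (geom_point (@P2 F) == R)%MS.
  rewrite (Dv_at rp _ (s := inl false)) //=; have [a na eR] := same_pointP Rf R2.
  have -> : x = i1.
    move: Rx; rewrite (same_point_at Rf R2) geom_P2.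
    by case: (x =P _) => // _; rewrite eqxx.
  rewrite eR; apply: (ordeq_scale C na); apply: (ordeq_unif C) (unif_P2 n3 hG ns K).
  exact: curve_P2.
have -> : Dv pts divZ R = 0.
  have [[s sR]|away] := Dv_cases pts R; last by rewrite Dv_away.
  by rewrite (Dv_at rp _ sR); case: s sR => [[]|k] //= sR; [case/negP: nR1|case/negP: nR2].
apply: (ordeq_vl C Rf (a := R 0 i2 / R 0 x)).
  exists 1%N, 'X_i2, 'X_x; rewrite addn0 !evalX; split=> //; exact: dhomogXU.
rewrite mulf_neq0 ?invr_eq0 //; apply/eqP => R0; have [nR fR] := Rf.
move: fR; rewrite curve_polyE !(rmorphD, rmorphM, rmorphXn) /= !evalX R0.
have n0 : (n == 0)%N = false by case: (n) n3.
rewrite expr0n n0 !(mulr0, mul0r, addr0).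
move/eqP; rewrite mulf_eq0 expf_eq0 => /orP[/eqP R00|/andP[_ /eqP R10]].
  have eR : R = R 0 i1 *: geom_point P2.
    apply/rowP; elim/ord3P; rewrite [RHS]mxE geom_P2 /= ?mulr1 ?mulr0 //.
  have n1 : R 0 i1 != 0 by apply: contraNneq nR => r0; rewrite eR r0 scale0r.
  by case/negP: nR2; rewrite eR andbC scale_same_point // submx_refl.
have eR : R = R 0 i0 *: geom_point P1.
  by apply/rowP; elim/ord3P; rewrite [RHS]mxE geom_P1 /= ?mulr1 ?mulr0.
have nR0 : R 0 i0 != 0 by apply: contraNneq nR => r0; rewrite eR r0 scale0r.
by case/negP: nR1; rewrite eR andbC scale_same_point // submx_refl.
Qed.
Local Notation Hz := divZ_order.

Local Notation W := (W n divZ).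
Local Notation gpt s := (geom_point (pts s)).
Implicit Types (A B : bool + 'I_m -> int).

Section Monomials.
Variables (a b e : nat).
Hypothesis abe : (a + b + e = n - 2)%N.
Let x := ev 'X_i0.
Let y := ev 'X_i1.
Let z := ev 'X_i2.

Definition monom : K := x ^+ a * y ^+ b * z ^+ e / z ^+ (n - 2).

Let nx : x != 0. Proof. exact: evX_neq0 C K i0. Qed.
Let ny : y != 0. Proof. exact: evX_neq0 C K i1. Qed.
Let nz : z != 0. Proof. exact: evX_neq0 C K i2. Qed.

Lemma monom_P1 : ordeq (geom_point P1) ((b + e * n)%N%:Z - (n%:Z - 2) * n%:Z) monom.
Proof.
have f1 := curve_P1 G n3; have oy := ordeq_unif C f1 (unif_P1 n3 hG ns K).
have oz := order_Z_P1 n3 hG ns K.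
have := ordeq_div C f1 (ordeqM C f1 (ordeqX C f1 b oy) (ordeqX C f1 e oz)) (ordeqX C f1 (n - 2) oz).
have -> : 1 * b%:Z + n%:Z * e%:Z - n%:Z * (n - 2)%N%:Z = (b + e * n)%N%:Z - (n%:Z - 2) * n%:Z.
  by rewrite -subzn ?(ltnW n3) // PoszD PoszM; ring.
congr ordeq; rewrite /monom -!/x -!/y -!/z !expr_div_n -abe !exprD.
by field; rewrite !expf_neq0.
Qed.

Lemma monom_P2 : ordeq (geom_point P2) ((a * n + e)%N%:Z - (n%:Z - 2)) monom.
Proof.
have f2 := curve_P2 G n3; have oz := ordeq_unif C f2 (unif_P2 n3 hG ns K).
have ox := order_X_P2 n3 hG ns K.
have := ordeq_div C f2 (ordeqM C f2 (ordeqX C f2 a ox) (ordeqX C f2 e oz)) (ordeqX C f2 (n - 2) oz).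
have -> : n%:Z * a%:Z + 1 * e%:Z - 1 * (n - 2)%N%:Z = (a * n + e)%N%:Z - (n%:Z - 2).
  by rewrite -subzn ?(ltnW n3) // PoszD PoszM; ring.
congr ordeq; rewrite /monom -!/x -!/y -!/z !expr_div_n -abe !exprD.
by field; rewrite !expf_neq0.
Qed.

Lemma monom_LL : LL (mkdiv ((n%:Z - 2) * n%:Z - (b + e * n)%N%:Z)
  ((n%:Z - 2) - (a * n + e)%N%:Z) (fun=> 0)) monom.
Proof.
have hW : LL (Hk divZ (n - 2)%N%:Z) monom.
  apply/(LL_Hk C Hz); rewrite /monom divfK ?expf_neq0 //.
  exists ('X_i0 ^+ a * 'X_i1 ^+ b * 'X_i2 ^+ e); last by rewrite !rmorphM !rmorphXn.
  by rewrite -abe; apply: dhomogM (dhomogXUn _ _ _); apply: dhomogM; apply: dhomogXUn.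
have [hs ha] := iffLR (LL_local C rp _ _) hW.
apply/(LL_local C rp); split=> // -[[]|k] /=.
- by rewrite opprB; case: monom_P1.
- by rewrite opprB; case: monom_P2.
- by have := hs (inr k); rewrite /Hk /= mulr0.
Qed.

End Monomials.

(** A differential [eta] corresponds to [v = DO eta / Z^(n - 2)], and its divisor condition to
    membership of [v] in [LL B]. The poles at the [Q k] are at most simple, so [residue_functional]
    applies there, and a residue is zero exactly when the pole is absent. *)
Lemma code_char (a b : int) (E : divisor F) (B := fun s => W s - mkdiv a b (fun=> -1) s) :
    E = (fun R => a * point_divisor P1 R + b * point_divisor P2 R) ->
  exists rho : K -> 'rV[F]_m, [/\
    forall a u v, LL B u -> LL B v -> rho (c a * u + v) = a *: rho u + rho v,
    forall w, w \in goppa_code K Q E <-> exists2 v, LL B v & w = rho v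
    & forall v k, LL B v -> rho v 0 k = 0 <-> ordge (geom_point (Q k)) 0 v].
Proof.
move=> eE; have [D DE] := derivation_exists C K.
pose A := mkdiv a b (fun _ : 'I_m => -1).
pose z := ev 'X_i2; pose h v := v * z ^+ (n - 2).
have nz : z ^+ (n - 2) != 0 by rewrite expf_neq0 ?(evX_neq0 C).
have eW : W = Hk divZ (n - 2)%N%:Z by rewrite /W -subzn // (ltnW n3).
have hB v : LL B v <-> forall P x, on_curve f P -> P 0 x != 0 ->
    ordge P (Dv pts A P) (h v / ev 'X_x ^+ (n - 2)).
  split=> [hv P x Pf Px|hv R Rf].
    by apply/(ordge_zX C Hz _ _ _ Pf Px); rewrite -eW -opprB -DvB; apply: hv.
  have [x [_ [_ [_ _ _ Rx _]]]] := smooth_chart C Rf.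
  by rewrite DvB opprB eW; apply/(ordge_zX C Hz _ _ _ Rf Rx)/hv.
have eDv : (fun R => E R - \sum_k point_divisor (Q k) R) = Dv pts A.
  apply/funext => R; rewrite eE /Dv sum_mkdiv /= -sumrN; congr (_ + _).
  by apply: eq_bigr => k _; rewrite mulN1r.
have /boolp.choice[x Qx] k : exists x, geom_point (Q k) 0 x != 0.
  exact: (point_chart C rp (inr k)).
have /boolp.choice[res resP] k := residue_functional C DE (Qf k) (Qx k).
have pole v k : LL B v -> ordge (geom_point (Q k)) (-1) (h v / ev 'X_(x k) ^+ (n - 2)).
  move=> /hB/(_ _ _ (Qf k) (Qx k)); rewrite (Dv_at rp _ (s := inr k)) //.
  by rewrite /= submx_refl.
have hL (e : F) u v : h (c e * u + v) = c e * h u + h v by rewrite /h mulrDl mulrA.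
exists (fun v => \row_k res k (h v)); split=> [e u v hu hv|w|v k hv].
- by apply/rowP => k; have [lin _ _] := resP k; rewrite !mxE hL lin //; apply: pole.
- rewrite inE asboolE eDv; split=> [[eta [/(differentials_geP C DE) he hr]]|[v hv ->]].
    have hv : h (DO D eta / z ^+ (n - 2)) = DO D eta by rewrite /h divfK.
    have LLv : LL B (DO D eta / z ^+ (n - 2)) by apply/hB; rewrite hv.
    exists (DO D eta / z ^+ (n - 2)) => //; apply/rowP => k.
    have [_ hres _] := resP k; rewrite mxE hv; apply/hres => //.
    by rewrite -hv; apply: pole.
  pose s := ev 'X_i1; have nDs : D s != 0.
    by have := D_generator_neq0 C DE; rewrite (evX0 C) divr1.
  have eh : DO D ((h v / D s) *: kaehler_d c s) = h v.
    by rewrite (DO_scale C DE) (DO_d C DE) divfK.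
  exists ((h v / D s) *: kaehler_d c s); split.
    by apply/(differentials_geP C DE); rewrite eh; apply/hB.
  by move=> k; have [_ hres _] := resP k; apply/hres; rewrite eh ?mxE //; apply: pole.
have [_ _ hres] := resP k; rewrite mxE hres; last exact: pole.
rewrite -(ordge_zX C Hz _ _ _ (Qf k) (Qx k)) -eW sub0r.
by rewrite (Dv_at rp _ (s := inr k)) ?submx_refl // eW /Hk /= mulr0.
Qed.

(** [v] is the difference of preimages of the two words; where the words agree its residue is zero,
    so it has no pole. *)
Lemma goppa_word (a b : int) (E : divisor F) w w' :
    E = (fun R => a * point_divisor P1 R + b * point_divisor P2 R) ->
    w \in goppa_code K Q E -> w' \in goppa_code K Q E -> w != w' ->
  exists2 v : K, v != 0 &
    LL (fun s => W s - mkdiv a b (fun k => - ((w 0 k != w' 0 k) : nat)%:Z) s) v.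
Proof.
move=> eE; have [rho [rhoL codeP rho0]] := code_char eE.
move=> /codeP[u hu ->] /codeP[u' hu' ->] nuu'; pose v := c (-1) * u' + u.
have hv : LL (fun s => W s - mkdiv a b (fun=> -1) s) v.
  by have [_ lin] := LL_subsp C K pts (fun s => W s - mkdiv a b (fun=> -1) s); apply: lin.
exists v.
  apply: contraNneq nuu' => v0; suff -> : u = u' by [].
  by apply/eqP; rewrite -subr_eq0 -v0 /v rmorphN rmorph1 mulN1r addrC.
have [hs ha] := iffLR (LL_local C rp _ _) hv; apply/(LL_local C rp); split=> //.
move=> [[]|k]; [exact: (hs (inl true))|exact: (hs (inl false))|].
have := hs (inr k); rewrite /W /Hk /= mulr0 !sub0r !opprK.
have [euu' _|//] := eqVneq (rho u 0 k) (rho u' 0 k).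
rewrite /= oppr0; apply/(rho0 _ _ hv).
by rewrite /v rhoL // !mxE euu' mulN1r addNr.
Qed.

Variable ell : (bool + 'I_m -> int) -> nat.
Hypothesis ellP : forall A, hasdim c (LL A) (ell A).

Lemma deg_W : deg W = (n%:Z - 2) * n.+1%:Z.
Proof. by rewrite (deg_Hk deg_divZ). Qed.

Lemma riemann_roch_pts A : (forall k, -1 <= A (inr k) <= 1) ->
  (ell A)%:Z = deg A + 1 - 'C(n, 2)%:Z + (ell (fun s => W s - A s))%:Z.
Proof.
(* Large enough for [A] to lie between [W - top k] and [top k] at [P1] and [P2]; at the other points
   these bounds are -1 and 1. *)
move=> hA; pose k := (`|A (inl true)| + `|A (inl false)| + n.+1)%N.
apply: (riemann_roch C rp divZ_ge0 deg_divZ Hz ellP (k := k)).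
- by rewrite /k; clear; lia.
- case=> [[]|l]; rewrite /W /top /Hk /=; last by have := hA l; move: (A _); clear; lia.
    by rewrite /k; move: (A (inl true)) (A (inl false)) n3; clear => a b; nia.
  by rewrite /k; move: (A (inl true)) (A (inl false)) n3; clear => a b; nia.
- case=> [[]|l]; rewrite /W /top /Hk /=; last by have := hA l; move: (A _); clear; lia.
    by rewrite /k; move: (A (inl true)) (A (inl false)) n3; clear => a b; nia.
  by rewrite /k; move: (A (inl true)) (A (inl false)) n3; clear => a b; nia.
Qed.

Lemma LL_neg_degree_pts A v : (forall k, -1 <= A (inr k) <= 1) ->
  deg A < 0 -> LL A v -> v = 0.
Proof.
move=> hA; pose a := A (inl true); pose b := A (inl false).
pose k := (`|a| + `|b| + n.+1)%N.
(* Where [A] is -1 at some [Q l], [B] is raised to 1, so that both [B] and [A + B] stay in the range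
   where the excess vanishes. *)
pose B s := Hk divZ k%:Z s + if s is inr l then Num.max 0 (- A (inr l)) else 0.
have exc A' : (forall s, Hk divZ n.+1%:Z s <= A' s) ->
    (forall s, A' s <= top divZ (k + k) s) -> excess n ell A' = 0.
  by apply: (excess_between C rp deg_divZ Hz ellP) => //; rewrite /k; clear; lia.
apply: (LL_neg_degree C ellP (B := B)); apply: exc.
- case=> [[]|l]; rewrite /B /Hk /=; last by have := hA l; move: (A _); clear; lia.
    by rewrite addr0 ler_wpM2r // /k; clear; lia.
  by rewrite addr0 ler_wpM2r // /k; clear; lia.
- case=> [[]|l]; rewrite /B /top /Hk /=; last by have := hA l; move: (A _); clear; lia.
    by rewrite /k; clear; nia.
  by rewrite /k; clear; lia.
- case=> [[]|l]; rewrite /B /Hk /=; last by have := hA l; move: (A _); clear; lia.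
    by rewrite -/a /k; move: (a) (b) n3; clear => a b; nia.
  by rewrite -/b /k; move: (a) (b) n3; clear => a b; lia.
- case=> [[]|l]; rewrite /B /top /Hk /=; last by have := hA l; move: (A _); clear; lia.
    by rewrite -/a /k; move: (a) (b) n3; clear => a b; nia.
  by rewrite -/b /k; move: (a) (b) n3; clear => a b; lia.
Qed.

Lemma goppa_dimension (a b : int) (E : divisor F) :
    E = (fun R => a * point_divisor P1 R + b * point_divisor P2 R) ->
    deg W < a + b -> a + b < m%:Z ->
  exists2 V : {vspace 'rV[F]_m}, forall w, (w \in V) = (w \in goppa_code K Q E)
    & (\dim V)%:Z = m%:Z + deg W - a - b + 1 - 'C(n, 2)%:Z.
Proof.
move=> eE ltW ltm; have [rho [rhoL codeP rho0]] := code_char eE.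
set B := (fun s => _) in rhoL codeP rho0; have [bv fb hb] := ellP B.
have LLb x : LL B (comb c bv x) by apply/hb; exists x.
pose psi x := rho (comb c bv x).
have psiL : linear psi by move=> e x y; rewrite /psi comb_lin; apply: rhoL.
pose p : {linear 'rV[F]_(ell B) -> 'rV[F]_m} := HB.pack psi (GRing.isLinear.Build _ _ _ _ psi psiL).
exists (limg (linfun p)) => [w|].
  apply/memv_imgP/idP => [[x _ ->]|/codeP[v /hb[x ->] ->]].
    by rewrite lfunE; apply/codeP; exists (comb c bv x).
  by exists x; rewrite ?memvf // lfunE.
have deg0 : deg (mkdiv a b (fun _ : 'I_m => 0)) = a + b.
  by rewrite deg_mkdiv big1 // addr0.
have deg1 : deg (mkdiv a b (fun _ : 'I_m => -1)) = a + b - m%:Z.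
  by rewrite deg_mkdiv sumr_const card_ord mulNrn natz.
(* Injectivity: zero residues leave [v] without poles at the [Q k], hence in L(W - E), of negative
   degree. *)
rewrite limg_dim_eq; last first.
  apply/eqP; rewrite -subv0; apply/subvP => x; rewrite memv_cap memvf /=.
  rewrite memv_ker (lfunE p x) => /eqP px0; rewrite memv0; apply/eqP/fb.
  apply: (LL_neg_degree_pts (A := fun s => W s - mkdiv a b (fun=> 0) s)) => [k||].
  - by rewrite /W /Hk /= mulr0.
  - by rewrite degB deg0 subr_lt0.
  apply/(LL_local C rp); have [hs ha] := iffLR (LL_local C rp _ _) (LLb x).
  split=> // -[[]|k]; [exact: (hs (inl true))|exact: (hs (inl false))|].
  rewrite /W /Hk /= mulr0 subr0 oppr0; apply/(rho0 _ _ (LLb x)).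
  by rewrite -/(psi x) -[psi x]/(p x) px0 mxE.
have hW k : W (inr k) = 0 by rewrite /W /Hk /= mulr0.
rewrite dimvf /dim /= mul1n (riemann_roch_pts (A := B)); last by move=> k; rewrite /B hW.
have -> : (fun s => W s - B s) = mkdiv a b (fun=> -1).
  by apply/funext => s; rewrite /B opprB addrC subrK.
(* The correction term of Riemann-Roch is the dimension of L(E - D), again of negative degree. *)
rewrite (ell_zero C ellP); last first.
  by move=> v; apply: LL_neg_degree_pts; rewrite // deg1 subr_lt0.
by rewrite /B degB deg1; move: (deg W) ('C(n, 2)); clear => w z; lia.
Qed.

Variables (i j : nat).
Hypotheses (i_gt0 : (1 <= i)%N) (j_gt0 : (1 <= j)%N) (ijn : (i + j <= n - 1)%N).

(** The windows from [al1] to [be1] and from [al2] to [be2] contain [p] and [p + 1] integers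
    ([be_window]); [N] counts both. *)
Let p := (n - (i + j))%N.
Let N := (p + p.+1)%N.
Let be1 : int := i%:Z * n%:Z - i%:Z - j%:Z.
Let be2 : int := j%:Z * n%:Z - j%:Z.
Let al1 : int := (i%:Z - 1) * n%:Z + 1.
Let al2 : int := (j%:Z - 1) * n%:Z + i%:Z.
Let be : bool + 'I_m -> int := mkdiv be1 be2 (fun=> 0).

Lemma WE : W = mkdiv ((n%:Z - 2) * n%:Z) (n%:Z - 2) (fun=> 0).
Proof. by apply/funext => -[[]|k]; rewrite /W /Hk /= ?mulr1 ?mulr0. Qed.

Lemma abeE1 l : (l < p)%N -> (n - 1 - i - l + l + (i - 1) = n - 2)%N.
Proof. by rewrite /p; move: i_gt0 j_gt0 ijn n3; clear; lia. Qed.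

Lemma abeE2 l : (l < p.+1)%N -> (j - 1 + (p - l) + (i - 1 + l) = n - 2)%N.
Proof. by rewrite /p; move: i_gt0 j_gt0 ijn n3; clear; lia. Qed.

(** The numerator vanishes at [P1] to order [l + (i - 1) n = al1 - 1 + l]: one monomial for each
    place of the first window. *)
Definition M1 l : K := monom (n - 1 - i - l) l (i - 1).
(** The numerator vanishes at [P2] to order [(j - 1) n + i - 1 + l = al2 - 1 + l]. *)
Definition M2 l : K := monom (j - 1) (p - l) (i - 1 + l).

Lemma M1_P1 l : (l < p)%N -> ordeq (gpt (inl true)) (al1 - 1 + l%:Z - W (inl true)) (M1 l).
Proof.
move=> ltl; have := monom_P1 (abeE1 ltl); rewrite WE /=; congr ordeq.
rewrite /al1; move: i_gt0; clear; case: (i) => // i' _; rewrite !subSS !subn0; lia.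
Qed.

Lemma M2_P2 l : (l < p.+1)%N -> ordeq (gpt (inl false)) (al2 - 1 + l%:Z - W (inl false)) (M2 l).
Proof.
move=> ltl; have := monom_P2 (abeE2 ltl); rewrite WE /=; congr ordeq.
rewrite /al2; move: i_gt0 j_gt0; clear; case: (j) => // j'; case: (i) => // i' _ _; rewrite !subSS !subn0; lia.
Qed.

(** At [P2], the bound by [be2] absorbs the pole that a function of L(be) may have there, and the
    bound by [al2] places [M1 l] in the space where the combination is sought. Both hold because
    [l < p] leaves X an exponent of at least [j]. *)
Lemma M1_LL l : (l < p)%N -> exists B, [/\ LL B (M1 l),
  B (inl true) = W (inl true) - al1 + 1 - l%:Z, B (inl false) <= W (inl false) - be2,
  B (inl false) <= W (inl false) - al2 + 1 & forall k, B (inr k) = 0].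
Proof.
move=> ltl; have h := monom_LL (abeE1 ltl).
eexists; split; first exact: h.
all: rewrite ?WE //=.
- by rewrite /al1; move: i_gt0; clear; case: (i) => // i' _; rewrite !subSS !subn0; lia.
- rewrite /be2; have : (j <= n - 1 - i - l)%N by move: ltl; rewrite /p; clear; lia.
  by move: (n - 1 - i - l)%N => t; clear; nia.
- rewrite /al2; have : (j <= n - 1 - i - l)%N by move: ltl; rewrite /p; clear; lia.
  by move: (n - 1 - i - l)%N i_gt0 => t; clear; nia.
Qed.

Lemma M2_LL l : (l < p.+1)%N -> exists B, [/\ LL B (M2 l),
  B (inl false) = W (inl false) - al2 + 1 - l%:Z, B (inl true) <= W (inl true) - be1,
  B (inl true) <= W (inl true) - al1 + 1 & forall k, B (inr k) = 0].
Proof.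
move=> ltl; have h := monom_LL (abeE2 ltl).
eexists; split; first exact: h.
all: rewrite ?WE //=.
- by rewrite /al2; move: i_gt0 j_gt0; clear; case: (j) => // j'; case: (i) => // i' _ _; rewrite !subSS !subn0; lia.
- by rewrite /be1; move: ltl i_gt0 ijn n3; rewrite /p; clear; nia.
- by rewrite /al1; move: ltl i_gt0 ijn n3; rewrite /p; clear; nia.
Qed.

Lemma be_window : be1 = al1 + p%:Z - 1 /\ be2 = al2 + p.+1%:Z - 1.
Proof. by rewrite /be1 /be2 /al1 /al2 /p; move: ijn n3; clear; lia. Qed.

Lemma distance_degree (e : 'I_m -> int) (v : K)
    (A := fun s => W s - mkdiv (al1 + be1 - 1) (al2 + be2 - 1) (fun k => - e k) s) :
  (forall k, 0 <= e k <= 1) -> v != 0 -> LL A v -> N%:Z <= deg A.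
Proof.
move=> he nv hv; rewrite leNgt; apply/negP => ltN.
have [eb1 eb2] := be_window; have Wr k : W (inr k) = 0 by rewrite WE.
pose AB s := A s + be s.
have dAB : deg AB = deg A + deg be by rewrite /deg big_split.
have Ar k : A (inr k) = e k by rewrite /A Wr /= sub0r opprK.
have rr1 := riemann_roch_pts (A := be).
have rr2 := riemann_roch_pts (A := AB).
have leWA : (ell (fun s => W s - AB s)%R <= ell (fun s => W s - be s)%R)%N.
  have := ell_mul C ellP (fun s => W s - AB s)%R nv hv; congr (_ <= ell _)%N.
  by apply/funext => s; rewrite /AB; move: (W s) (A s) (be s); clear; lia.
(* In the difference of the two Riemann-Roch formulas the correction terms compare by [leWA], so
   [ell AB] exceeds [ell be] by at most [deg A]. *)
have ltE : (ell AB < ell be + N)%N.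
  have hAB k : -1 <= AB (inr k) <= 1.
    by rewrite /AB Ar /= addr0; have := he k; move: (e k); clear; lia.
  have h1 := rr1 (fun=> isT); have h2 := rr2 hAB.
  move: h1 h2 leWA ltN; rewrite dAB; move: (deg A) (deg be) (ell AB) (ell be).
  by move: (ell _) (ell _) 'C(n, 2) (N); clear; lia.
pose w1 : 'cV[K]_p := \col_(l < p) M1 l; pose w2 : 'cV[K]_p.+1 := \col_(l < p.+1) M2 l.
have wAB l : LL AB (col_mx w1 w2 l 0).
  case: (split_ordP l) => l' ->; rewrite ?col_mxEu ?col_mxEd mxE.
    have [B [hB B1 _ B2 B3]] := M1_LL (ltn_ord l').
    apply: (LL_le C) hB => -[[]|k]; rewrite /AB ?B3 ?Ar /=.
    - by rewrite B1 /A /=; move: (W _); clear; lia.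
    - by move: B2; rewrite /A /=; move: (W _); clear; lia.
    - by have := he k; move: (e k); clear; lia.
  have [B [hB B1 _ B2 B3]] := M2_LL (ltn_ord l').
  apply: (LL_le C) hB => -[[]|k]; rewrite /AB ?B3 ?Ar /=.
  - by move: B2; rewrite /A /=; move: (W _); clear; lia.
  - by rewrite B1 /A /=; move: (W _); clear; lia.
  - by have := he k; move: (e k); clear; lia.
have sub u : LL be (u / v) -> LL AB u.
  by move=> hu; have := LL_mul C hv hu; rewrite mulrC divfK.
have [x nx hx] := hasdim_dep (hasdim_scale nv (ellP be)) (ellP AB) sub wAB ltE.
have yv : comb c (col_mx w1 w2) x / v * v = comb c w1 (lsubmx x) + comb c w2 (rsubmx x).
  rewrite divfK // -{1}[x]hsubmxK /comb map_row_mx mul_row_col mxE; reflexivity.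
have [hs _] := iffLR (LL_local C rp _ _) hv.
have f1 := rp_on rp (inl true); have f2 := rp_on rp (inl false).
(* If the combination involves only the second family, its leading term is examined at [P2];
   otherwise at [P1]. *)
have [x1|x1] := eqVneq (lsubmx x) 0.
  have x2 : rsubmx x != 0 by apply: contraNneq nx => x2; rewrite -[x]hsubmxK x1 x2 row_mx0.
  have [l0 ol] : exists l0 : 'I_p.+1, ordeq (gpt (inl false)) (al2 - 1 - W (inl false) + l0%:Z)
      (comb c w2 (rsubmx x)).
    by apply: (comb_order C) => // l; rewrite mxE addrAC; apply: M2_P2.
  apply: (gap_window C rp Hz (al := al2) (s := inl false) hx eb2 (ltn_ord l0)).
  - have := hs (inl false); congr ordge; rewrite /A /=; move: (W _); clear; lia.
  - by rewrite yv x1 comb0 add0r addrAC.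
  move=> l ltl; have [B [hB B1 B2 _ B3]] := M2_LL ltl; exists (M2 l), B; split=> //.
    exact: M2_P2.
  case=> [[]|k] // _; last by rewrite B3 Wr.
  by move: B2; rewrite /=; move: (W _); clear; lia.
have [l0 ol] : exists l0 : 'I_p, ordeq (gpt (inl true)) (al1 - 1 - W (inl true) + l0%:Z)
    (comb c w1 (lsubmx x)).
  by apply: (comb_order C) => // l; rewrite mxE addrAC; apply: M1_P1.
apply: (gap_window C rp Hz (al := al1) (s := inl true) hx eb1 (ltn_ord l0)).
- have := hs (inl true); congr ordge; rewrite /A /=; move: (W _); clear; lia.
(* The second family does not disturb the leading term at [P1]: its order there is at least
   [be1 - W], above [al1 - 1 + l0 - W] since [l0 < p]. *)
- rewrite yv addrAC; apply: (ordeqD C) => //; rewrite combE; apply: (ordge_sum C f1) => l _.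
  apply: (ordgeZ C f1); rewrite mxE; have [B [hB _ B1 _ _]] := M2_LL (ltn_ord l).
  have [h _] := iffLR (LL_local C rp _ _) hB; apply: (ordge_le C) (h (inl true)).
  by move: B1 (ltn_ord l0); rewrite eb1; move: (W _) (B _); clear; lia.
move=> l ltl; have [B [hB B1 B2 _ B3]] := M1_LL ltl; exists (M1 l), B; split=> //.
  exact: M1_P1.
case=> [[]|k] // _; last by rewrite B3 Wr.
by move: B2; rewrite /=; move: (W _); clear; lia.
Qed.

End GoppaCode.

Theorem theorem6p1 (F : finFieldType) (n : nat) (G : {mpoly F[3]})
  (K : function_field (curve_poly n G)) (i j m : nat) (Q : 'I_m -> 'rV[F]_3)
  (alpha1 := (i%:Z - 1) * n%:Z + 1) (alpha2 := (j%:Z - 1) * n%:Z + i%:Z)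
  (beta1 := i%:Z * n%:Z - i%:Z - j%:Z) (beta2 := j%:Z * n%:Z - j%:Z)
  (F1 : divisor F := fun R => (alpha1 + beta1 - 1) * point_divisor P1 R
                            + (alpha2 + beta2 - 1) * point_divisor P2 R) :
  (3 <= n)%N ->
  G \is (n - 2).-homog ->
  nonsingular (curve_poly n G) ->
  (1 <= i)%N -> (1 <= j)%N -> (i + j <= n - 1)%N ->
  (forall k, on_curve (curve_poly n G) (geom_point (Q k))) ->
  (forall k l, k != l -> ~~ (Q k == Q l)%MS) ->
  (forall k, ~~ (Q k == P1)%MS /\ ~~ (Q k == P2)%MS) ->
  (n + 2 <= 2 * (i + j))%N ->
  2 * n%:Z ^+ 2 - 4 * n%:Z - 2 <= m%:Z ->
  (exists2 C : {vspace 'rV[F]_m},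
     (forall c, (c \in C) = (c \in goppa_code K Q F1))
     & (\dim C)%:R = m%:R + 2^-1 * n%:R ^+ 2
         + (3 / 2 - 2 * (i + j)%:R) * n%:R + 2 * j%:R :> rat)
  /\ (2 * (i + j)%:Z + 1) * n%:Z - n%:Z ^+ 2 - 2 * i%:Z - 4 * j%:Z + 2
       <= (min_distance (goppa_code K Q F1))%:Z.
Proof.
move=> n3 hG ns i_gt0 j_gt0 ijn Qf Qne QP nij mn.
pose C := curve_smooth n3 hG ns; pose rp := pts_rational n3 Qf Qne QP.
have [ell ellP] := ell_exists C rp (divZ_order n3 hG ns K Qf Qne QP).
have dW := deg_W n m.
have degF1 : alpha1 + beta1 - 1 + (alpha2 + beta2 - 1)
    = (2 * (i + j)%:Z - 2) * n%:Z - 2 * j%:Z - 1.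
  by rewrite /alpha1 /beta1 /alpha2 /beta2 PoszD; ring.
split.
  have [||V codeV dV] := goppa_dimension n3 hG ns Qf Qne QP ellP (erefl F1).
  (* The lower bound on [i + j] enters here, making [W - F1] of negative degree. *)
  - by rewrite dW degF1; clear -n3 i_gt0 j_gt0 ijn nij; nia.
  (* As [i + j <= n - 1] and [j >= 1], the degree of [F1] is at most [2 n^2 - 4 n - 3], just below
     the lower bound on [m]. *)
  - by rewrite degF1; clear -n3 i_gt0 j_gt0 ijn mn; nia.
  exists V => //; have [_ eC] := bin2_lt n.
  have {}dV : (\dim V)%:Z = m%:Z + (n%:Z - 2) * n.+1%:Z
      - ((2 * (i + j)%:Z - 2) * n%:Z - 2 * j%:Z - 1) + 1 - 'C(n, 2)%:Z.
    by rewrite dV dW -degF1; ring.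
  have {}eC : 'C(n, 2)%:Z * 2 = n%:Z * (n%:Z - 1) by clear -eC n3; nia.
  (* Doubled, so that the formula holds in the integers before the passage to the rationals. *)
  have dV2 : 2 * (\dim V)%:Z
      = 2 * m%:Z + n%:Z ^+ 2 + (3 - 4 * (i + j)%:Z) * n%:Z + 4 * j%:Z.
    by clear -dV eC; nia.
  have := congr1 (fun z : int => z%:~R : rat) dV2.
  rewrite /= !(rmorphD, rmorphB, rmorphM, rmorphXn) /= => e.
  apply: (@mulfI _ (2 : rat)) => //; rewrite [LHS]e; by field.
rewrite /min_distance; elim/big_ind: _ => [|d d' hd hd'|[w w'] /= /and3P[hw hw' nww']].
(* [min_distance] starts from the default value [m], which must itself satisfy the bound. *)
- by clear -n3 i_gt0 j_gt0 ijn mn; nia.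
- by case: (leqP d d').
have [v nv hv] := goppa_word n3 hG ns Qf Qne QP (erefl F1) hw hw' nww'.
have ew : \sum_k ((w 0 k != w' 0 k) : nat)%:Z = (hamming_dist w w')%:Z.
  rewrite -(big_morph Posz PoszD (erefl 0%:Z)) /hamming_dist -sum1dep_card [in RHS]big_mkcond.
  by congr Posz; apply: eq_bigr => k _; case: (_ != _).
(* Here [deg A] is [deg W - deg F1] plus the Hamming distance, so the inequality rearranges to the
   bound. *)
have := distance_degree n3 hG ns Qf Qne QP ellP i_gt0 j_gt0 ijn _ nv hv.
have hb k : 0 <= ((w 0 k != w' 0 k) : nat)%:Z <= 1 by case: (_ != _).
rewrite degB dW deg_mkdiv degF1 sumrN ew => /(_ hb) le.
by clear -le ijn n3; lia.
Qed.
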